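(* Let $0<q<1$, $\psi\in\mathbb{R}$, and let $a,b,c,u,t$ be nonzero complex numbers with $|a|\le1$, $|b|<1$, $|u|\le1$ and $1<|t|<|abu|^{-1}$, where $u$ is such that $\tfrac12(u+u^{-1})$ is a spectral point, i.e. either $|u|=1$, or $|u|<1$ and $u\in ac\,q^{\mathbb{Z}}$. Then $$ \sum_{n=-\infty}^\infty {}_2\varphi_1\!\left({be^{-i\psi},\ qe^{-i\psi}/c\atop bq/c};q,\,cq^{-n}e^{i\psi}\right)\,{}_2\varphi_1\!\left({ae^{i\psi}/u,\ aue^{i\psi}\atop a^2};q,\,cq^{-n}e^{-i\psi}\right)t^n $$ $$ =\frac{(q,\,be^{-i\psi},\,ce^{i\psi}/t,\,a^2bte^{i\psi},\,bqt/c,\,acu,\,ac/u;q)_\infty}{(ce^{i\psi},\,ce^{-i\psi},\,a^2ce^{i\psi},\,bq/c,\,1/t,\,abtu,\,abt/u;q)_\infty}\; {}_8W_7\big(a^2ce^{i\psi}/q;\,aue^{i\psi},ae^{i\psi}/u,ce^{i\psi},a^2t,c/bt;\,q,\,be^{-i\psi}\big). $$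
   Context: Notation: $(x;q)_k=\prod_{j=0}^{k-1}(1-xq^j)$ for $k\in\mathbb{Z}_{\ge0}\cup\{\infty\}$, $(x_1,\dots,x_r;q)_k=\prod_i(x_i;q)_k$; $q^{\mathbb{Z}}=\{q^j:j\in\mathbb{Z}\}$; $ac\,q^{\mathbb{Z}}=\{acq^j:j\in\mathbb{Z}\}$; $c/bt$ means $c/(bt)$. $${}_2\varphi_1\!\left({A,B\atop C};q,z\right)=\sum_{k=0}^\infty\frac{(A,B;q)_k}{(q,C;q)_k}z^k\quad(|z|<1),$$ and for other $z$ the symbol denotes the analytic continuation (meromorphic in $z\in\mathbb{C}$ with poles contained in $\{q^{-j}:j\in\mathbb{Z}_{\ge0}\}$). $${}_{8}W_7(a_1;a_4,\dots,a_8;q,z)=\sum_{k=0}^\infty\frac{1-a_1q^{2k}}{1-a_1}\,\frac{(a_1,a_4,\dots,a_8;q)_k}{(q,a_1q/a_4,\dots,a_1q/a_8;q)_k}\,z^k\quad(|z|<1).$$ As usual, parameters are understood to be such that the expressions are defined: $ce^{\pm i\psi}\notin q^{\mathbb{Z}}$ and no denominator vanishes, except that when $ac/u=q^{-j}$ with $j\in\mathbb{Z}_{\ge0}$ the product of the prefactor and the ${}_8W_7$ is read termwise, using $(ac/u;q)_\infty/(ac/u;q)_k=(acq^k/u;q)_\infty$. *)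

(* Defs.v *)
(* Standard library reals together with Coquelicot (complex numbers, series). *)
From Stdlib Require Import Reals ZArith List.
From Coquelicot Require Import Coquelicot.
Import ListNotations.

Open Scope R_scope.
Open Scope C_scope.

(* [the P] is the unique complex number satisfying [P] (see [iota_correct]);
   nothing is claimed about it when there is no such number. *)
Definition the (P : C -> Prop) : C := iota (T := C_CompleteNormedModule) P.

(* Convergence of a complex series, and its sum. *)
Definition is_Cseries (f : nat -> C) (s : C) : Prop :=
  is_series (K := C_AbsRing) (V := C_NormedModule) f s.

Definition Cseries (f : nat -> C) : C := the (is_Cseries f).

(* A two-sided series converges when its two halves converge separately. *)
Definition is_Zseries (f : Z -> C) (s : C) : Prop :=
  exists s1 s2 : C,
    is_Cseries (fun n : nat => f (Z.of_nat n)) s1 /\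
    is_Cseries (fun n : nat => f (- Z.of_nat (S n))%Z) s2 /\
    s = s1 + s2.

Definition Cpowz (z : C) (n : Z) : C :=
  match n with
  | Z0 => 1
  | Zpos p => z ^ Pos.to_nat p
  | Zneg p => / (z ^ Pos.to_nat p)
  end.

(* cis x = e^{i x} *)
Definition cis (x : R) : C := (cos x, sin x).

Fixpoint qpoch (q x : C) (k : nat) : C :=
  match k with
  | O => 1
  | S k' => qpoch q x k' * (1 - x * q ^ k')
  end.

Definition qpoch_inf (q x : C) : C :=
  the (fun l => filterlim (qpoch q x) eventually (locally l)).

Definition Cprod (l : list C) : C := fold_right Cmult (RtoC 1) l.

Definition qpochs (q : C) (xs : list C) (k : nat) : C :=
  Cprod (map (fun x => qpoch q x k) xs).

Definition qpochs_inf (q : C) (xs : list C) : C :=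
  Cprod (map (qpoch_inf q) xs).

(* No factor 1 - x q^j of (x;q)_k or (x;q)_oo vanishes, so that the symbol may
   stand in a denominator. *)
Definition qregular (q x : C) : Prop := forall j : nat, x * q ^ j <> 1.

(* w lies in x q^Z *)
Definition in_qZ (q x w : C) : Prop := exists j : Z, w = x * Cpowz q j.

Definition analytic_at (F : C -> C) (z0 : C) : Prop :=
  exists (alpha : nat -> C) (r : R),
    (0 < r)%R /\
    forall z : C, (Cmod (z - z0) < r)%R ->
      is_Cseries (fun k : nat => alpha k * (z - z0) ^ k) (F z).

Definition phi21_term (q A B D z : C) (k : nat) : C :=
  qpochs q [A; B] k / qpochs q [q; D] k * z ^ k.

(* F is the analytic continuation of the series 2phi1(A, B; D; q, .) from the
   unit disc to the complement of {q^{-j} : j >= 0}; this complement being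
   connected, the values of F on it are determined. *)
Definition phi21_continuation (q A B D : C) (F : C -> C) : Prop :=
  (forall z : C, (Cmod z < 1)%R -> is_Cseries (phi21_term q A B D z) (F z)) /\
  (forall z : C, (forall j : nat, z <> / (q ^ j)) -> analytic_at F z).

(* 2phi1(A, B; D; q, z), for z not of the form q^{-j} with j >= 0. *)
Definition phi21 (q A B D z : C) : C :=
  the (fun w => exists F : C -> C, phi21_continuation q A B D F /\ F z = w).

(* 8W7(a1; a4, ..., a8; q, z) *)
Definition W87 (q a1 a4 a5 a6 a7 a8 z : C) : C :=
  Cseries (fun k : nat =>
    (1 - a1 * q ^ (2 * k)) / (1 - a1) *
    (qpochs q [a1; a4; a5; a6; a7; a8] k /
     qpochs q [q; a1 * q / a4; a1 * q / a5; a1 * q / a6; a1 * q / a7;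
               a1 * q / a8] k) *
    z ^ k).

(* The product (a1 q/a4; q)_oo * 8W7(a1; a4, ..., a8; q, z) read termwise: in
   the k-th term (a1 q/a4; q)_oo / (a1 q/a4; q)_k is (a1 q^{k+1}/a4; q)_oo. *)
Definition W87_termwise (q a1 a4 a5 a6 a7 a8 z : C) : C :=
  Cseries (fun k : nat =>
    (1 - a1 * q ^ (2 * k)) / (1 - a1) *
    (qpochs q [a1; a4; a5; a6; a7; a8] k /
     qpochs q [q; a1 * q / a5; a1 * q / a6; a1 * q / a7; a1 * q / a8] k *
     qpoch_inf q (a1 * q / a4 * q ^ k)) *
    z ^ k).

(* Main.v *)
Require Import Defs.
From Stdlib Require Import Reals ZArith List Lra Lia IndefiniteDescription.
From Coquelicot Require Import Coquelicot.
Import ListNotations.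
Open Scope R_scope.
Open Scope C_scope.

(** Write [e = e^(i psi)], [y = b t], [tau = 1/t], and let [phi] be the second
    2phi1, continued to the complement of its poles.

    Why the identity holds. At the points [c q^(-n) e] the continued first 2phi1
    is a constant times the coefficient of [s^n] in the Laurent series of
    [(c e/s, b q s/c;q)_oo / (1/s, b s/e;q)_oo] ([laurent_expansion_pos],
    [laurent_expansion_neg]). Hence the bilateral sum is the same constant times
    the double series over [l, m >= 0] with the terms
    [(q e/c;q)_l/(q;q)_l (y/e)^l (c e;q)_m/(q;q)_m tau^m phi((c/e) q^(m - l))],
    summed along the lines [l - m = n] ([double_series_by_difference]). For fixed
    [tau] this is a power series in [y] whose coefficients do not contain [b]
    ([double_sum_has_ps]). The right-hand side is treated alike: multiplied by
    [(a u y, a y/u;q)_oo] and a constant, it becomes a power series in [y]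
    without [b] ([vwp_sum_has_ps]). So it suffices to compare the two at
    [y = c q^j] for large [j], because these points accumulate at [0]
    ([power_series_identity]). There the 8W7 terminates, and the transformation
    of [watson] turns it into a balanced 4phi3; it is proved from the q-analogue
    of the Saalschuetz sum and the terminating 6phi5. In the double series at
    such a point, the sum over [l] is a convergent rearrangement of Euler's series
    and collapses to a finite sum ([terminating_sum]), the sum over [m] is a
    q-binomial series, and the same 4phi3 appears.

    Why everything converges. The transformation of Jackson writes the 2phi1 as
    an entire function, with coefficients of Gaussian decay, over [(z;q)_oo]
    ([jackson_transformation], [jackson_entire]). This quotient is the analytic
    continuation ([phi21_jackson]); uniqueness holds since any point other than a
    pole is joined to the unit disc by a segment free of poles. The same form
    bounds [phi((c/e) q^(-l))] by a constant times [rho^l] for every [rho] larger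
    than [|a/u|] and [|a u|] ([jackson_growth]). The condition [|t| < 1/|a b u|]
    demands the rate [|a u|]. If [|u| = 1] the two rates coincide. If [|u| < 1],
    the assumption that [u] lies in [a c q^Z] says that the grid of [phi] has the
    special form of the Laurent expansion above, on which the larger rate does not
    occur ([laurent_growth], [spectral_growth]). *)

Ltac nonneg :=
  repeat first [lra | assumption | apply Cmod_ge_0 | apply Rmult_le_pos | apply pow_le
    | apply Rdiv_le_0_compat; [|solve [pos]]]
with pos :=
  repeat first [lra | assumption | apply exp_pos | apply Rinv_0_lt_compat
    | apply Rmult_lt_0_compat | apply pow_lt | apply Rdiv_lt_0_compat
    | apply Cmod_gt_0; assumption].

(** * Complex sequences and series *)

Definition Cconv (u : nat -> C) (l : C) : Prop :=
  forall eps : R, (0 < eps)%R ->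
    exists N : nat, forall n : nat, (N <= n)%nat -> (Cmod (u n - l) < eps)%R.

Fixpoint csum (f : nat -> C) (n : nat) : C :=
  match n with O => 0 | S n' => csum f n' + f n' end.

Fixpoint rsum (f : nat -> R) (n : nat) : R :=
  match n with O => 0%R | S n' => (rsum f n' + f n')%R end.

Lemma Cmod_minus_sym (x y : C) : Cmod (x - y) = Cmod (y - x).
Proof. replace (x - y) with (- (y - x)) by ring. apply Cmod_opp. Qed.

Lemma filterlim_Cconv (u : nat -> C) (l : C) :
  filterlim u eventually (locally l) <-> Cconv u l.
Proof.
  split.
  - intros H eps Heps.
    assert (Hl : locally l (fun y => (Cmod (y - l) < eps)%R)).
    { apply (locally_le_locally_norm (V := C_NormedModule)).
      exists (mkposreal eps Heps). intros y Hy. exact Hy. }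
    destruct (H _ Hl) as [N HN]. exists N. exact HN.
  - intros H P HP.
    apply (locally_norm_le_locally (V := C_NormedModule)) in HP.
    destruct HP as [eps HP].
    destruct (H eps (cond_pos eps)) as [N HN].
    exists N. intros n Hn. apply HP. exact (HN n Hn).
Qed.

Lemma sum_n_csum (f : nat -> C) (n : nat) :
  sum_n (G := C_AbelianMonoid) f n = csum f (S n).
Proof.
  induction n as [|n IH].
  - rewrite sum_O. simpl. change C with (AbelianMonoid.sort C_AbelianMonoid).
    simpl. ring.
  - rewrite sum_Sn, IH. reflexivity.
Qed.

Lemma Cconv_ext (u v : nat -> C) (l : C) :
  (forall n, u n = v n) -> Cconv u l -> Cconv v l.
Proof.
  intros E H eps Heps. destruct (H eps Heps) as [N HN].
  exists N. intros n Hn. rewrite <- E. auto.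
Qed.

Lemma Cconv_shift (u : nat -> C) (l : C) (k : nat) :
  Cconv u l -> Cconv (fun n => u (n + k)%nat) l.
Proof.
  intros H eps Heps. destruct (H eps Heps) as [N HN].
  exists N. intros n Hn. apply HN. lia.
Qed.

Lemma Cconv_unshift (u : nat -> C) (l : C) (k : nat) :
  Cconv (fun n => u (n + k)%nat) l -> Cconv u l.
Proof.
  intros H eps Heps. destruct (H eps Heps) as [N HN].
  exists (N + k)%nat. intros n Hn.
  replace n with ((n - k) + k)%nat by lia. apply HN. lia.
Qed.

Lemma is_Cseries_csum (f : nat -> C) (s : C) :
  is_Cseries f s <-> Cconv (csum f) s.
Proof.
  unfold is_Cseries, is_series. rewrite filterlim_Cconv. split; intros H.
  - apply (Cconv_unshift _ _ 1). eapply Cconv_ext; [|exact H].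
    intros n. rewrite sum_n_csum. f_equal. lia.
  - apply (Cconv_shift _ _ 1) in H. eapply Cconv_ext; [|exact H].
    intros n. symmetry. rewrite sum_n_csum. f_equal. lia.
Qed.

Lemma Cconv_const (c : C) : Cconv (fun _ => c) c.
Proof.
  intros eps Heps. exists O. intros n _.
  replace (c - c) with (RtoC 0) by ring. rewrite Cmod_0. exact Heps.
Qed.

Lemma Cconv_plus (u v : nat -> C) (l m : C) :
  Cconv u l -> Cconv v m -> Cconv (fun n => u n + v n) (l + m).
Proof.
  rewrite <- !filterlim_Cconv. intros Hu Hv.
  exact (filterlim_comp_2 _ _ _ Hu Hv (filterlim_plus (V := C_NormedModule) l m)).
Qed.

Lemma Cconv_bounded (u : nat -> C) (l : C) :
  Cconv u l -> exists M : R, forall n, (Cmod (u n) <= M)%R.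
Proof.
  intros H. apply filterlim_Cconv in H.
  destruct (filterlim_bounded (V := C_NormedModule) u) as [M HM]; [exists l; exact H|].
  exists M. exact HM.
Qed.

Lemma Cconv_mult (u v : nat -> C) (l m : C) :
  Cconv u l -> Cconv v m -> Cconv (fun n => u n * v n) (l * m).
Proof.
  intros Hu Hv eps Heps.
  destruct (Cconv_bounded _ _ Hu) as [M0 HuM0]. set (M := (M0 + 1)%R).
  assert (HM : (0 < M)%R) by (assert (H := HuM0 O); assert (H' := Cmod_ge_0 (u O)); unfold M; lra).
  assert (HuM : forall n, (Cmod (u n) <= M)%R) by (intros n; specialize (HuM0 n); unfold M; lra).
  assert (Hm := Cmod_ge_0 m).
  destruct (Hu (eps / (2 * (Cmod m + 1)))%R) as [N HN].
  { apply Rdiv_lt_0_compat; lra. }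
  destruct (Hv (eps / (2 * M))%R) as [N' HN'].
  { apply Rdiv_lt_0_compat; lra. }
  exists (N + N')%nat. intros n Hn.
  replace (u n * v n - l * m) with (u n * (v n - m) + (u n - l) * m) by ring.
  apply Rle_lt_trans with (1 := Cmod_triangle _ _).
  rewrite !Cmod_mult.
  specialize (HN n ltac:(lia)). specialize (HN' n ltac:(lia)).
  assert (H1 : (Cmod (u n) * Cmod (v n - m) <= M * Cmod (v n - m))%R).
  { apply Rmult_le_compat_r; [apply Cmod_ge_0|apply HuM]. }
  assert (H2 : (M * Cmod (v n - m) < M * (eps / (2 * M)))%R).
  { apply Rmult_lt_compat_l; [lra|exact HN']. }
  assert (H3 : (Cmod (u n - l) * Cmod m <= eps / (2 * (Cmod m + 1)) * (Cmod m + 1))%R).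
  { apply Rmult_le_compat; [apply Cmod_ge_0|lra|lra|lra]. }
  replace (M * (eps / (2 * M)))%R with (eps / 2)%R in H2 by (field; lra).
  replace (eps / (2 * (Cmod m + 1)) * (Cmod m + 1))%R with (eps / 2)%R in H3
    by (field; lra).
  lra.
Qed.

Lemma Cconv_scal (c : C) (u : nat -> C) (l : C) :
  Cconv u l -> Cconv (fun n => c * u n) (c * l).
Proof. intros H. exact (Cconv_mult _ _ _ _ (Cconv_const c) H). Qed.

Lemma Cconv_unique (u : nat -> C) (l m : C) : Cconv u l -> Cconv u m -> l = m.
Proof.
  rewrite <- !filterlim_Cconv.
  exact (filterlim_locally_unique (V := C_NormedModule) u l m).
Qed.

Lemma Cconv_le (u : nat -> C) (l : C) (M : R) :
  Cconv u l -> (forall n, (Cmod (u n) <= M)%R) -> (Cmod l <= M)%R.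
Proof.
  intros H HM. apply Rnot_lt_le. intros Hlt.
  destruct (H (Cmod l - M)%R ltac:(lra)) as [N HN].
  specialize (HN N (Nat.le_refl _)). specialize (HM N).
  rewrite Cmod_minus_sym in HN.
  assert (T := Cmod_triangle (l - u N) (u N)).
  replace (l - u N + u N) with l in T by ring. lra.
Qed.

Lemma the_eq (P : C -> Prop) (x : C) :
  P x -> (forall y, P y -> y = x) -> the P = x.
Proof.
  intros Hx Hu. apply Hu. unfold the.
  apply (iota_correct (V := C_CompleteNormedModule)).
  exists x. split; [exact Hx|]. intros y Hy. symmetry. apply Hu. exact Hy.
Qed.

Lemma is_Cseries_unique (f : nat -> C) (s t : C) :
  is_Cseries f s -> is_Cseries f t -> s = t.
Proof. rewrite !is_Cseries_csum. apply Cconv_unique. Qed.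

Lemma Cseries_eq (f : nat -> C) (s : C) : is_Cseries f s -> Cseries f = s.
Proof.
  intros H. apply the_eq; [exact H|].
  intros y Hy. exact (is_Cseries_unique _ _ _ Hy H).
Qed.

Lemma csum_ext (f g : nat -> C) (n : nat) :
  (forall k, (k < n)%nat -> f k = g k) -> csum f n = csum g n.
Proof.
  induction n as [|n IH]; intros H; simpl; [reflexivity|].
  rewrite IH by (intros; apply H; lia). rewrite H by lia. reflexivity.
Qed.

Lemma rsum_ext (f g : nat -> R) (n : nat) :
  (forall k, (k < n)%nat -> f k = g k) -> rsum f n = rsum g n.
Proof.
  induction n as [|n IH]; intros H; simpl; [reflexivity|].
  rewrite IH by (intros; apply H; lia). rewrite H by lia. reflexivity.
Qed.

Lemma csum_plus (f g : nat -> C) (n : nat) :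
  csum (fun k => f k + g k) n = csum f n + csum g n.
Proof. induction n as [|n IH]; simpl; [ring|rewrite IH; ring]. Qed.

Lemma csum_scal (c : C) (f : nat -> C) (n : nat) :
  csum (fun k => c * f k) n = c * csum f n.
Proof. induction n as [|n IH]; simpl; [ring|rewrite IH; ring]. Qed.

Lemma csum_zero (f : nat -> C) (n : nat) :
  (forall k, (k < n)%nat -> f k = 0) -> csum f n = 0.
Proof.
  induction n as [|n IH]; intros H; simpl; [reflexivity|].
  rewrite IH by (intros; apply H; lia). rewrite H by lia. ring.
Qed.

Lemma csum_add (f : nat -> C) (n m : nat) :
  csum f (n + m) = csum f n + csum (fun k => f (n + k)%nat) m.
Proof.
  induction m as [|m IH]; [rewrite Nat.add_0_r; simpl; ring|].
  rewrite Nat.add_succ_r. simpl. rewrite IH. ring.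
Qed.

Lemma csum_S (f : nat -> C) (n : nat) :
  csum f (S n) = f O + csum (fun k => f (S k)) n.
Proof. change (S n) with (1 + n)%nat. rewrite csum_add. simpl. ring. Qed.

Lemma csum_swap (a : nat -> nat -> C) (n m : nat) :
  csum (fun i => csum (a i) m) n = csum (fun j => csum (fun i => a i j) n) m.
Proof.
  induction n as [|n IH]; simpl; [symmetry; apply csum_zero; reflexivity|].
  rewrite IH. rewrite <- csum_plus. reflexivity.
Qed.

Lemma rsum_le (f g : nat -> R) (n : nat) :
  (forall k, (k < n)%nat -> (f k <= g k)%R) -> (rsum f n <= rsum g n)%R.
Proof.
  induction n as [|n IH]; intros H; simpl; [lra|].
  assert (H1 := H n ltac:(lia)).
  assert (H2 : (rsum f n <= rsum g n)%R) by (apply IH; intros; apply H; lia). lra.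
Qed.

Lemma rsum_nonneg (f : nat -> R) (n : nat) :
  (forall k, (0 <= f k)%R) -> (0 <= rsum f n)%R.
Proof. intros H. induction n as [|n IH]; simpl; [lra|]. specialize (H n). lra. Qed.

Lemma rsum_mono (f : nat -> R) (n m : nat) :
  (forall k, (0 <= f k)%R) -> (n <= m)%nat -> (rsum f n <= rsum f m)%R.
Proof.
  intros H Hn. induction Hn as [|m Hn IH]; [lra|]. simpl. specialize (H m). lra.
Qed.

Lemma rsum_scal (c : R) (f : nat -> R) (n : nat) :
  rsum (fun k => c * f k)%R n = (c * rsum f n)%R.
Proof. induction n as [|n IH]; simpl; [ring|rewrite IH; ring]. Qed.

Lemma rsum_plus (f g : nat -> R) (n : nat) :
  rsum (fun k => f k + g k)%R n = (rsum f n + rsum g n)%R.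
Proof. induction n as [|n IH]; simpl; [ring|rewrite IH; ring]. Qed.

Lemma rsum_zero (n : nat) : rsum (fun _ => 0%R) n = 0%R.
Proof. induction n as [|n IH]; simpl; [ring|rewrite IH; ring]. Qed.

Lemma rsum_swap (a : nat -> nat -> R) (n m : nat) :
  rsum (fun i => rsum (a i) m) n = rsum (fun j => rsum (fun i => a i j) n) m.
Proof.
  induction n as [|n IH]; simpl; [symmetry; apply rsum_zero|].
  rewrite IH. rewrite <- rsum_plus. reflexivity.
Qed.

Lemma csum_le (f : nat -> C) (n : nat) :
  (Cmod (csum f n) <= rsum (fun k => Cmod (f k)) n)%R.
Proof.
  induction n as [|n IH]; simpl; [rewrite Cmod_0; lra|].
  apply Rle_trans with (1 := Cmod_triangle _ _). lra.
Qed.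

Definition abs_le (f : nat -> C) (M : R) : Prop :=
  forall n, (rsum (fun k => Cmod (f k)) n <= M)%R.

Lemma bounded_rsum_ex_series (f : nat -> R) (M : R) :
  (forall k, (0 <= f k)%R) -> (forall n, (rsum f n <= M)%R) -> ex_series f.
Proof.
  intros H0 HM.
  assert (E : forall n, sum_n f n = rsum f (S n)).
  { induction n as [|n IH]; [rewrite sum_O; simpl; ring|].
    rewrite sum_Sn, IH. reflexivity. }
  destruct (ex_finite_lim_seq_incr (sum_n f) M) as [l Hl].
  - intros n. rewrite !E. simpl. specialize (H0 (S n)). lra.
  - intros n. rewrite E. apply HM.
  - exists l. exact Hl.
Qed.

Lemma abs_le_series (f : nat -> C) (M : R) :
  abs_le f M -> exists s, is_Cseries f s /\ (Cmod s <= M)%R.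
Proof.
  intros H.
  assert (He : ex_series (K := C_AbsRing) (V := C_NormedModule) f).
  { apply (ex_series_le (K := C_AbsRing) (V := C_CompleteNormedModule) f
             (fun k => Cmod (f k))).
    - intros n. apply Rle_refl.
    - apply bounded_rsum_ex_series with M; [intros; apply Cmod_ge_0|exact H]. }
  destruct He as [s Hs]. exists s. split; [exact Hs|].
  apply is_Cseries_csum in Hs. apply Cconv_le with (1 := Hs).
  intros n. apply Rle_trans with (1 := csum_le _ _). apply H.
Qed.

Lemma abs_le_is_series (f : nat -> C) (M : R) :
  abs_le f M -> is_Cseries f (Cseries f).
Proof.
  intros H. destruct (abs_le_series _ _ H) as [s [Hs _]].
  rewrite (Cseries_eq _ _ Hs). exact Hs.
Qed.

Lemma abs_le_dom (f : nat -> C) (g : nat -> R) (M : R) :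
  (forall k, (Cmod (f k) <= g k)%R) -> (forall n, (rsum g n <= M)%R) -> abs_le f M.
Proof.
  intros H HM n. apply Rle_trans with (rsum g n); [|apply HM].
  apply rsum_le. intros; apply H.
Qed.

Lemma is_Cseries_ext (f g : nat -> C) (s : C) :
  (forall k, f k = g k) -> is_Cseries f s -> is_Cseries g s.
Proof. exact (is_series_ext (V := C_NormedModule) f g s). Qed.

Lemma is_Cseries_scal (c : C) (f : nat -> C) (s : C) :
  is_Cseries f s -> is_Cseries (fun k => c * f k) (c * s).
Proof. exact (is_series_scal (V := C_NormedModule) c f s). Qed.

Lemma is_Cseries_plus (f g : nat -> C) (s t : C) :
  is_Cseries f s -> is_Cseries g t -> is_Cseries (fun k => f k + g k) (s + t).
Proof. exact (is_series_plus (V := C_NormedModule) f g s t). Qed.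

Lemma is_Cseries_shift (f : nat -> C) (s : C) (n : nat) :
  is_Cseries (fun k => f (n + k)%nat) s -> is_Cseries f (csum f n + s).
Proof.
  rewrite !is_Cseries_csum. intros H. apply (Cconv_unshift _ _ n).
  apply (Cconv_ext (fun k => csum f n + csum (fun j => f (n + j)%nat) k)).
  - intros k. rewrite Nat.add_comm, csum_add. reflexivity.
  - apply Cconv_plus; [apply Cconv_const|exact H].
Qed.

Lemma is_Cseries_unshift (f : nat -> C) (s : C) (n : nat) :
  is_Cseries f s -> is_Cseries (fun k => f (n + k)%nat) (s - csum f n).
Proof.
  rewrite !is_Cseries_csum. intros H. apply (Cconv_shift _ _ n) in H.
  apply (Cconv_ext (fun k => csum f (k + n) + - csum f n)).
  - intros k. rewrite (Nat.add_comm k), csum_add. ring.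
  - apply Cconv_plus; [exact H|apply Cconv_const].
Qed.

Lemma is_Cseries_finite (f : nat -> C) (n : nat) :
  (forall k, (n <= k)%nat -> f k = 0) -> is_Cseries f (csum f n).
Proof.
  intros H. replace (csum f n) with (csum f n + 0) by ring.
  apply is_Cseries_shift. apply is_Cseries_csum.
  apply Cconv_ext with (fun _ => 0); [|apply Cconv_const].
  intros k. symmetry. apply csum_zero. intros; apply H; lia.
Qed.

Lemma rsum_add (f : nat -> R) (n k : nat) :
  rsum f (n + k) = (rsum f n + rsum (fun j => f (n + j)%nat) k)%R.
Proof.
  induction k as [|k IH]; [rewrite Nat.add_0_r; simpl; ring|].
  rewrite Nat.add_succ_r. simpl. rewrite IH. ring.
Qed.

Lemma rows_abs_le (a : nat -> nat -> C) (s : nat -> C) (M : R) :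
  (forall I J, (rsum (fun i => rsum (fun j => Cmod (a i j)) J) I <= M)%R) ->
  (forall i, is_Cseries (a i) (s i)) -> abs_le s M.
Proof.
  intros HM Hs I. apply Rnot_lt_le. intros Hlt.
  assert (Happ : forall I eps, (0 < eps)%R -> exists N, forall J, (N <= J)%nat ->
    (rsum (fun i => Cmod (csum (a i) J - s i)) I < eps)%R).
  { clear I Hlt. induction I as [|I IH]; intros eps Heps.
    - exists O. intros. simpl. exact Heps.
    - destruct (IH (eps / 2)%R ltac:(lra)) as [N HN].
      assert (HI := Hs I). apply is_Cseries_csum in HI.
      destruct (HI (eps / 2)%R ltac:(lra)) as [N' HN'].
      exists (N + N')%nat. intros J HJ. simpl.
      specialize (HN J ltac:(lia)). specialize (HN' J ltac:(lia)). lra. }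
  destruct (Happ I (rsum (fun k => Cmod (s k)) I - M)%R ltac:(lra)) as [N HN].
  specialize (HN N (Nat.le_refl _)). specialize (HM I N).
  assert (rsum (fun k => Cmod (s k)) I <=
    rsum (fun i => rsum (fun j => Cmod (a i j)) N) I +
    rsum (fun i => Cmod (csum (a i) N - s i)) I)%R; [|lra].
  rewrite <- rsum_plus. apply rsum_le. intros k _.
  assert (T := Cmod_triangle (csum (a k) N) (s k - csum (a k) N)).
  replace (csum (a k) N + (s k - csum (a k) N)) with (s k) in T by ring.
  rewrite (Cmod_minus_sym (s k)) in T. assert (T' := csum_le (a k) N). lra.
Qed.

(** Some finite rectangle carries all but [eps] of the supremum of the absolute
    sums, so both iterated sums are within [eps] of its partial sum. *)
Lemma Cseries_fubini (a : nat -> nat -> C) (M : R) :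
  (forall I J, (rsum (fun i => rsum (fun j => Cmod (a i j)) J) I <= M)%R) ->
  exists s,
    is_Cseries (fun i => Cseries (a i)) s /\
    is_Cseries (fun j => Cseries (fun i => a i j)) s /\
    abs_le (fun i => Cseries (a i)) M /\ abs_le (fun j => Cseries (fun i => a i j)) M /\
    (forall i, is_Cseries (a i) (Cseries (a i))) /\
    (forall j, is_Cseries (fun i => a i j) (Cseries (fun i => a i j))).
Proof.
  intros HM.
  set (T := fun I J => rsum (fun i => rsum (fun j => Cmod (a i j)) J) I).
  set (S := fun I J => csum (fun i => csum (a i) J) I).
  assert (HM' : forall I J, (rsum (fun j => rsum (fun i => Cmod (a i j)) J) I <= M)%R).
  { intros I J. rewrite rsum_swap. apply HM. }
  assert (Hone : forall (b : nat -> nat -> C) i,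
    (forall I J, (rsum (fun i => rsum (fun j => Cmod (b i j)) J) I <= M)%R) ->
    abs_le (b i) M).
  { intros b i Hb n. apply Rle_trans with (2 := Hb (Datatypes.S i) n). simpl.
    assert (H : (0 <= rsum (fun i => rsum (fun j => Cmod (b i j)) n) i)%R).
    { apply rsum_nonneg. intros. apply rsum_nonneg. intros; apply Cmod_ge_0. }
    lra. }
  assert (Cr := fun i => abs_le_is_series _ _ (Hone a i HM)).
  assert (Cc := fun j => abs_le_is_series _ _ (Hone (fun j i => a i j) j HM')).
  assert (Ar := rows_abs_le _ _ _ HM Cr).
  assert (Ac := rows_abs_le _ _ _ HM' Cc).
  destruct (abs_le_series _ _ Ar) as [s [Hs _]].
  destruct (abs_le_series _ _ Ac) as [t [Ht _]].
  exists s. split; [exact Hs|].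
  assert (E : s = t); [|subst t; repeat split; auto].
  assert (Prow : forall I, Cconv (fun J => S I J) (csum (fun i => Cseries (a i)) I)).
  { induction I as [|I IH]; [exact (Cconv_const 0)|].
    apply (Cconv_plus _ (csum (a I)) _ _ IH). apply is_Cseries_csum, Cr. }
  assert (Pcol : forall J, Cconv (fun I => S I J)
                    (csum (fun j => Cseries (fun i => a i j)) J)).
  { intros J. apply Cconv_ext with
      (fun I => csum (fun j => csum (fun i => a i j) I) J).
    { intros I. symmetry. apply csum_swap. }
    induction J as [|J IH]; simpl; [apply Cconv_const|].
    apply Cconv_plus; [exact IH|]. apply is_Cseries_csum, Cc. }
  destruct (completeness (fun x => exists I J, x = T I J)) as [m [Hub Hlub]].
  { exists M. intros x [I [J ->]]. apply HM. }
  { exists (T O O), O, O. reflexivity. }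
  assert (Hbig : forall eps, (0 < eps)%R -> exists I J, (m - eps < T I J)%R).
  { intros eps Heps. apply Classical_Prop.NNPP. intros Hn.
    assert (m <= m - eps)%R; [|lra]. apply Hlub. intros x [I [J ->]].
    apply Rnot_lt_le. intros Hlt. apply Hn. exists I, J. lra. }
  assert (Hdiff : forall I J p r,
     (Cmod (S (I + p)%nat (J + r)%nat - S I J) <= T (I + p)%nat (J + r)%nat - T I J)%R).
  { intros I J p r. unfold S, T. rewrite csum_add, rsum_add.
    rewrite (csum_ext (fun i => csum (a i) (J + r))
      (fun i => csum (a i) J + csum (fun k => a i (J + k)%nat) r))
      by (intros; apply csum_add).
    rewrite (rsum_ext (fun i => rsum (fun j => Cmod (a i j)) (J + r))
      (fun i => rsum (fun j => Cmod (a i j)) J + rsum (fun k => Cmod (a i (J + k)%nat)) r)%R)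
      by (intros; apply rsum_add).
    rewrite csum_plus, rsum_plus.
    match goal with |- (Cmod (?x + ?y + ?z - ?x) <= _)%R =>
      replace (x + y + z - x) with (y + z) by ring end.
    apply Rle_trans with (1 := Cmod_triangle _ _).
    match goal with |- (?x + ?y <= _)%R =>
      assert (x <= rsum (fun i => rsum (fun k => Cmod (a i (J + k)%nat)) r) I)%R end.
    { apply Rle_trans with (1 := csum_le _ _). apply rsum_le. intros. apply csum_le. }
    match goal with |- (?x + ?y <= _)%R =>
      assert (y <= rsum (fun i => rsum (fun j => Cmod (a (I + i)%nat j)) (J + r)) p)%R end.
    { apply Rle_trans with (1 := csum_le _ _). apply rsum_le. intros. apply csum_le. }
    lra. }
  assert (Hclose : forall eps, (0 < eps)%R -> (Cmod (s - t) <= 2 * eps)%R).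
  { intros eps Heps. destruct (Hbig eps Heps) as [I [J HIJ]].
    assert (Hd : forall p r, (Cmod (S (I + p)%nat (J + r)%nat - S I J) <= eps)%R).
    { intros p r. apply Rle_trans with (1 := Hdiff I J p r).
      assert (T (I + p)%nat (J + r)%nat <= m)%R by (apply Hub; eauto). lra. }
    assert (H1 : (Cmod (s - S I J) <= eps)%R).
    { apply is_Cseries_csum in Hs. apply (Cconv_shift _ _ I) in Hs.
      apply (fun H => Cconv_plus _ _ _ _ H (Cconv_const (- S I J))) in Hs.
      apply (Cconv_le _ _ _ Hs). intros p. rewrite Nat.add_comm.
      assert (Hp := Prow (I + p)%nat). apply (Cconv_shift _ _ J) in Hp.
      apply (fun H => Cconv_plus _ _ _ _ H (Cconv_const (- S I J))) in Hp.
      apply (Cconv_le _ _ _ Hp). intros r. rewrite (Nat.add_comm r). apply Hd. }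
    assert (H2 : (Cmod (t - S I J) <= eps)%R).
    { apply is_Cseries_csum in Ht. apply (Cconv_shift _ _ J) in Ht.
      apply (fun H => Cconv_plus _ _ _ _ H (Cconv_const (- S I J))) in Ht.
      apply (Cconv_le _ _ _ Ht). intros p. rewrite Nat.add_comm.
      assert (Hp := Pcol (J + p)%nat). apply (Cconv_shift _ _ I) in Hp.
      apply (fun H => Cconv_plus _ _ _ _ H (Cconv_const (- S I J))) in Hp.
      apply (Cconv_le _ _ _ Hp). intros r. rewrite (Nat.add_comm r). apply Hd. }
    replace (s - t) with ((s - S I J) + (S I J - t)) by ring.
    apply Rle_trans with (1 := Cmod_triangle _ _).
    rewrite (Cmod_minus_sym _ t). lra. }
  assert (Hz : Cmod (s - t) = 0%R).
  { apply Rle_antisym; [|apply Cmod_ge_0]. apply Rnot_lt_le. intros Hlt.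
    specialize (Hclose (Cmod (s - t) / 4)%R ltac:(lra)). lra. }
  apply Cmod_eq_0 in Hz. replace s with ((s - t) + t) by ring. rewrite Hz. ring.
Qed.

(** Summation along the antidiagonals: the substitution [(i, j) = (r, k - r)]
    turns them into the columns of a lower triangular array. *)
Lemma Cseries_diagonal (a : nat -> nat -> C) (M : R) :
  (forall I J, (rsum (fun i => rsum (fun j => Cmod (a i j)) J) I <= M)%R) ->
  exists s,
    is_Cseries (fun i => Cseries (a i)) s /\
    is_Cseries (fun k => csum (fun r => a r (k - r)%nat) (S k)) s /\
    abs_le (fun k => csum (fun r => a r (k - r)%nat) (S k)) M.
Proof.
  intros HM.
  set (b := fun i k => if (i <=? k)%nat then a i (k - i)%nat else 0).
  assert (Hb0 : forall i k, (k < i)%nat -> b i k = 0).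
  { intros i k H. unfold b. destruct (Nat.leb_spec i k); [lia|reflexivity]. }
  assert (Hb1 : forall i k, b i (i + k)%nat = a i k).
  { intros i k. unfold b. destruct (Nat.leb_spec i (i + k)); [f_equal; lia|lia]. }
  assert (HMb : forall I J, (rsum (fun i => rsum (fun j => Cmod (b i j)) J) I <= M)%R).
  { intros I J. apply Rle_trans with (2 := HM I J). apply rsum_le. intros i _.
    apply Rle_trans with (rsum (fun j => Cmod (b i j)) (i + J)).
    - apply rsum_mono; [intros; apply Cmod_ge_0|lia].
    - rewrite rsum_add. rewrite (rsum_ext _ (fun _ => 0%R)).
      + rewrite rsum_zero. apply Req_le. rewrite Rplus_0_l. apply rsum_ext.
        intros. rewrite Hb1. reflexivity.
      + intros k Hk. rewrite Hb0 by lia. apply Cmod_0. }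
  destruct (Cseries_fubini _ _ HMb) as (s & H1 & H2 & H3 & H4 & H5 & H6).
  destruct (Cseries_fubini _ _ HM) as (s' & H1' & H2' & H3' & H4' & H5' & H6').
  assert (Ecol : forall k, Cseries (fun i => b i k) = csum (fun r => a r (k - r)%nat) (S k)).
  { intros k. apply Cseries_eq.
    rewrite (csum_ext _ (fun i => b i k)).
    - apply is_Cseries_finite. intros i Hi. apply Hb0. lia.
    - intros i Hi. unfold b. destruct (Nat.leb_spec i k); [reflexivity|lia]. }
  exists s. split; [|split].
  - revert H1. apply is_Cseries_ext. intros i. apply Cseries_eq.
    replace (Cseries (a i)) with (csum (b i) i + Cseries (a i)).
    + apply is_Cseries_shift. revert H5'. intros H5'. specialize (H5' i).
      revert H5'. apply is_Cseries_ext. intros k. symmetry. apply Hb1.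
    + rewrite csum_zero; [ring|]. intros k Hk. apply Hb0. exact Hk.
  - revert H2. apply is_Cseries_ext. exact Ecol.
  - intros n. rewrite (rsum_ext _ (fun k => Cmod (Cseries (fun i => b i k))));
      [apply H4|]. intros k _. rewrite Ecol. reflexivity.
Qed.

(** * Power series with majorants *)

(** [M] bounds the sum of the absolute values on the circle of radius [rho]: a
    family of power series may then be rearranged on the sole evidence of its
    bounds [M], without reference to the coefficients. *)
Definition power_series (c : nat -> C) (rho M : R) (f : C -> C) : Prop :=
  (forall n, (rsum (fun k => Cmod (c k) * rho ^ k) n <= M)%R) /\
  forall z, (Cmod z <= rho)%R -> is_Cseries (fun k => c k * z ^ k) (f z).

Definition has_power_series (rho M : R) (f : C -> C) : Prop :=
  exists c, power_series c rho M f.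

Lemma rpow_nonneg (r : R) (n : nat) : (0 <= r)%R -> (0 <= r ^ n)%R.
Proof. intros H. apply pow_le. exact H. Qed.

Lemma rpow_le (x y : R) (n : nat) : (0 <= x <= y)%R -> (x ^ n <= y ^ n)%R.
Proof. intros H. apply pow_incr. exact H. Qed.

Lemma coef_abs_le (c : nat -> C) (rho M : R) (z : C) :
  (forall n, (rsum (fun k => Cmod (c k) * rho ^ k) n <= M)%R) ->
  (Cmod z <= rho)%R -> abs_le (fun k => c k * z ^ k) M.
Proof.
  intros H Hz. apply abs_le_dom with (2 := H). intros k.
  rewrite Cmod_mult, Cmod_pow. apply Rmult_le_compat_l; [apply Cmod_ge_0|].
  apply rpow_le. split; [apply Cmod_ge_0|exact Hz].
Qed.

Lemma power_series_make (c : nat -> C) (rho M : R) :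
  (forall n, (rsum (fun k => Cmod (c k) * rho ^ k) n <= M)%R) ->
  power_series c rho M (fun z => Cseries (fun k => c k * z ^ k)).
Proof.
  intros H. split; [exact H|]. intros z Hz.
  apply abs_le_is_series with M. apply coef_abs_le with rho; assumption.
Qed.

Lemma has_ps_ext (rho M : R) (f g : C -> C) :
  (forall z, (Cmod z <= rho)%R -> f z = g z) ->
  has_power_series rho M f -> has_power_series rho M g.
Proof.
  intros E [c [H1 H2]]. exists c. split; [exact H1|].
  intros z Hz. rewrite <- E by exact Hz. auto.
Qed.

Lemma has_ps_le (rho M M' : R) (f : C -> C) :
  (M <= M')%R -> has_power_series rho M f -> has_power_series rho M' f.
Proof.
  intros HM [c [H1 H2]]. exists c. split; [|exact H2].
  intros n. specialize (H1 n). lra.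
Qed.

Lemma has_ps_restrict (rho rho' M : R) (f : C -> C) :
  (0 <= rho' <= rho)%R -> has_power_series rho M f -> has_power_series rho' M f.
Proof.
  intros Hr [c [H1 H2]]. exists c. split.
  - intros n. apply Rle_trans with (2 := H1 n). apply rsum_le. intros k _.
    apply Rmult_le_compat_l; [apply Cmod_ge_0|]. apply rpow_le. lra.
  - intros z Hz. apply H2. lra.
Qed.

Lemma has_ps_const (rho : R) (x : C) : has_power_series rho (Cmod x) (fun _ => x).
Proof.
  exists (fun k => match k with O => x | _ => 0 end). split.
  - intros n. apply Rle_trans with (rsum (fun k => match k with O => Cmod x | _ => 0%R end) (S n)).
    + apply Rle_trans with (rsum (fun k => match k with O => Cmod x | _ => 0%R end) n).
      * apply rsum_le. intros k _. destruct k; simpl; [lra|]. rewrite Cmod_0. lra.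
      * apply rsum_mono; [|lia]. intros [|k]; [apply Cmod_ge_0|lra].
    + induction n as [|n IH]; simpl in *; lra.
  - intros z _.
    assert (H := is_Cseries_finite (fun k => match k with O => x | _ => 0 end * z ^ k) 1).
    simpl in H. replace (0 + x * 1) with x in H by ring. apply H.
    intros k Hk. destruct k; [lia|]. ring.
Qed.

Lemma has_ps_scal (rho M : R) (x : C) (f : C -> C) :
  has_power_series rho M f -> has_power_series rho (Cmod x * M) (fun z => x * f z).
Proof.
  intros [c [H1 H2]]. exists (fun k => x * c k). split.
  - intros n. rewrite (rsum_ext _ (fun k => Cmod x * (Cmod (c k) * rho ^ k))%R).
    + rewrite rsum_scal. apply Rmult_le_compat_l; [apply Cmod_ge_0|apply H1].
    + intros. rewrite Cmod_mult. ring.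
  - intros z Hz. apply is_Cseries_ext with (fun k => x * (c k * z ^ k)).
    + intros; ring.
    + apply is_Cseries_scal. auto.
Qed.

Lemma has_ps_plus (rho M M' : R) (f g : C -> C) :
  (0 <= rho)%R ->
  has_power_series rho M f -> has_power_series rho M' g ->
  has_power_series rho (M + M') (fun z => f z + g z).
Proof.
  intros Hr [c [H1 H2]] [d [H3 H4]]. exists (fun k => c k + d k). split.
  - intros n. specialize (H1 n). specialize (H3 n).
    apply Rle_trans with (2 := Rplus_le_compat _ _ _ _ H1 H3).
    rewrite <- rsum_plus. apply rsum_le. intros k _.
    rewrite <- Rmult_plus_distr_r.
    apply Rmult_le_compat_r; [nonneg|apply Cmod_triangle].
  - intros z Hz. apply is_Cseries_ext with (fun k => c k * z ^ k + d k * z ^ k).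
    + intros; ring.
    + apply is_Cseries_plus; auto.
Qed.

Lemma has_ps_shift (rho M : R) (f : C -> C) :
  (0 <= rho)%R ->
  has_power_series rho M f -> has_power_series rho (rho * M) (fun z => z * f z).
Proof.
  intros Hr [c [H1 H2]].
  exists (fun k => match k with O => RtoC 0 | S k' => c k' end). split.
  - intros n.
    apply Rle_trans with (rsum (fun k => Cmod (match k with O => RtoC 0 | S k' => c k' end) * rho ^ k)%R (1 + n)).
    + apply rsum_mono; [|lia]. intros. apply Rmult_le_pos; [apply Cmod_ge_0|].
      nonneg.
    + rewrite rsum_add. simpl. rewrite Cmod_0.
      rewrite (rsum_ext _ (fun k => rho * (Cmod (c k) * rho ^ k))%R) by (intros; ring).
      rewrite rsum_scal. assert (H := Rmult_le_compat_l rho _ _ Hr (H1 n)). lra.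
  - intros z Hz.
    assert (H := is_Cseries_shift (fun k => match k with O => RtoC 0 | S k' => c k' end * z ^ k) (z * f z) 1).
    simpl in H. replace (z * f z) with (0 + 0 * 1 + z * f z) by ring. apply H.
    apply is_Cseries_ext with (fun k => z * (c k * z ^ k)); [intros; ring|].
    apply is_Cseries_scal. auto.
Qed.

Lemma has_ps_mult (rho M M' : R) (f g : C -> C) :
  (0 <= rho)%R ->
  has_power_series rho M f -> has_power_series rho M' g ->
  has_power_series rho (M * M') (fun z => f z * g z).
Proof.
  intros Hr [c [H1 H2]] [d [H3 H4]].
  exists (fun k => csum (fun r => c r * d (k - r)%nat) (S k)).
  assert (HB : forall I J, (rsum (fun i => rsum (fun j =>
      (Cmod (c i) * rho ^ i) * (Cmod (d j) * rho ^ j)) J) I <= M * M')%R).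
  { intros I J.
    rewrite (rsum_ext _ (fun i => rsum (fun j => Cmod (d j) * rho ^ j)%R J * (Cmod (c i) * rho ^ i))%R).
    - rewrite rsum_scal, Rmult_comm. apply Rmult_le_compat; auto.
      + apply rsum_nonneg. intros. nonneg.
      + apply rsum_nonneg. intros. nonneg.
    - intros i _. rewrite rsum_scal. ring. }
  assert (HA : forall z, (Cmod z <= rho)%R -> forall I J,
    (rsum (fun i => rsum (fun j => Cmod ((c i * z ^ i) * (d j * z ^ j))) J) I <= M * M')%R).
  { intros z Hz I J. apply Rle_trans with (2 := HB I J).
    apply rsum_le. intros i _. apply rsum_le. intros j _.
    rewrite !Cmod_mult, !Cmod_pow.
    assert (Hzz : forall n, (0 <= Cmod z ^ n <= rho ^ n)%R).
    { intros. split; [nonneg|].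
      apply rpow_le. split; [apply Cmod_ge_0|exact Hz]. }
    assert (H5 := Hzz i). assert (H6 := Hzz j).
    assert (H7 := Cmod_ge_0 (c i)). assert (H8 := Cmod_ge_0 (d j)).
    apply Rmult_le_compat; try nonneg; apply Rmult_le_compat_l; lra. }
  assert (Econv : forall z k, csum (fun r => (c r * z ^ r) * (d (k - r)%nat * z ^ (k - r))) (S k)
     = csum (fun r => c r * d (k - r)%nat) (S k) * z ^ k).
  { intros z k. rewrite Cmult_comm, <- csum_scal. apply csum_ext. intros r Hr'.
    replace (z ^ k) with (z ^ (r + (k - r))) by (f_equal; lia).
    rewrite Cpow_add_r. ring. }
  split.
  - intros n.
    assert (HR : (Cmod (RtoC rho) <= rho)%R) by (rewrite Cmod_R, Rabs_pos_eq; lra).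
    destruct (Cseries_diagonal _ _ (HA (RtoC rho) HR)) as (s & _ & _ & H).
    apply Rle_trans with (2 := H n). apply Req_le. apply rsum_ext. intros k _.
    rewrite Econv, Cmod_mult, Cmod_pow, Cmod_R, Rabs_pos_eq by lra. reflexivity.
  - intros z Hz. destruct (Cseries_diagonal _ _ (HA z Hz)) as (s & Ha & Hb & _).
    assert (E : s = f z * g z).
    { apply (is_Cseries_unique _ _ _ Ha).
      apply is_Cseries_ext with (fun i => g z * (c i * z ^ i)).
      - intros i. symmetry. apply Cseries_eq. rewrite (Cmult_comm (g z)).
        apply is_Cseries_scal. auto.
      - rewrite (Cmult_comm (f z)). apply is_Cseries_scal. auto. }
    rewrite <- E. revert Hb. apply is_Cseries_ext. intros k. apply Econv.
Qed.

Lemma has_ps_pow (rho M : R) (f : C -> C) (n : nat) :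
  (0 <= rho)%R ->
  has_power_series rho M f -> has_power_series rho (M ^ n) (fun z => f z ^ n).
Proof.
  intros Hr H. induction n as [|n IH]; simpl.
  - apply has_ps_le with (Cmod 1); [rewrite Cmod_1; lra|apply has_ps_const].
  - apply has_ps_mult; assumption.
Qed.

Lemma has_ps_id (rho : R) : (0 <= rho)%R -> has_power_series rho rho (fun z => z).
Proof.
  intros Hr. apply has_ps_ext with (fun z => z * 1).
  - intros; ring.
  - apply has_ps_le with (rho * Cmod 1)%R; [rewrite Cmod_1; lra|].
    apply (has_ps_shift _ _ (fun _ => 1)); [exact Hr|apply has_ps_const].
Qed.

(** A sum of power series may be rearranged as soon as the majorants of its
    terms have bounded partial sums. *)
Lemma has_ps_sum (rho M : R) (f : nat -> C -> C) (m : nat -> R) :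
  (0 < rho)%R ->
  (forall k, has_power_series rho (m k) (f k)) ->
  (forall n, (rsum m n <= M)%R) ->
  has_power_series rho M (fun z => Cseries (fun k => f k z)) /\
  forall z, (Cmod z <= rho)%R -> abs_le (fun k => f k z) M.
Proof.
  intros Hr Hf HM.
  destruct (functional_choice (fun k c => power_series c rho (m k) (f k)) Hf) as [c Hc].
  assert (HA : forall z, (Cmod z <= rho)%R -> forall I J,
    (rsum (fun k => rsum (fun i => Cmod (c k i * z ^ i)) J) I <= M)%R).
  { intros z Hz I J. apply Rle_trans with (2 := HM I). apply rsum_le. intros k _.
    apply (coef_abs_le (c k) rho); [apply Hc|exact Hz]. }
  assert (HR : (Cmod (RtoC rho) <= rho)%R) by (rewrite Cmod_R, Rabs_pos_eq; lra).
  assert (Efac : forall z i, (Cmod z <= rho)%R ->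
     Cseries (fun k => c k i * z ^ i) = Cseries (fun k => c k i) * z ^ i).
  { intros z i Hz. apply Cseries_eq.
    apply is_Cseries_ext with (fun k => z ^ i * c k i); [intros; ring|].
    rewrite (Cmult_comm (Cseries _)). apply is_Cseries_scal.
    assert (Hri : RtoC rho ^ i <> 0).
    { apply Cpow_nz. intros E. apply RtoC_inj in E. lra. }
    destruct (Cseries_fubini _ _ (HA _ HR)) as (s & _ & _ & _ & _ & _ & H).
    specialize (H i). apply (is_Cseries_scal (/ (RtoC rho ^ i))) in H.
    assert (H' : is_Cseries (fun k => c k i) (/ (RtoC rho ^ i) * Cseries (fun k => c k i * RtoC rho ^ i))).
    { revert H. apply is_Cseries_ext. intros k. field. exact Hri. }
    rewrite (Cseries_eq _ _ H'). exact H'. }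
  assert (Erow : forall z k, (Cmod z <= rho)%R -> Cseries (fun i => c k i * z ^ i) = f k z).
  { intros z k Hz. apply Cseries_eq. apply Hc. exact Hz. }
  split.
  - exists (fun i => Cseries (fun k => c k i)). split.
    + intros n. destruct (Cseries_fubini _ _ (HA _ HR)) as (s & _ & _ & _ & H & _).
      apply Rle_trans with (2 := H n). apply Req_le, rsum_ext. intros i _.
      rewrite Efac by exact HR. rewrite Cmod_mult, Cmod_pow, Cmod_R, Rabs_pos_eq by lra.
      reflexivity.
    + intros z Hz. destruct (Cseries_fubini _ _ (HA _ Hz)) as (s & H1 & H2 & _).
      assert (E : Cseries (fun k => f k z) = s).
      { apply Cseries_eq. revert H1. apply is_Cseries_ext. intros k. auto. }
      rewrite E. revert H2. apply is_Cseries_ext. intros i. apply Efac. exact Hz.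
  - intros z Hz n. destruct (Cseries_fubini _ _ (HA _ Hz)) as (s & _ & _ & H & _).
    apply Rle_trans with (2 := H n). apply Req_le, rsum_ext. intros k _.
    rewrite Erow by exact Hz. reflexivity.
Qed.

(** Each power [(z0 + w)^k] is expanded in [w]; the result converges as long as
    [|z0| + |w|] stays within the original disc. *)
Lemma has_ps_recenter (rho rho' M : R) (f : C -> C) (z0 : C) :
  (0 < rho')%R -> (Cmod z0 + rho' <= rho)%R ->
  has_power_series rho M f -> has_power_series rho' M (fun w => f (z0 + w)).
Proof.
  intros Hr' Hz0 [c [H1 H2]].
  destruct (has_ps_sum rho' M (fun k w => c k * (z0 + w) ^ k)
     (fun k => Cmod (c k) * (Cmod z0 + rho') ^ k)%R Hr') as [H _].
  - intros k. apply has_ps_scal, has_ps_pow; [lra|].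
    apply has_ps_plus; [lra|apply has_ps_const|apply has_ps_id; lra].
  - intros n. apply Rle_trans with (2 := H1 n). apply rsum_le. intros k _.
    apply Rmult_le_compat_l; [apply Cmod_ge_0|]. apply rpow_le.
    assert (H := Cmod_ge_0 z0). lra.
  - revert H. apply has_ps_ext. intros w Hw. apply Cseries_eq. apply H2.
    assert (T := Cmod_triangle z0 w). lra.
Qed.

(** The series [(f z - c 0) / z] is bounded by [M / rho]. *)
Lemma power_series_near_0 (c : nat -> C) (rho M : R) (f : C -> C) (z : C) :
  (0 < rho)%R -> power_series c rho M f -> (Cmod z <= rho)%R ->
  (Cmod (f z - c O) <= Cmod z * (M / rho))%R.
Proof.
  intros Hr [H1 H2] Hz.
  assert (Hd : forall n, (rsum (fun k => Cmod (c (S k)) * rho ^ k) n <= M / rho)%R).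
  { intros n. apply Rmult_le_reg_l with rho; [exact Hr|].
    replace (rho * (M / rho))%R with M by (field; lra).
    apply Rle_trans with (2 := H1 (1 + n)%nat). rewrite rsum_add. simpl.
    rewrite <- rsum_scal.
    rewrite (rsum_ext _ (fun k => Cmod (c (S k)) * (rho * rho ^ k))%R) by (intros; ring).
    assert (H := Cmod_ge_0 (c O)). lra. }
  assert (Hs := is_Cseries_unshift _ _ 1 (H2 z Hz)). simpl in Hs.
  assert (Hb : abs_le (fun k => c (S k) * z ^ k) (M / rho)) by (apply coef_abs_le with rho; auto).
  destruct (abs_le_series _ _ Hb) as [s [Hs1 Hs2]].
  replace (f z - c O) with (z * s).
  - rewrite Cmod_mult. apply Rmult_le_compat_l; [apply Cmod_ge_0|exact Hs2].
  - replace (f z - c O) with (f z - (0 + c O * 1)) by ring.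
    apply (is_Cseries_scal z) in Hs1. refine (is_Cseries_unique _ _ _ Hs1 _).
    revert Hs. apply is_Cseries_ext. intros k. ring.
Qed.

(** The zeros of a power series that is not identically zero do not accumulate
    at the centre: the first nonzero coefficient dominates there. *)
Lemma power_series_identity (c : nat -> C) (rho M : R) (f : C -> C) :
  (0 < rho)%R -> power_series c rho M f ->
  (forall eps, (0 < eps)%R -> exists z, (0 < Cmod z < eps)%R /\ f z = 0) ->
  forall k, c k = 0.
Proof.
  intros Hr Hps Hz k. induction k as [k IH] using (well_founded_induction lt_wf).
  destruct Hps as [H1 H2].
  assert (Hrk : (0 < rho ^ k)%R) by pos.
  assert (Hd : forall n, (rsum (fun i => Cmod (c (k + i)%nat) * rho ^ i) n <= M / rho ^ k)%R).
  { intros n. apply Rmult_le_reg_l with (rho ^ k)%R; [exact Hrk|].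
    replace (rho ^ k * (M / rho ^ k))%R with M by (field; lra).
    apply Rle_trans with (2 := H1 (k + n)%nat). rewrite rsum_add, <- rsum_scal.
    rewrite (rsum_ext (fun j => Cmod (c (k + j)%nat) * rho ^ (k + j))%R
       (fun j => rho ^ k * (Cmod (c (k + j)%nat) * rho ^ j))%R)
      by (intros; rewrite pow_add; ring).
    assert (H := rsum_nonneg (fun k => Cmod (c k) * rho ^ k)%R k).
    specialize (H ltac:(intros; nonneg)).
    lra. }
  assert (Hg := power_series_make _ _ _ Hd).
  apply Cmod_eq_0. apply Rle_antisym; [|apply Cmod_ge_0]. apply Rnot_lt_le. intros Hlt.
  assert (HMk : (0 <= M / rho ^ k)%R) by exact (Hd O).
  set (B := (M / rho ^ k / rho)%R) in *.
  assert (HB : (0 <= B)%R) by (apply Rdiv_le_0_compat; assumption).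
  destruct (Hz (Rmin rho (Cmod (c k) / (B + 1)))%R) as [z [[Hz0 Hz1] Hfz]].
  { apply Rmin_glb_lt; [exact Hr|]. pos. }
  assert (Hz2 := Rlt_le_trans _ _ _ Hz1 (Rmin_l _ _)).
  assert (Hz3 := Rlt_le_trans _ _ _ Hz1 (Rmin_r _ _)).
  assert (Hn := power_series_near_0 _ _ _ _ z Hr Hg (Rlt_le _ _ Hz2)).
  cbv beta in Hn. rewrite Nat.add_0_r in Hn.
  assert (Hgz : Cseries (fun i => c (k + i)%nat * z ^ i) = 0).
  { apply Cseries_eq. specialize (H2 z (Rlt_le _ _ Hz2)). rewrite Hfz in H2.
    apply (is_Cseries_unshift _ _ k) in H2.
    rewrite csum_zero in H2 by (intros i Hi; rewrite IH by exact Hi; ring).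
    apply (is_Cseries_scal (/ (z ^ k))) in H2.
    replace (/ (z ^ k) * (0 - 0)) with (RtoC 0) in H2 by ring.
    revert H2. apply is_Cseries_ext. intros i. rewrite Cpow_add_r. field.
    apply Cpow_nz. apply Cmod_gt_0. exact Hz0. }
  rewrite Hgz in Hn. rewrite Cmod_minus_sym in Hn.
  replace (c k - 0) with (c k) in Hn by ring. fold B in Hn.
  assert (Cmod z * B < Cmod (c k))%R; [|lra].
  apply Rle_lt_trans with (Cmod z * (B + 1))%R; [lra|].
  apply Rlt_le_trans with (Cmod (c k) / (B + 1) * (B + 1))%R.
  - apply Rmult_lt_compat_r; lra.
  - apply Req_le. field. lra.
Qed.

(** * q-shifted factorials *)

Lemma geometric_le (x : R) (n : nat) :
  (0 <= x < 1)%R -> (rsum (fun k => x ^ k)%R n <= / (1 - x))%R.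
Proof.
  intros Hx.
  assert (E : (rsum (fun k => x ^ k)%R n * (1 - x) = 1 - x ^ n)%R).
  { induction n as [|n IH]; simpl; [ring|]. rewrite Rmult_plus_distr_r, IH. ring. }
  apply Rmult_le_reg_r with (1 - x)%R; [lra|]. rewrite E, Rinv_l by lra.
  assert (H := rpow_nonneg x n). lra.
Qed.

Section QSeries.
Context {q : C} (hq : (0 < Cmod q < 1)%R).

Local Notation P := (qpoch q).
Local Notation Pi := (qpoch_inf q).
Local Notation r := (Cmod q).

(** [q^(k (k - 1) / 2)] *)
Fixpoint qtri (k : nat) : C :=
  match k with O => 1 | S k' => qtri k' * q ^ k' end.

(** [x^k (y/x;q)_k], in a homogeneous form that includes [x = 0], where it is
    [(-y)^k q^(k (k - 1) / 2)]. *)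
Fixpoint qshift (x y : C) (k : nat) : C :=
  match k with O => 1 | S k' => qshift x y k' * (x - y * q ^ k') end.

Lemma q_neq0 : q <> 0.
Proof. apply Cmod_gt_0. lra. Qed.

Lemma qpow_neq0 (n : nat) : q ^ n <> 0.
Proof. apply Cpow_nz, q_neq0. Qed.

Lemma qtri_neq0 (n : nat) : qtri n <> 0.
Proof.
  induction n as [|n IH]; simpl; [apply C1_nz|].
  apply Cmult_neq_0; [exact IH|apply qpow_neq0].
Qed.

Lemma qpow_lt1 (n : nat) : (0 < r ^ n <= 1)%R.
Proof.
  split; [pos|].
  rewrite <- (pow1 n). apply rpow_le. lra.
Qed.

Lemma qtri_add (m n : nat) : qtri (m + n) = qtri m * qtri n * q ^ (m * n).
Proof.
  induction n as [|n IH].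
  - rewrite Nat.add_0_r, Nat.mul_0_r. simpl. ring.
  - rewrite Nat.add_succ_r. simpl. rewrite IH.
    replace (m * S n)%nat with (m * n + m)%nat by ring.
    rewrite !Cpow_add_r. ring.
Qed.

Lemma qtri_S (n : nat) : qtri (S n) = qtri n * q ^ n.
Proof. reflexivity. Qed.

Lemma qpoch_S (x : C) (n : nat) : P x (S n) = P x n * (1 - x * q ^ n).
Proof. reflexivity. Qed.

Lemma qshift_S (x y : C) (n : nat) : qshift x y (S n) = qshift x y n * (x - y * q ^ n).
Proof. reflexivity. Qed.

Lemma qpoch_add (x : C) (n m : nat) : P x (n + m) = P x n * P (x * q ^ n) m.
Proof.
  induction m as [|m IH]; [rewrite Nat.add_0_r; simpl; ring|].
  rewrite Nat.add_succ_r, !qpoch_S, IH, Cpow_add_r. ring.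
Qed.

Lemma qpoch_S_l (x : C) (n : nat) : P x (S n) = (1 - x) * P (x * q) n.
Proof.
  replace (S n) with (1 + n)%nat by lia. rewrite qpoch_add. simpl.
  replace (x * (q * 1)) with (x * q) by ring. ring.
Qed.

Lemma qshift_add (x y : C) (n m : nat) :
  qshift x y (n + m) = qshift x y n * qshift x (y * q ^ n) m.
Proof.
  induction m as [|m IH]; [rewrite Nat.add_0_r; simpl; ring|].
  rewrite Nat.add_succ_r, !qshift_S, IH, Cpow_add_r. ring.
Qed.

Lemma qshift_S_l (x y : C) (n : nat) : qshift x y (S n) = (x - y) * qshift x (y * q) n.
Proof.
  replace (S n) with (1 + n)%nat by lia. rewrite qshift_add. simpl.
  replace (y * (q * 1)) with (y * q) by ring. ring.
Qed.

Lemma qshift_scale (w x y : C) (k : nat) :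
  qshift (w * x) (w * y) k = w ^ k * qshift x y k.
Proof. induction k as [|k IH]; simpl; [ring|rewrite IH; ring]. Qed.

Lemma qshift_qpoch (x y : C) (k : nat) : x <> 0 -> qshift x y k = x ^ k * P (y / x) k.
Proof.
  intros Hx. induction k as [|k IH]; simpl; [ring|]. rewrite IH. field. exact Hx.
Qed.

Lemma qshift_1 (y : C) (k : nat) : qshift 1 y k = P y k.
Proof. induction k as [|k IH]; simpl; [reflexivity|rewrite IH; ring]. Qed.

(** The factors [1 - x q^(-i)] are rewritten as [- x q^(-i) (1 - q^i/x)]. *)
Lemma qpoch_reverse (x : C) (n : nat) :
  x <> 0 -> P (x / q ^ n) n * qtri (S n) = P (q / x) n * (- x) ^ n.
Proof.
  intros Hx. induction n as [|n IH]; [simpl; ring|].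
  rewrite qpoch_S_l. replace (x / q ^ S n * q) with (x / q ^ n).
  2:{ simpl. field. split; [apply qpow_neq0|apply q_neq0]. }
  rewrite (qtri_S (S n)), qpoch_S.
  transitivity ((P (x / q ^ n) n * qtri (S n)) * (q ^ S n - x)).
  - field. apply qpow_neq0.
  - rewrite IH. simpl. field. exact Hx.
Qed.

(** Since [1 + v <= exp v], this dominates all products of factors
    [1 + x |q|^j] with distinct [j]. *)
Definition qbound (x : R) : R := exp (x / (1 - r)).

Lemma geometric_rsum (n : nat) : (rsum (fun k => r ^ k)%R n <= / (1 - r))%R.
Proof.
  apply geometric_le. lra.
Qed.

Lemma qbound_pos (x : R) : (0 < qbound x)%R.
Proof. apply exp_pos. Qed.

Lemma qbound_le (x y : R) : (x <= y)%R -> (qbound x <= qbound y)%R.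
Proof.
  intros H. unfold qbound. destruct H as [H| ->]; [|lra].
  left. apply exp_increasing. apply Rmult_lt_compat_r; [|exact H].
  apply Rinv_0_lt_compat. lra.
Qed.

Lemma exp_geometric_le (x : R) (n : nat) :
  (0 <= x)%R -> (exp (x * rsum (fun k => r ^ k)%R n) <= qbound x)%R.
Proof.
  intros Hx. assert (H := geometric_rsum n).
  assert (H' : (x * rsum (fun k => r ^ k)%R n <= x / (1 - r))%R)
    by (apply Rmult_le_compat_l; assumption).
  unfold qbound. destruct H' as [H'| ->]; [left; apply exp_increasing, H'|lra].
Qed.

Lemma exp_ge (x : R) : (1 + x <= exp x)%R.
Proof.
  destruct (Req_dec x 0) as [->|H]; [rewrite exp_0; lra|].
  left. apply exp_ineq1. exact H.
Qed.

Lemma qshift_bound (x y : C) (rho : R) (n : nat) :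
  (0 < rho)%R -> (Cmod x <= rho)%R ->
  (Cmod (qshift x y n) <= rho ^ n * qbound (Cmod y / rho))%R.
Proof.
  intros Hr Hx.
  assert (Hy : (0 <= Cmod y / rho)%R) by (apply Rdiv_le_0_compat; [apply Cmod_ge_0|exact Hr]).
  apply Rle_trans with (rho ^ n * exp (Cmod y / rho * rsum (fun k => r ^ k)%R n))%R.
  - induction n as [|n IH].
    + simpl. rewrite Cmod_1, Rmult_0_r, exp_0. lra.
    + rewrite qshift_S, Cmod_mult. simpl rsum. rewrite Rmult_plus_distr_l, exp_plus.
      replace (rho ^ S n * (exp (Cmod y / rho * rsum (fun k => r ^ k)%R n) * exp (Cmod y / rho * r ^ n)))%R
        with ((rho ^ n * exp (Cmod y / rho * rsum (fun k => r ^ k)%R n)) * (rho * exp (Cmod y / rho * r ^ n)))%R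
        by (simpl; ring).
      apply Rmult_le_compat; [apply Cmod_ge_0|apply Cmod_ge_0|exact IH|].
      apply Rle_trans with (Cmod x + Cmod (- (y * q ^ n)))%R; [apply Cmod_triangle|].
      rewrite Cmod_opp, Cmod_mult, Cmod_pow.
      apply Rle_trans with (rho * (1 + Cmod y / rho * r ^ n))%R.
      * replace (rho * (1 + Cmod y / rho * r ^ n))%R with (rho + Cmod y * r ^ n)%R
          by (field; lra). lra.
      * apply Rmult_le_compat_l; [lra|apply exp_ge].
  - apply Rmult_le_compat_l; [nonneg|]. apply exp_geometric_le, Hy.
Qed.

Lemma qpoch_bound (x : C) (n : nat) : (Cmod (P x n) <= qbound (Cmod x))%R.
Proof.
  rewrite <- qshift_1.
  assert (H := qshift_bound 1 x 1 n Rlt_0_1). rewrite Cmod_1, pow1 in H.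
  specialize (H (Rle_refl _)). replace (Cmod x / 1)%R with (Cmod x) in H by field. lra.
Qed.

Lemma qpoch_bound_le (x : C) (m : R) (n : nat) :
  (Cmod x <= m)%R -> (Cmod (P x n) <= qbound m)%R.
Proof. intros H. apply Rle_trans with (1 := qpoch_bound x n). apply qbound_le, H. Qed.

Lemma qpoch_cvg (x : C) : Cconv (P x) (Pi x).
Proof.
  assert (H : exists l, Cconv (P x) l).
  { destruct (abs_le_series (fun k => - x * q ^ k * P x k)
      (Cmod x * qbound (Cmod x) * / (1 - r))%R) as [s [Hs _]].
    { apply abs_le_dom with (fun k => Cmod x * qbound (Cmod x) * r ^ k)%R.
      - intros k. rewrite !Cmod_mult, Cmod_opp, Cmod_pow.
        assert (H1 := qpoch_bound x k). assert (H2 := qpow_lt1 k).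
        replace (Cmod x * qbound (Cmod x) * r ^ k)%R
          with (Cmod x * r ^ k * qbound (Cmod x))%R by ring.
        apply Rmult_le_compat_l; [|exact H1].
        nonneg.
      - intros n. rewrite rsum_scal. apply Rmult_le_compat_l; [|apply geometric_rsum].
        apply Rmult_le_pos; [apply Cmod_ge_0|left; apply qbound_pos]. }
    exists (1 + s). apply is_Cseries_csum in Hs.
    apply (Cconv_plus _ _ _ _ (Cconv_const 1)) in Hs. revert Hs. apply Cconv_ext.
    intros n. induction n as [|n IH]; simpl; [ring|]. rewrite <- IH. simpl. ring. }
  destruct H as [l Hl]. unfold qpoch_inf.
  rewrite (the_eq _ l); [exact Hl|apply filterlim_Cconv, Hl|].
  intros y Hy. apply filterlim_Cconv in Hy. exact (Cconv_unique _ _ _ Hy Hl).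
Qed.

Lemma qpoch_inf_bound (x : C) (m : R) : (Cmod x <= m)%R -> (Cmod (Pi x) <= qbound m)%R.
Proof.
  intros H. apply Cconv_le with (1 := qpoch_cvg x). intros n. apply qpoch_bound_le, H.
Qed.

Lemma qpoch_inf_split (x : C) (n : nat) : Pi x = P x n * Pi (x * q ^ n).
Proof.
  apply Cconv_unique with (fun k => P x (k + n)%nat).
  - apply Cconv_shift, qpoch_cvg.
  - apply Cconv_ext with (fun k => P x n * P (x * q ^ n) k).
    + intros k. rewrite Nat.add_comm, qpoch_add. reflexivity.
    + apply Cconv_scal, qpoch_cvg.
Qed.

Lemma qpoch_inf_zero (x : C) (j : nat) : x * q ^ j = 1 -> Pi x = 0.
Proof.
  intros H. rewrite (qpoch_inf_split x (S j)), qpoch_S, H. ring.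
Qed.

Lemma qregular_shift (x : C) (n : nat) : qregular q x -> qregular q (x * q ^ n).
Proof.
  intros H j E. apply (H (n + j)%nat). rewrite Cpow_add_r, <- E. ring.
Qed.

Lemma qpoch_neq0 (x : C) (n : nat) : qregular q x -> P x n <> 0.
Proof.
  intros H. induction n as [|n IH]; [apply C1_nz|].
  apply Cmult_neq_0; [exact IH|]. intros E. apply (H n).
  replace (x * q ^ n) with (1 - (1 - x * q ^ n)) by ring. rewrite E. ring.
Qed.

Lemma small_qregular (x : C) : (Cmod x < 1)%R -> qregular q x.
Proof.
  intros H j E. assert (E' : Cmod (x * q ^ j) = 1%R) by (rewrite E; apply Cmod_1).
  rewrite Cmod_mult, Cmod_pow in E'. assert (Hj := qpow_lt1 j).
  assert (Hx := Cmod_ge_0 x).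
  assert (Cmod x * r ^ j <= Cmod x * 1)%R by (apply Rmult_le_compat_l; lra). lra.
Qed.

Lemma q_regular : qregular q q.
Proof. apply small_qregular. lra. Qed.

Lemma qpoch_q_neq0 (n : nat) : P q n <> 0.
Proof. apply qpoch_neq0, q_regular. Qed.

(** For [0 <= v <= |x| < 1] one has [1 - v >= exp (- v / (1 - |x|))], because
    [exp w >= 1 + w]; this is used with [v = |x q^n|]. *)
Lemma qpoch_small_lower (x : C) (n : nat) :
  (Cmod x < 1)%R -> (/ qbound (Cmod x / (1 - Cmod x)) <= Cmod (P x n))%R.
Proof.
  intros Hx. assert (Hx0 := Cmod_ge_0 x).
  set (y := (Cmod x / (1 - Cmod x))%R).
  assert (Hy : (0 <= y)%R) by (apply Rdiv_le_0_compat; lra).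
  apply Rle_trans with (/ exp (y * rsum (fun k => r ^ k)%R n))%R.
  { apply Rinv_le_contravar; [apply exp_pos|]. apply exp_geometric_le, Hy. }
  induction n as [|n IH].
  - simpl. rewrite Cmod_1, Rmult_0_r, exp_0. lra.
  - rewrite qpoch_S, Cmod_mult. simpl rsum. rewrite Rmult_plus_distr_l, exp_plus.
    rewrite Rinv_mult. assert (Hn := qpow_lt1 n).
    apply Rmult_le_compat; [left; apply Rinv_0_lt_compat, exp_pos|
      left; apply Rinv_0_lt_compat, exp_pos|exact IH|].
    set (w := (Cmod x * r ^ n)%R).
    assert (Hw : (0 <= w <= Cmod x)%R).
    { unfold w. split; [nonneg|].
      rewrite <- (Rmult_1_r (Cmod x)) at 2. apply Rmult_le_compat_l; lra. }
    apply Rle_trans with (1 - w)%R.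
    + apply Rmult_le_reg_r with (exp (y * r ^ n)); [apply exp_pos|].
      rewrite Rinv_l by (apply Rgt_not_eq, exp_pos).
      assert (He := exp_ge (y * r ^ n)).
      apply Rle_trans with ((1 - w) * (1 + y * r ^ n))%R; [|apply Rmult_le_compat_l; lra].
      assert (Hyw : (y * r ^ n * (1 - Cmod x) = w)%R).
      { unfold y, w. field. lra. }
      nra.
    + assert (T := Cmod_triangle (1 - x * q ^ n) (x * q ^ n)).
      replace (1 - x * q ^ n + x * q ^ n) with (RtoC 1) in T by ring.
      rewrite Cmod_1, (Cmod_mult x), Cmod_pow in T. unfold w. lra.
Qed.

(** After finitely many nonzero factors [|x q^N| < 1], and the remaining partial
    products are bounded away from zero. *)
Lemma qpoch_inf_neq0 (x : C) : qregular q x -> Pi x <> 0.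
Proof.
  intros H.
  assert (Hex : exists N, (Cmod (x * q ^ N) < 1)%R).
  { destruct (pow_lt_1_zero r) with (y := (/ (Cmod x + 1))%R) as [N HN].
    - rewrite Rabs_pos_eq; lra.
    - apply Rinv_0_lt_compat. assert (Hx := Cmod_ge_0 x). lra.
    - exists N. specialize (HN N (Nat.le_refl _)).
      rewrite Cmod_mult, Cmod_pow. rewrite Rabs_pos_eq in HN by nonneg.
      assert (Hx := Cmod_ge_0 x).
      apply Rle_lt_trans with (Cmod x * / (Cmod x + 1))%R.
      + apply Rmult_le_compat_l; lra.
      + apply Rmult_lt_reg_r with (Cmod x + 1)%R; [lra|].
        rewrite Rmult_assoc, Rinv_l by lra. lra. }
  destruct Hex as [N HN]. rewrite (qpoch_inf_split x N).
  apply Cmult_neq_0; [apply qpoch_neq0, H|]. intros E.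
  assert (Hc := qpoch_cvg (x * q ^ N)). rewrite E in Hc.
  set (b := (/ qbound (Cmod (x * q ^ N) / (1 - Cmod (x * q ^ N))))%R).
  assert (Hb : (0 < b)%R) by (apply Rinv_0_lt_compat, qbound_pos).
  destruct (Hc b Hb) as [M HM]. specialize (HM M (Nat.le_refl _)).
  replace (P (x * q ^ N) M - 0) with (P (x * q ^ N) M) in HM by ring.
  assert (Hl := qpoch_small_lower _ M HN). fold b in Hl. lra.
Qed.

(** The bound is uniform because [1/(x;q)_n = (x q^n;q)_oo / (x;q)_oo]. *)
Lemma qpoch_inv_bounded (x : C) :
  qregular q x -> exists M, (0 < M)%R /\ forall n, (Cmod (/ P x n) <= M)%R.
Proof.
  intros H. exists (/ Cmod (Pi x) * qbound (Cmod x))%R.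
  assert (H0 := qpoch_inf_neq0 x H). assert (Hp : (0 < Cmod (Pi x))%R) by (apply Cmod_gt_0, H0).
  split; [pos|].
  intros n.
  replace (/ P x n) with (/ Pi x * Pi (x * q ^ n)).
  - rewrite Cmod_mult, Cmod_inv by exact H0.
    apply Rmult_le_compat_l; [left; apply Rinv_0_lt_compat, Hp|].
    apply qpoch_inf_bound. rewrite Cmod_mult, Cmod_pow.
    rewrite <- (Rmult_1_r (Cmod x)) at 2.
    apply Rmult_le_compat_l; [apply Cmod_ge_0|apply qpow_lt1].
  - rewrite (qpoch_inf_split x n) in *. field.
    split; intros E; apply H0; rewrite E; ring.
Qed.

Lemma ratio_bounded (x y : C) :
  qregular q y -> exists M, (0 < M)%R /\ forall n, (Cmod (P x n / P y n) <= M)%R.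
Proof.
  intros H. destruct (qpoch_inv_bounded y H) as [M [HM HMn]].
  exists (qbound (Cmod x) * M)%R. split; [pos|].
  intros n. unfold Cdiv. rewrite Cmod_mult.
  apply Rmult_le_compat; try apply Cmod_ge_0; [apply qpoch_bound|apply HMn].
Qed.

(** The ratio [x |q|^k] of consecutive terms is eventually at most [1/2]. *)
Lemma qtri_geometric_bounded (x : R) :
  (0 <= x)%R -> exists M, (0 < M)%R /\ forall n, (rsum (fun k => x ^ k * Cmod (qtri k))%R n <= M)%R.
Proof.
  intros Hx.
  destruct (pow_lt_1_zero r) with (y := (/ (2 * (x + 1)))%R) as [N HN].
  { rewrite Rabs_pos_eq; lra. }
  { apply Rinv_0_lt_compat. lra. }
  assert (HN' : forall k, (N <= k)%nat -> (x * r ^ k <= / 2)%R).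
  { intros k Hk. specialize (HN k Hk). rewrite Rabs_pos_eq in HN by nonneg.
    apply Rle_trans with (x * / (2 * (x + 1)))%R; [apply Rmult_le_compat_l; lra|].
    apply Rmult_le_reg_r with (2 * (x + 1))%R; [lra|].
    rewrite Rmult_assoc, Rinv_l by lra. lra. }
  set (t := fun k => (x ^ k * Cmod (qtri k))%R).
  assert (Ht0 : forall k, (0 <= t k)%R).
  { intros k. nonneg. }
  assert (Hstep : forall k, (t (N + k)%nat <= t N * (/ 2) ^ k)%R).
  { induction k as [|k IH]; [rewrite Nat.add_0_r; simpl; lra|].
    rewrite Nat.add_succ_r.
    replace (t (S (N + k))) with (t (N + k)%nat * (x * r ^ (N + k)))%R.
    2:{ unfold t. rewrite qtri_S, Cmod_mult, Cmod_pow. simpl. ring. }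
    replace (t N * (/ 2) ^ S k)%R with ((t N * (/ 2) ^ k) * / 2)%R by (simpl; ring).
    apply Rmult_le_compat; [apply Ht0| |exact IH|apply HN'; lia].
    nonneg. }
  exists (rsum t N + t N * 2 + 1)%R.
  assert (H0 := rsum_nonneg t N Ht0). assert (H1 := Ht0 N).
  split; [lra|]. intros n.
  apply Rle_trans with (rsum t (N + n)); [apply rsum_mono; [exact Ht0|lia]|].
  rewrite rsum_add.
  assert (rsum (fun j => t (N + j)%nat) n <= t N * 2)%R; [|lra].
  apply Rle_trans with (rsum (fun k => t N * (/ 2) ^ k)%R n).
  - apply rsum_le. intros; apply Hstep.
  - rewrite rsum_scal. apply Rmult_le_compat_l; [exact H1|].
    assert (H := geometric_le (/ 2) n ltac:(lra)).
    replace (/ (1 - / 2))%R with 2%R in H by field. exact H.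
Qed.

End QSeries.

Arguments qtri q k : clear implicits.
Arguments qshift q x y k : clear implicits.
Arguments qbound q x : clear implicits.

(** * The q-binomial theorem, the q-Vandermonde sum and the transformation of Jackson *)

Section Hyper.
Context {q : C} (hq : (0 < Cmod q < 1)%R).

Local Notation P := (qpoch q).
Local Notation Pi := (qpoch_inf q).
Local Notation r := (Cmod q).
Local Notation tri := (qtri q).
Local Notation shf := (qshift q).

Lemma one_minus_qpow_neq0 (n : nat) : 1 - q ^ S n <> 0.
Proof.
  intros E. apply (q_regular hq n). change (q * q ^ n) with (q ^ S n).
  replace (q ^ S n) with (1 - (1 - q ^ S n)) by ring. rewrite E. ring.
Qed.

Lemma product_rsum (f g : nat -> R) (M N : R) (I J : nat) :
  (forall k, (0 <= f k)%R) -> (forall k, (0 <= g k)%R) ->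
  (forall n, (rsum f n <= M)%R) -> (forall n, (rsum g n <= N)%R) ->
  (rsum (fun i => rsum (fun j => f i * g j)%R J) I <= M * N)%R.
Proof.
  intros Hf Hg HM HN.
  rewrite (rsum_ext _ (fun i => rsum g J * f i)%R) by (intros; rewrite rsum_scal; ring).
  rewrite rsum_scal, Rmult_comm. apply Rmult_le_compat; auto; apply rsum_nonneg; assumption.
Qed.

Lemma qshift_ratio_bound (x y : C) (rho : R) :
  (0 < rho)%R -> (Cmod x <= rho)%R ->
  exists M, (0 < M)%R /\ forall k, (Cmod (shf x y k / P q k) <= M * rho ^ k)%R.
Proof.
  intros Hr Hx. destruct (qpoch_inv_bounded hq q (q_regular hq)) as [M [HM HMn]].
  exists (qbound q (Cmod y / rho) * M)%R.
  split; [pos|].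
  intros k. unfold Cdiv. rewrite Cmod_mult.
  replace (qbound q (Cmod y / rho) * M * rho ^ k)%R
    with (rho ^ k * qbound q (Cmod y / rho) * M)%R by ring.
  apply Rmult_le_compat; try apply Cmod_ge_0; [|apply HMn].
  apply (qshift_bound hq); lra.
Qed.

Lemma qbinomial_abs_bound (x y : C) :
  (Cmod x < 1)%R ->
  exists M, forall n, (rsum (fun k => Cmod (shf x y k / P q k) * 1 ^ k)%R n <= M)%R.
Proof.
  intros Hx. assert (Hx0 := Cmod_ge_0 x). set (rho := ((1 + Cmod x) / 2)%R).
  destruct (qshift_ratio_bound x y rho) as [M [HM HMk]]; [unfold rho; lra|unfold rho; lra|].
  exists (M * / (1 - rho))%R. intros n.
  apply Rle_trans with (rsum (fun k => M * rho ^ k)%R n).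
  - apply rsum_le. intros k _. rewrite pow1, Rmult_1_r. apply HMk.
  - rewrite rsum_scal. apply Rmult_le_compat_l; [lra|].
    apply geometric_le. unfold rho. lra.
Qed.

(** The sum [f(w)] of the series with ratio [w] satisfies
    [(1 - x w) f(w) = (1 - y w) f(q w)], which can be iterated down to [f(0) = 1]. *)
Lemma qbinomial (x y : C) :
  (Cmod x < 1)%R -> is_Cseries (fun k => shf x y k / P q k) (Pi y / Pi x).
Proof.
  intros Hx. destruct (qbinomial_abs_bound x y Hx) as [M HM].
  set (c := fun k => shf x y k / P q k) in *.
  set (f := fun z => Cseries (fun k => c k * z ^ k)).
  assert (Hps : power_series c 1 M f) by exact (power_series_make _ _ _ HM).
  assert (Hc : forall k, c (S k) * (1 - q ^ S k) = c k * (x - y * q ^ k)).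
  { intros k. unfold c. rewrite qshift_S, qpoch_S.
    change (q * q ^ k) with (q ^ S k).
    assert (H1 := one_minus_qpow_neq0 k). assert (H2 := qpoch_q_neq0 hq k).
    field. auto. }
  assert (Hfe : forall w, (Cmod w <= 1)%R -> (1 - x * w) * f w = (1 - y * w) * f (w * q)).
  { intros w Hw.
    assert (Hwq : (Cmod (w * q) <= 1)%R).
    { rewrite Cmod_mult. rewrite <- (Rmult_1_r 1).
      apply Rmult_le_compat; try apply Cmod_ge_0; lra. }
    assert (S1 := proj2 Hps w Hw). assert (S2 := proj2 Hps _ Hwq).
    assert (S3 := is_Cseries_plus _ _ _ _ (is_Cseries_scal x _ _ S1) (is_Cseries_scal (- y) _ _ S2)).
    apply (is_Cseries_scal w) in S3.
    assert (S4 := is_Cseries_plus _ _ _ _ S1 (is_Cseries_scal (- (1)) _ _ S2)).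
    apply (is_Cseries_unshift _ _ 1) in S4. simpl in S4.
    assert (E : f w + - (1) * f (w * q) - (0 + (c O * 1 + - (1) * (c O * 1)))
       = w * (x * f w + - y * f (w * q))).
    { refine (is_Cseries_unique _ _ _ S4 _). revert S3. apply is_Cseries_ext.
      intros k. transitivity (w ^ S k * (c k * (x - y * q ^ k))).
      - rewrite Cpow_mult_l. simpl. ring.
      - rewrite <- Hc. rewrite Cpow_mult_l. simpl. ring. }
    replace ((1 - x * w) * f w) with (f w - w * (x * f w + - y * f (w * q)) - w * y * f (w * q)) by ring.
    rewrite <- E. ring. }
  assert (Hqn : forall n, (Cmod (q ^ n) <= 1)%R).
  { intros n. rewrite Cmod_pow. apply qpow_lt1. exact hq. }
  assert (Hit : forall n, P x n * f 1 = P y n * f (q ^ n)).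
  { induction n as [|n IH]; [simpl; ring|].
    rewrite !qpoch_S. replace (P x n * (1 - x * q ^ n) * f 1)
      with ((1 - x * q ^ n) * (P x n * f 1)) by ring.
    rewrite IH. replace ((1 - x * q ^ n) * (P y n * f (q ^ n)))
      with (P y n * ((1 - x * q ^ n) * f (q ^ n))) by ring.
    rewrite Hfe by apply Hqn. replace (q ^ n * q) with (q ^ S n) by (simpl; ring). ring. }
  assert (Hlim : Cconv (fun n => f (q ^ n)) 1).
  { intros eps Heps.
    assert (HM0 : (0 <= M)%R) by exact (HM O).
    destruct (pow_lt_1_zero r) with (y := (eps / (M + 1))%R) as [N HN].
    - rewrite Rabs_pos_eq; lra.
    - pos.
    - exists N. intros n Hn. specialize (HN n Hn).
      rewrite Rabs_pos_eq in HN by nonneg.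
      assert (H := power_series_near_0 _ _ _ _ (q ^ n) Rlt_0_1 Hps (Hqn n)).
      replace (c O) with (RtoC 1) in H by (unfold c; simpl; field; apply C1_nz).
      apply Rle_lt_trans with (1 := H). rewrite Cmod_pow.
      replace (M / 1)%R with M by field.
      apply Rle_lt_trans with (r ^ n * (M + 1))%R.
      + apply Rmult_le_compat_l; [nonneg|lra].
      + apply Rlt_le_trans with (eps / (M + 1) * (M + 1))%R.
        * apply Rmult_lt_compat_r; lra.
        * apply Req_le. field. lra. }
  assert (E : Pi x * f 1 = Pi y * 1).
  { apply Cconv_unique with (fun n => P y n * f (q ^ n)).
    - apply Cconv_ext with (fun n => P x n * f 1); [exact Hit|].
      apply Cconv_mult; [apply (qpoch_cvg hq)|apply Cconv_const].
    - apply Cconv_mult; [apply (qpoch_cvg hq)|exact Hlim]. }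
  assert (HPx := qpoch_inf_neq0 hq x (small_qregular hq x Hx)).
  replace (Pi y / Pi x) with (f 1).
  - assert (S1 := proj2 Hps 1). rewrite Cmod_1 in S1. specialize (S1 (Rle_refl _)).
    revert S1. apply is_Cseries_ext. intros k. rewrite Cpow_1_l. ring.
  - replace (Pi y) with (Pi y * 1) by ring. rewrite <- E. field. exact HPx.
Qed.

Lemma qbinomial_at (x y z : C) :
  (Cmod (z * x) < 1)%R ->
  is_Cseries (fun k => shf x y k / P q k * z ^ k) (Pi (z * y) / Pi (z * x)).
Proof.
  intros H. apply (qbinomial (z * x) (z * y)) in H. revert H. apply is_Cseries_ext.
  intros k. rewrite qshift_scale. field. apply (qpoch_q_neq0 hq).
Qed.

Lemma qshift_01 (k : nat) : shf 0 1 k = (- (1)) ^ k * tri k.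
Proof. induction k as [|k IH]; simpl; [ring|rewrite IH; ring]. Qed.

Lemma qpoch_inf_0 : Pi 0 = 1.
Proof.
  apply Cconv_unique with (P 0); [apply (qpoch_cvg hq)|].
  apply Cconv_ext with (fun _ => 1); [|apply Cconv_const].
  induction n as [|n IH]; simpl; [reflexivity|rewrite <- IH; ring].
Qed.

Lemma euler_series (z : C) :
  is_Cseries (fun k => (- (1)) ^ k * tri k / P q k * z ^ k) (Pi z).
Proof.
  assert (H := qbinomial_at 0 1 z).
  rewrite Cmult_0_r, Cmod_0, qpoch_inf_0, Cmult_1_r in H. specialize (H Rlt_0_1).
  replace (Pi z / 1) with (Pi z) in H by field. revert H. apply is_Cseries_ext.
  intros k. rewrite qshift_01. reflexivity.
Qed.

(** Pascal's rule for the Gaussian binomial coefficients, in the form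
    [1 - q^(n+1) = (1 - q^(n+1-k)) + q^(n+1-k) (1 - q^k)], gives the induction. *)
Lemma qvandermonde (n : nat) : forall B D : C,
  csum (fun k => (- (1)) ^ k * tri k * shf B D k * P (D * q ^ k) (n - k) /
                 (P q k * P q (n - k))) (S n) = P B n / P q n.
Proof.
  induction n as [|n IH]; intros B D.
  { simpl. field. }
  assert (Hq := qpoch_q_neq0 hq). assert (Hq1 := one_minus_qpow_neq0).
  set (T := fun n D k => (- (1)) ^ k * tri k * shf B D k * P (D * q ^ k) (n - k) /
                 (P q k * P q (n - k))) in *.
  change (csum (T (S n) D) (S (S n)) = P B (S n) / P q (S n)).
  assert (E1 : csum (fun k => (1 - q ^ (S n - k)) * T (S n) D k) (S (S n))
             = (1 - D * q ^ n) * csum (T n D) (S n)).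
  { change (csum (fun k => (1 - q ^ (S n - k)) * T (S n) D k) (S n)
        + (1 - q ^ (S n - S n)) * T (S n) D (S n) = (1 - D * q ^ n) * csum (T n D) (S n)).
    rewrite Nat.sub_diag. change (q ^ 0) with (RtoC 1).
    rewrite <- csum_scal.
    match goal with |- ?x + _ = ?y => assert (E : x = y); [|rewrite E; ring] end.
    apply csum_ext. intros k Hk. unfold T.
    replace (S n - k)%nat with (S (n - k)) by lia. rewrite !qpoch_S.
    change (q * q ^ (n - k)) with (q ^ S (n - k)).
    replace (D * q ^ k * q ^ (n - k)) with (D * q ^ n).
    2:{ replace n with (k + (n - k))%nat at 1 by lia. rewrite Cpow_add_r. ring. }
    field; repeat split; auto. }
  assert (E2 : csum (fun k => q ^ (S n - k) * (1 - q ^ k) * T (S n) D k) (S (S n))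
             = - (B - D) * q ^ n * csum (T n (D * q)) (S n)).
  { rewrite csum_S. change (q ^ 0) with (RtoC 1). rewrite <- csum_scal.
    match goal with |- _ + ?x = ?y => assert (E : x = y); [|rewrite E; ring] end.
    apply csum_ext. intros k Hk. unfold T.
    replace (S n - S k)%nat with (n - k)%nat by lia.
    rewrite qshift_S_l, qtri_S, (qpoch_S q k). change (q * q ^ k) with (q ^ S k).
    replace (D * q ^ S k) with (D * q * q ^ k) by (simpl; ring).
    replace (q ^ n) with (q ^ (n - k) * q ^ k).
    2:{ rewrite <- Cpow_add_r. f_equal. lia. }
    change ((- (1)) ^ S k) with (- (1) * (- (1)) ^ k).
    field; repeat split; auto. }
  assert (E3 : csum (fun k => (1 - q ^ (S n - k)) * T (S n) D k) (S (S n)) +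
     csum (fun k => q ^ (S n - k) * (1 - q ^ k) * T (S n) D k) (S (S n))
     = (1 - q ^ S n) * csum (T (S n) D) (S (S n))).
  { rewrite <- csum_plus, <- csum_scal. apply csum_ext. intros k Hk.
    replace (q ^ S n) with (q ^ (S n - k) * q ^ k).
    2:{ rewrite <- Cpow_add_r. f_equal. lia. }
    ring. }
  assert (IH1 : csum (T n D) (S n) = P B n / P q n) by exact (IH B D).
  assert (IH2 : csum (T n (D * q)) (S n) = P B n / P q n) by exact (IH B (D * q)).
  rewrite E1, E2, IH1, IH2 in E3.
  replace (csum (T (S n) D) (S (S n))) with
    (/ (1 - q ^ S n) * ((1 - q ^ S n) * csum (T (S n) D) (S (S n)))) by (field; auto).
  rewrite <- E3, !qpoch_S. change (q * q ^ n) with (q ^ S n). field. auto.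
Qed.

(** Coefficients of the series [(A z;q)_oo 2phi2(A, D/B; D, A z; q, B z)],
    written so that [B = 0] and zeros of [(A z;q)_oo] are harmless. *)
Definition jackson_coef (A B D : C) (k : nat) : C :=
  P A k * ((- (1)) ^ k * tri k * shf B D k) / (P q k * P D k).

(** This is [(z;q)_oo 2phi1(A, B; D; q, z)], as an entire function of [z]. *)
Definition jackson (A B D z : C) : C :=
  Cseries (fun k => jackson_coef A B D k * z ^ k * Pi (A * q ^ k * z)).

Lemma Cmod_sign (k : nat) : Cmod ((- (1)) ^ k) = 1%R.
Proof. rewrite Cmod_pow, Cmod_m1. apply pow1. Qed.

Lemma jackson_coef_bound (A B D : C) (rho : R) :
  (Cmod B < rho)%R -> qregular q D ->
  exists M, (0 < M)%R /\
    forall k, (Cmod (jackson_coef A B D k) <= M * (rho ^ k * Cmod (tri k)))%R.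
Proof.
  intros HB HD. assert (HB0 := Cmod_ge_0 B).
  destruct (qshift_ratio_bound B D rho ltac:(lra) ltac:(lra)) as [M [HM HMk]].
  destruct (ratio_bounded hq A D HD) as [N [HN HNk]].
  exists (N * M)%R. split; [pos|]. intros k.
  replace (jackson_coef A B D k) with
    ((P A k / P D k) * (shf B D k / P q k) * ((- (1)) ^ k * tri k)).
  2:{ unfold jackson_coef.
    assert (H1 := qpoch_neq0 D k HD). assert (H2 := qpoch_q_neq0 hq k). field. auto. }
  rewrite !Cmod_mult, Cmod_sign, Rmult_1_l.
  replace (N * M * (rho ^ k * Cmod (tri k)))%R with (N * (M * rho ^ k) * Cmod (tri k))%R by ring.
  apply Rmult_le_compat_r; [apply Cmod_ge_0|].
  apply Rmult_le_compat; try apply Cmod_ge_0; auto.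
Qed.

Lemma jackson_is_series (A B D z : C) :
  qregular q D ->
  is_Cseries (fun k => jackson_coef A B D k * z ^ k * Pi (A * q ^ k * z)) (jackson A B D z).
Proof.
  intros HD. assert (HB : (Cmod B < Cmod B + 1)%R) by lra.
  destruct (jackson_coef_bound A B D _ HB HD) as [M [HM HMk]].
  assert (HB0 := Cmod_ge_0 B). assert (Hz0 := Cmod_ge_0 z).
  destruct (qtri_geometric_bounded hq ((Cmod B + 1) * Cmod z)%R) as [N [HN HNk]].
  { nonneg. }
  apply abs_le_is_series with (M * qbound q (Cmod A * Cmod z) * N)%R.
  apply abs_le_dom with (fun k => M * qbound q (Cmod A * Cmod z) * (((Cmod B + 1) * Cmod z) ^ k * Cmod (tri k)))%R.
  - intros k. rewrite !Cmod_mult, Cmod_pow, Rpow_mult_distr.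
    replace (M * qbound q (Cmod A * Cmod z) * ((Cmod B + 1) ^ k * Cmod z ^ k * Cmod (tri k)))%R
      with (M * ((Cmod B + 1) ^ k * Cmod (tri k)) * Cmod z ^ k * qbound q (Cmod A * Cmod z))%R by ring.
    apply Rmult_le_compat; try apply Cmod_ge_0.
    + nonneg.
    + apply Rmult_le_compat_r; [nonneg|apply HMk].
    + apply (qpoch_inf_bound hq). rewrite !Cmod_mult, Cmod_pow.
      assert (H := qpow_lt1 hq k). assert (HA := Cmod_ge_0 A).
      apply Rmult_le_compat_r; [exact Hz0|]. rewrite <- (Rmult_1_r (Cmod A)) at 2.
      apply Rmult_le_compat_l; lra.
  - intros n. rewrite rsum_scal. apply Rmult_le_compat_l; [|apply HNk].
    apply Rmult_le_pos; [lra|left; apply qbound_pos].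
Qed.

(** Jackson's transformation: [(B;q)_k/(D;q)_k] is expanded by the q-Vandermonde
    sum, and the inner sums are evaluated by the q-binomial theorem. *)
Lemma jackson_transformation (A B D z : C) :
  qregular q D -> (Cmod z < 1)%R ->
  is_Cseries (phi21_term q A B D z) (jackson A B D z / Pi z).
Proof.
  intros HD Hz. assert (Hz0 := Cmod_ge_0 z).
  assert (Hq := qpoch_q_neq0 hq). assert (HDn := fun k => qpoch_neq0 D k HD).
  set (a := fun k s => (- (1)) ^ k * tri k * shf B D k / (P q k * P D k) * z ^ k *
     (P A (k + s) / P q s * z ^ s)).
  assert (HB : (Cmod B < Cmod B + 1)%R) by lra. assert (HB0 := Cmod_ge_0 B).
  destruct (jackson_coef_bound 0 B D _ HB HD) as [M [HM HMk]].
  destruct (qpoch_inv_bounded hq q (q_regular hq)) as [M' [HM' HMk']].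
  destruct (qtri_geometric_bounded hq ((Cmod B + 1) * Cmod z)%R) as [N [HN HNk]].
  { nonneg. }
  assert (HP0 : forall k, P 0 k = 1).
  { induction k as [|k IH]; simpl; [reflexivity|rewrite IH; ring]. }
  set (L := (M * (qbound q (Cmod A) * M'))%R).
  assert (HL : (0 <= L)%R).
  { unfold L. apply Rmult_le_pos; [lra|]. apply Rmult_le_pos; [left; apply qbound_pos|lra]. }
  assert (HA : forall I J, (rsum (fun i => rsum (fun j => Cmod (a i j)) J) I <=
     (L * N) * / (1 - Cmod z))%R).
  { intros I J.
    apply Rle_trans with (rsum (fun i => rsum (fun j =>
      L * (((Cmod B + 1) * Cmod z) ^ i * Cmod (tri i)) * Cmod z ^ j)%R J) I).
    - apply rsum_le. intros i _. apply rsum_le. intros j _. unfold a.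
      replace ((- (1)) ^ i * tri i * shf B D i / (P q i * P D i)) with (jackson_coef 0 B D i).
      2:{ unfold jackson_coef. rewrite HP0. field. auto. }
      unfold Cdiv. rewrite !Cmod_mult, !Cmod_pow, Rpow_mult_distr. unfold L.
      replace (M * (qbound q (Cmod A) * M') * ((Cmod B + 1) ^ i * Cmod z ^ i * Cmod (tri i)) * Cmod z ^ j)%R
       with ((M * ((Cmod B + 1) ^ i * Cmod (tri i)) * Cmod z ^ i) * (qbound q (Cmod A) * M' * Cmod z ^ j))%R by ring.
      apply Rmult_le_compat.
      + nonneg.
      + nonneg.
      + apply Rmult_le_compat_r; [nonneg|apply HMk].
      + apply Rmult_le_compat_r; [nonneg|].
        apply Rmult_le_compat; try apply Cmod_ge_0; [apply (qpoch_bound hq)|apply HMk'].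
    - apply (product_rsum (fun i => L * (((Cmod B + 1) * Cmod z) ^ i * Cmod (tri i)))%R (fun j => Cmod z ^ j)%R).
      + intros. apply Rmult_le_pos; [exact HL|]. apply Rmult_le_pos; [|apply Cmod_ge_0].
        nonneg.
      + intros. nonneg.
      + intros. rewrite rsum_scal. apply Rmult_le_compat_l; [exact HL|apply HNk].
      + intros. apply geometric_le. lra. }
  destruct (Cseries_diagonal _ _ HA) as (s & H1 & H2 & _).
  assert (HPz := qpoch_inf_neq0 hq z (small_qregular hq z Hz)).
  assert (E : s = jackson A B D z / Pi z).
  { assert (HJ := is_Cseries_scal (/ Pi z) _ _ (jackson_is_series A B D z HD)).
    replace (jackson A B D z / Pi z) with (/ Pi z * jackson A B D z) by (field; exact HPz).
    refine (is_Cseries_unique _ _ _ H1 _). revert HJ. apply is_Cseries_ext. intros k.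
    symmetry. apply Cseries_eq.
    assert (Hb := qbinomial_at 1 (A * q ^ k) z). rewrite Cmult_1_r in Hb.
    specialize (Hb Hz). apply (is_Cseries_scal (jackson_coef A B D k * z ^ k)) in Hb.
    replace (/ Pi z * (jackson_coef A B D k * z ^ k * Pi (A * q ^ k * z)))
      with (jackson_coef A B D k * z ^ k * (Pi (z * (A * q ^ k)) / Pi z)).
    2:{ rewrite (Cmult_comm z). field. exact HPz. }
    revert Hb. apply is_Cseries_ext. intros j. unfold a, jackson_coef.
    rewrite qpoch_add, qshift_1. field. auto. }
  rewrite <- E. revert H2. apply is_Cseries_ext. intros k.
  unfold phi21_term, qpochs. simpl map. unfold Cprod. simpl fold_right.
  replace (P A k * (P B k * 1) / (P q k * (P D k * 1)) * z ^ k)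
    with (P A k * z ^ k / P D k * (P B k / P q k)) by (field; auto).
  rewrite <- (qvandermonde k B D), <- csum_scal. apply csum_ext. intros j Hj. unfold a.
  replace (j + (k - j))%nat with k by lia.
  replace (z ^ k) with (z ^ j * z ^ (k - j)) by (rewrite <- Cpow_add_r; f_equal; lia).
  assert (ED : P D k = P D j * P (D * q ^ j) (k - j)).
  { rewrite <- qpoch_add. f_equal. lia. }
  assert (HDj := HDn k). rewrite ED in *.
  field. repeat split; auto. intros E0; apply HDj; rewrite E0; ring.
Qed.

(** Coefficient sequences of the entire functions that occur as numerators over
    [(z;q)_oo]. *)
Definition gauss_decay (s : R) (e : nat -> C) : Prop :=
  exists M : R, (0 <= M)%R /\ forall k, (Cmod (e k) <= M * s ^ k * Cmod (tri k))%R.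

Lemma gauss_decay_bounded (s : R) (e : nat -> C) (rho : R) :
  (0 <= rho)%R -> (0 <= s)%R -> gauss_decay s e ->
  exists M, forall n, (rsum (fun k => Cmod (e k) * rho ^ k)%R n <= M)%R.
Proof.
  intros Hr Hs (M & HM & He).
  destruct (qtri_geometric_bounded hq (s * rho)%R) as [N [HN HNk]].
  { nonneg. }
  exists (M * N)%R. intros n.
  apply Rle_trans with (rsum (fun k => M * ((s * rho) ^ k * Cmod (tri k)))%R n).
  - apply rsum_le. intros k _. rewrite Rpow_mult_distr.
    replace (M * (s ^ k * rho ^ k * Cmod (tri k)))%R with (M * s ^ k * Cmod (tri k) * rho ^ k)%R by ring.
    apply Rmult_le_compat_r; [nonneg|apply He].
  - rewrite rsum_scal. apply Rmult_le_compat_l; [exact HM|apply HNk].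
Qed.

(** Euler's series expands [(A q^k z;q)_oo] in powers [z^i] with the factor
    [q^(i (i - 1) / 2 + k i)]; together with the [q^(k (k - 1) / 2)] of Jackson's
    series this is [q] to the power [(k + i) (k + i - 1) / 2]. *)
Lemma jackson_entire (A B D : C) :
  qregular q D ->
  exists s e, (1 <= s)%R /\ gauss_decay s e /\
    forall z, is_Cseries (fun k => e k * z ^ k) (jackson A B D z).
Proof.
  intros HD. assert (HB : (Cmod B < Cmod B + 1)%R) by lra.
  assert (HB0 := Cmod_ge_0 B). assert (HA0 := Cmod_ge_0 A).
  destruct (jackson_coef_bound A B D _ HB HD) as [M [HM HMk]].
  destruct (qpoch_inv_bounded hq q (q_regular hq)) as [M' [HM' HMk']].
  assert (Hq := qpoch_q_neq0 hq).
  set (b := fun k s => jackson_coef A B D k * ((- (1)) ^ s * tri s / P q s * (A * q ^ k) ^ s)).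
  assert (Hb : forall k s, (Cmod (b k s) <= M * M' * ((Cmod B + 1) ^ k * Cmod A ^ s * Cmod (tri (k + s))))%R).
  { intros k s. unfold b, Cdiv. rewrite qtri_add, !Cmod_mult, Cmod_sign, !Cmod_pow, Cmod_mult, Cmod_pow.
    rewrite Rpow_mult_distr, <- pow_mult.
    replace (M * M' * ((Cmod B + 1) ^ k * Cmod A ^ s * (Cmod (tri k) * Cmod (tri s) * r ^ (k * s))))%R
     with ((M * ((Cmod B + 1) ^ k * Cmod (tri k))) * (Cmod (tri s) * M' * (Cmod A ^ s * r ^ (k * s))))%R by ring.
    rewrite Rmult_1_l.
    assert (H0 : (0 <= Cmod A ^ s * r ^ (k * s))%R).
    { nonneg. }
    apply Rmult_le_compat; [apply Cmod_ge_0| |apply HMk|].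
    - apply Rmult_le_pos; [|exact H0]. nonneg.
    - apply Rmult_le_compat_r; [exact H0|].
      apply Rmult_le_compat_l; [apply Cmod_ge_0|apply HMk']. }
  exists (2 * (Cmod B + 1 + Cmod A))%R, (fun k => csum (fun j => b j (k - j)%nat) (S k)).
  split; [lra|]. split.
  - exists (M * M')%R. split; [nonneg|]. intros k.
    apply Rle_trans with (1 := csum_le _ _).
    apply Rle_trans with (rsum (fun _ => M * M' * ((Cmod B + 1 + Cmod A) ^ k * Cmod (tri k)))%R (S k)).
    + apply rsum_le. intros j Hj. apply Rle_trans with (1 := Hb _ _).
      replace (j + (k - j))%nat with k by lia.
      apply Rmult_le_compat_l; [nonneg|].
      apply Rmult_le_compat_r; [apply Cmod_ge_0|].
      replace ((Cmod B + 1 + Cmod A) ^ k)%R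
        with ((Cmod B + 1 + Cmod A) ^ j * (Cmod B + 1 + Cmod A) ^ (k - j))%R.
      2:{ rewrite <- pow_add. f_equal. lia. }
      apply Rmult_le_compat; try nonneg; apply rpow_le; lra.
    + assert (Ec : forall (x : R) n, rsum (fun _ => x) n = (INR n * x)%R).
      { intros x n. induction n as [|n IH]; [simpl; ring|]. rewrite S_INR. simpl. rewrite IH. ring. }
      rewrite Ec, Rpow_mult_distr.
      assert (H2 : (INR (S k) <= 2 ^ k)%R).
      { clear. induction k as [|k IH]; [simpl; lra|]. rewrite S_INR. simpl pow.
        assert (1 <= 2 ^ k)%R by (apply pow_R1_Rle; lra). lra. }
      replace (M * M' * (2 ^ k * (Cmod B + 1 + Cmod A) ^ k) * Cmod (tri k))%R
        with (2 ^ k * (M * M' * ((Cmod B + 1 + Cmod A) ^ k * Cmod (tri k))))%R by ring.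
      apply Rmult_le_compat_r; [|exact H2].
      apply Rmult_le_pos; [nonneg|].
      nonneg.
  - intros z. assert (Hz0 := Cmod_ge_0 z).
    destruct (qtri_geometric_bounded hq ((Cmod B + 1) * Cmod z)%R) as [N [HN HNk]].
    { nonneg. }
    destruct (qtri_geometric_bounded hq (Cmod A * Cmod z)%R) as [N' [HN' HNk']].
    { nonneg. }
    assert (HH : forall I J, (rsum (fun i => rsum (fun j => Cmod (b i j * z ^ i * z ^ j)) J) I
        <= (M * M' * N) * N')%R).
    { intros I J.
      apply Rle_trans with (rsum (fun i => rsum (fun j =>
       M * M' * (((Cmod B + 1) * Cmod z) ^ i * Cmod (tri i)) * ((Cmod A * Cmod z) ^ j * Cmod (tri j)))%R J) I).
      - apply rsum_le. intros i _. apply rsum_le. intros j _.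
        rewrite !Cmod_mult, !Cmod_pow, !Rpow_mult_distr.
        replace (M * M' * ((Cmod B + 1) ^ i * Cmod z ^ i * Cmod (tri i)) * (Cmod A ^ j * Cmod z ^ j * Cmod (tri j)))%R
        with (M * M' * ((Cmod B + 1) ^ i * Cmod A ^ j * (Cmod (tri i) * Cmod (tri j))) * Cmod z ^ i * Cmod z ^ j)%R by ring.
        apply Rmult_le_compat_r; [nonneg|].
        apply Rmult_le_compat_r; [nonneg|].
        apply Rle_trans with (1 := Hb i j).
        apply Rmult_le_compat_l; [nonneg|].
        apply Rmult_le_compat_l; [nonneg|].
        rewrite qtri_add, !Cmod_mult, Cmod_pow.
        rewrite <- (Rmult_1_r (Cmod (tri i) * Cmod (tri j))) at 2.
        apply Rmult_le_compat_l; [nonneg|apply (qpow_lt1 hq)].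
      - apply (product_rsum (fun i => M * M' * (((Cmod B + 1) * Cmod z) ^ i * Cmod (tri i)))%R
            (fun j => (Cmod A * Cmod z) ^ j * Cmod (tri j))%R).
        + intros. apply Rmult_le_pos; [nonneg|].
          nonneg.
        + intros. nonneg.
        + intros. rewrite rsum_scal. apply Rmult_le_compat_l; [nonneg|apply HNk].
        + exact HNk'. }
    destruct (Cseries_diagonal _ _ HH) as (s & H1 & H2 & _).
    assert (E : s = jackson A B D z).
    { refine (is_Cseries_unique _ _ _ H1 _).
      assert (HJ := jackson_is_series A B D z HD). revert HJ. apply is_Cseries_ext.
      intros k. symmetry. apply Cseries_eq.
      assert (He := is_Cseries_scal (jackson_coef A B D k * z ^ k) _ _ (euler_series (A * q ^ k * z))).
      revert He. apply is_Cseries_ext. intros j. unfold b.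
      rewrite !Cpow_mult_l. field. apply Hq. }
    rewrite <- E. revert H2. apply is_Cseries_ext. intros k.
    rewrite (Cmult_comm _ (z ^ k)), <- csum_scal. apply csum_ext. intros j Hj.
    replace (z ^ k) with (z ^ j * z ^ (k - j)) by (rewrite <- Cpow_add_r; f_equal; lia). ring.
Qed.

End Hyper.

Arguments jackson_coef q A B D k : clear implicits.
Arguments jackson q A B D z : clear implicits.
Arguments gauss_decay q s e : clear implicits.

(** * Analytic continuation of the 2phi1 *)

Definition local_power_series (f : C -> C) : Prop :=
  exists rho M, (0 < rho)%R /\ has_power_series rho M f.

Lemma local_ps_mult (f g : C -> C) :
  local_power_series f -> local_power_series g -> local_power_series (fun w => f w * g w).
Proof.
  intros (rho & M & Hr & H) (rho' & M' & Hr' & H').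
  assert (Hm := Rmin_l rho rho'). assert (Hm' := Rmin_r rho rho').
  assert (H0 : (0 < Rmin rho rho')%R) by (apply Rmin_glb_lt; assumption).
  exists (Rmin rho rho'), (M * M')%R. split; [exact H0|].
  apply has_ps_mult; [lra|apply has_ps_restrict with rho; [lra|exact H]|
    apply has_ps_restrict with rho'; [lra|exact H']].
Qed.

Lemma local_ps_minus (f g : C -> C) :
  local_power_series f -> local_power_series g -> local_power_series (fun w => f w - g w).
Proof.
  intros (rho & M & Hr & H) (rho' & M' & Hr' & H').
  assert (Hm := Rmin_l rho rho'). assert (Hm' := Rmin_r rho rho').
  assert (H0 : (0 < Rmin rho rho')%R) by (apply Rmin_glb_lt; assumption).
  exists (Rmin rho rho'), (M + Cmod (- (1)) * M')%R. split; [exact H0|].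
  apply has_ps_ext with (fun w => f w + - (1) * g w); [intros; ring|].
  apply has_ps_plus; [lra|apply has_ps_restrict with rho; [lra|exact H]|].
  apply has_ps_scal, has_ps_restrict with rho'; [lra|exact H'].
Qed.

Lemma local_ps_ext (f g : C -> C) :
  (forall w, f w = g w) -> local_power_series f -> local_power_series g.
Proof.
  intros E (rho & M & Hr & H). exists rho, M. split; [exact Hr|].
  apply has_ps_ext with f; auto.
Qed.

Lemma local_ps_analytic (F : C -> C) (z0 : C) :
  local_power_series (fun w => F (z0 + w)) -> analytic_at F z0.
Proof.
  intros (rho & M & Hr & c & _ & H). exists c, rho. split; [exact Hr|].
  intros z Hz. specialize (H (z - z0)). replace (z0 + (z - z0)) with z in H by ring.
  apply H. lra.
Qed.

(** Convergence at one point at distance [3 r / 4] bounds the coefficients,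
    whence a majorant at the smaller radius [r / 2]. *)
Lemma analytic_local_ps (F : C -> C) (z0 : C) :
  analytic_at F z0 -> local_power_series (fun w => F (z0 + w)).
Proof.
  intros (c & r & Hr & H).
  assert (Hs : is_Cseries (fun k => c k * (RtoC (3 / 4 * r)) ^ k) (F (z0 + RtoC (3 / 4 * r)))).
  { specialize (H (z0 + RtoC (3 / 4 * r))).
    replace (z0 + RtoC (3 / 4 * r) - z0) with (RtoC (3 / 4 * r)) in H by ring.
    apply H. rewrite Cmod_R, Rabs_pos_eq; lra. }
  apply is_Cseries_csum in Hs. destruct (Cconv_bounded _ _ Hs) as [M HMn].
  assert (HM := Rle_trans _ _ _ (Cmod_ge_0 _) (HMn O)).
  assert (Hc : forall k, (Cmod (c k) * (3 / 4 * r) ^ k <= 2 * M)%R).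
  { intros k. assert (H1 := HMn k). assert (H2 := HMn (S k)). simpl in H2.
    replace (Cmod (c k) * (3 / 4 * r) ^ k)%R with (Cmod (c k * RtoC (3 / 4 * r) ^ k)).
    2:{ rewrite Cmod_mult, Cmod_pow, Cmod_R, Rabs_pos_eq by lra. reflexivity. }
    set (x := csum (fun k => c k * RtoC (3 / 4 * r) ^ k) k) in *.
    set (y := c k * RtoC (3 / 4 * r) ^ k) in *.
    replace y with ((x + y) + - x) by ring.
    apply Rle_trans with (1 := Cmod_triangle _ _). rewrite Cmod_opp. lra. }
  exists (r / 2)%R, (2 * M * / (1 - 2 / 3))%R. split; [lra|].
  exists c. split.
  - intros n. apply Rle_trans with (rsum (fun k => 2 * M * (2 / 3) ^ k)%R n).
    + apply rsum_le. intros k _.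
      replace (r / 2)%R with (2 / 3 * (3 / 4 * r))%R by field.
      rewrite Rpow_mult_distr. specialize (Hc k).
      replace (Cmod (c k) * ((2 / 3) ^ k * (3 / 4 * r) ^ k))%R
        with (Cmod (c k) * (3 / 4 * r) ^ k * (2 / 3) ^ k)%R by ring.
      apply Rmult_le_compat_r; [nonneg|exact Hc].
    + rewrite rsum_scal. apply Rmult_le_compat_l; [lra|]. apply geometric_le. lra.
  - intros w Hw. specialize (H (z0 + w)).
    replace (z0 + w - z0) with w in H by ring. apply H. lra.
Qed.

(** Analytic continuation along a segment: the points of the segment up to
    which two functions agree form a set that is open and closed. *)
Lemma analytic_segment (F G : C -> C) (w d : C) :
  (Cmod w < 1)%R ->
  (forall z, (Cmod z < 1)%R -> F z = G z) ->
  (forall s, (0 <= s <= 1)%R -> analytic_at F (w + RtoC s * d) /\ analytic_at G (w + RtoC s * d)) ->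
  F (w + d) = G (w + d).
Proof.
  intros Hw Hdisc Han.
  destruct (Req_dec (Cmod d) 0) as [Hd|Hd].
  { apply Cmod_eq_0 in Hd. subst d. replace (w + 0) with w by ring. auto. }
  assert (Hd0 : (0 < Cmod d)%R) by (assert (H := Cmod_ge_0 d); lra).
  set (Z := fun s : R => F (w + RtoC s * d) - G (w + RtoC s * d) = 0).
  set (S := fun s : R => (0 <= s <= 1)%R /\ forall s', (0 <= s' <= s)%R -> Z s').
  set (e := Rmin 1 ((1 - Cmod w) / (2 * Cmod d))).
  assert (He : (0 < e)%R).
  { apply Rmin_glb_lt; [lra|]. pos. }
  assert (HSe : S e).
  { split; [split; [lra|apply Rmin_l]|]. intros s' Hs'. unfold Z.
    rewrite Hdisc; [ring|]. apply Rle_lt_trans with (1 := Cmod_triangle _ _).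
    rewrite Cmod_mult, Cmod_R, Rabs_pos_eq by lra.
    assert (s' * Cmod d <= (1 - Cmod w) / (2 * Cmod d) * Cmod d)%R.
    { apply Rmult_le_compat_r; [lra|]. apply Rle_trans with e; [lra|apply Rmin_r]. }
    replace ((1 - Cmod w) / (2 * Cmod d) * Cmod d)%R with ((1 - Cmod w) / 2)%R in H
      by (field; lra). lra. }
  destruct (completeness S) as [sg [Hub Hlub]].
  { exists 1%R. intros s [Hs _]. lra. }
  { exists e. exact HSe. }
  assert (Hsg : (e <= sg)%R) by (apply Hub, HSe).
  assert (Hsg1 : (sg <= 1)%R) by (apply Hlub; intros s [Hs _]; lra).
  assert (Hbelow : forall s, (0 <= s < sg)%R -> Z s).
  { intros s Hs. apply Classical_Prop.NNPP. intros Hn.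
    assert (sg <= s)%R; [|lra]. apply Hlub. intros s1 [Hs1 HZ].
    apply Rnot_lt_le. intros Hlt. apply Hn, HZ. lra. }
  destruct (Han sg ltac:(lra)) as [HF HG].
  assert (HL := local_ps_minus _ _ (analytic_local_ps _ _ HF) (analytic_local_ps _ _ HG)).
  destruct HL as (rho & M & Hrho & c & Hps).
  assert (Hc := power_series_identity _ _ _ _ Hrho Hps).
  assert (Hacc : forall eps, (0 < eps)%R -> exists z, (0 < Cmod z < eps)%R /\
     F (w + RtoC sg * d + z) - G (w + RtoC sg * d + z) = 0).
  { intros eps Heps. set (t := Rmin (eps / (2 * Cmod d)) (sg / 2)).
    assert (Ht : (0 < t)%R).
    { apply Rmin_glb_lt; [pos|lra]. }
    assert (Ht1 : (t <= eps / (2 * Cmod d))%R) by apply Rmin_l.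
    assert (Ht2 : (t <= sg / 2)%R) by apply Rmin_r.
    exists (RtoC (- t) * d). split.
    - rewrite Cmod_mult, Cmod_R, Rabs_Ropp, Rabs_pos_eq by lra.
      split; [pos|].
      apply Rle_lt_trans with (eps / (2 * Cmod d) * Cmod d)%R.
      + apply Rmult_le_compat_r; lra.
      + replace (eps / (2 * Cmod d) * Cmod d)%R with (eps / 2)%R by (field; lra). lra.
    - assert (HZ := Hbelow (sg - t)%R ltac:(lra)). unfold Z in HZ.
      replace (w + RtoC sg * d + RtoC (- t) * d) with (w + RtoC (sg - t) * d); [exact HZ|].
      rewrite RtoC_minus, RtoC_opp. ring. }
  specialize (Hc Hacc).
  assert (Hzero : forall s, (Rabs (s - sg) * Cmod d <= rho)%R -> Z s).
  { intros s Hs. assert (H := proj2 Hps (RtoC (s - sg) * d)).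
    rewrite Cmod_mult, Cmod_R in H. specialize (H Hs). unfold Z.
    replace (w + RtoC s * d) with (w + RtoC sg * d + RtoC (s - sg) * d)
      by (rewrite RtoC_minus; ring).
    refine (is_Cseries_unique _ _ _ H _).
    assert (H0 := is_Cseries_finite (fun k => c k * (RtoC (s - sg) * d) ^ k) 0).
    apply H0. intros k _. rewrite Hc. ring. }
  destruct (Rlt_or_le sg 1) as [Hlt|Hge].
  - exfalso. set (s1 := Rmin 1 (sg + rho / Cmod d)).
    assert (Hp : (0 < rho / Cmod d)%R) by pos.
    assert (Hs1 : (sg < s1)%R) by (apply Rmin_glb_lt; lra).
    assert (Hs2 : (s1 <= sg + rho / Cmod d)%R) by apply Rmin_r.
    assert (HS1 : S s1).
    { split; [split; [lra|apply Rmin_l]|]. intros s' Hs'.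
      destruct (Rlt_or_le s' sg) as [H|H]; [apply Hbelow; lra|].
      apply Hzero. rewrite Rabs_pos_eq by lra.
      apply Rle_trans with (rho / Cmod d * Cmod d)%R; [apply Rmult_le_compat_r; lra|].
      apply Req_le. field. lra. }
    assert (H := Hub _ HS1). lra.
  - assert (HZ : Z 1%R).
    { apply Hzero. replace (1 - sg)%R with 0%R by lra. rewrite Rabs_R0. lra. }
    unfold Z in HZ. replace (w + RtoC 1 * d) with (w + d) in HZ by ring.
    replace (F (w + d)) with ((F (w + d) - G (w + d)) + G (w + d)) by ring.
    rewrite HZ. ring.
Qed.

Lemma Cinv_product (x y : C) : / (x * y) = / x * / y.
Proof.
  assert (H0 : / (RtoC 0) = 0).
  { unfold Cinv. simpl. unfold Rdiv. apply injective_projections; simpl; ring. }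
  destruct (Ceq_dec x 0) as [->|Hx]; [rewrite Cmult_0_l, H0; ring|].
  destruct (Ceq_dec y 0) as [->|Hy]; [rewrite Cmult_0_r, H0; ring|].
  field. auto.
Qed.

Section Continuation.
Context {q : C} (hq : (0 < Cmod q < 1)%R).
Local Notation P := (qpoch q).
Local Notation Pi := (qpoch_inf q).
Local Notation r := (Cmod q).

Lemma linear_inv_local_ps (z0 x : C) :
  1 - z0 * x <> 0 -> local_power_series (fun w => / (1 - (z0 + w) * x)).
Proof.
  intros H. set (s := x / (1 - z0 * x)). assert (Hs := Cmod_ge_0 s).
  set (rho := (/ (2 * (Cmod s + 1)))%R).
  assert (Hrho : (0 < rho)%R) by (apply Rinv_0_lt_compat; lra).
  assert (Hsr : (Cmod s * rho <= / 2)%R).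
  { unfold rho. apply Rmult_le_reg_r with (2 * (Cmod s + 1))%R; [lra|].
    rewrite Rmult_assoc, Rinv_l by lra. lra. }
  exists rho, (Cmod (/ (1 - z0 * x)) * / (1 - / 2))%R. split; [exact Hrho|].
  apply has_ps_ext with (fun w => / (1 - z0 * x) * / (1 - s * w)).
  - intros w Hw.
    assert (Hn : 1 - s * w <> 0).
    { intros E. assert (E' : s * w = 1) by (replace (s * w) with (1 - (1 - s * w)) by ring; rewrite E; ring).
      assert (E2 : (Cmod (s * w) = 1)%R) by (rewrite E'; apply Cmod_1).
      rewrite Cmod_mult in E2.
      assert (Cmod s * Cmod w <= Cmod s * rho)%R by (apply Rmult_le_compat_l; assumption). lra. }
    unfold s in *.
    assert (E : 1 - (z0 + w) * x = (1 - z0 * x) * (1 - x / (1 - z0 * x) * w)) by (field; exact H).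
    rewrite E. field. split; [exact H|]. intros E2. apply Hn.
    replace (1 - x / (1 - z0 * x) * w) with ((1 - z0 * x - x * w) / (1 - z0 * x)) by (field; exact H).
    rewrite E2. field. exact H.
  - apply has_ps_scal. exists (fun k => s ^ k). split.
    + intros n. apply Rle_trans with (rsum (fun k => (/ 2) ^ k)%R n).
      * apply rsum_le. intros k _. rewrite Cmod_pow, <- Rpow_mult_distr.
        apply rpow_le. split; [nonneg|exact Hsr].
      * apply geometric_le. lra.
    + intros w Hw.
      assert (Hsw : (Cmod (s * w) < 1)%R).
      { rewrite Cmod_mult. assert (Cmod s * Cmod w <= Cmod s * rho)%R by (apply Rmult_le_compat_l; assumption). lra. }
      assert (Hb : abs_le (fun k => s ^ k * w ^ k) (/ (1 - Cmod (s * w)))).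
      { apply abs_le_dom with (fun k => Cmod (s * w) ^ k)%R.
        - intros k. rewrite <- Cpow_mult_l, Cmod_pow. lra.
        - intros n. apply geometric_le. split; [apply Cmod_ge_0|exact Hsw]. }
      assert (Hser := abs_le_is_series _ _ Hb).
      assert (Hsh := is_Cseries_unshift _ _ 1 Hser). simpl in Hsh.
      assert (H2 := is_Cseries_scal (s * w) _ _ Hser).
      assert (E2 : Cseries (fun k => s ^ k * w ^ k) - (0 + 1 * 1) = s * w * Cseries (fun k => s ^ k * w ^ k)).
      { apply (is_Cseries_unique _ _ _ Hsh). revert H2. apply is_Cseries_ext. intros k. ring. }
      assert (Hn : 1 - s * w <> 0).
      { intros E3. assert (E' : s * w = 1) by (replace (s * w) with (1 - (1 - s * w)) by ring; rewrite E3; ring).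
        rewrite E', Cmod_1 in Hsw. lra. }
      replace (/ (1 - s * w)) with (Cseries (fun k => s ^ k * w ^ k)); [exact Hser|].
      set (X := Cseries (fun k => s ^ k * w ^ k)) in *.
      assert (E4 : X * (1 - s * w) = 1).
      { replace (X * (1 - s * w)) with (X - s * w * X) by ring. rewrite <- E2. ring. }
      transitivity (X * (1 - s * w) * / (1 - s * w)); [field; exact Hn|].
      rewrite E4. ring.
Qed.

Lemma qpoch_inv_local_ps (z0 : C) (N : nat) :
  qregular q z0 -> local_power_series (fun w => / P (z0 + w) N).
Proof.
  intros H. induction N as [|N IH].
  - exists 1%R, (Cmod 1). split; [lra|].
    apply has_ps_ext with (fun _ => 1); [intros; simpl; field|apply has_ps_const].
  - apply local_ps_ext with (fun w => / P (z0 + w) N * / (1 - (z0 + w) * q ^ N)).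
    + intros w. rewrite qpoch_S, Cinv_product. reflexivity.
    + apply local_ps_mult; [exact IH|]. apply linear_inv_local_ps.
      intros E. apply (H N). replace (z0 * q ^ N) with (1 - (1 - z0 * q ^ N)) by ring.
      rewrite E. ring.
Qed.

(** Finitely many factors of [(z;q)_oo] are inverted by geometric series; if [N]
    of them are split off, the q-binomial theorem expands the inverse of the rest
    on a disc about [0] that contains a neighbourhood of [z0]. *)
Lemma qpoch_inf_inv_local_ps (z0 : C) :
  qregular q z0 -> local_power_series (fun w => / Pi (z0 + w)).
Proof.
  intros H. assert (Hz0 := Cmod_ge_0 z0).
  destruct (pow_lt_1_zero r) with (y := (/ (Cmod z0 + 2))%R) as [N HN].
  { rewrite Rabs_pos_eq; lra. }
  { apply Rinv_0_lt_compat. lra. }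
  specialize (HN N (Nat.le_refl _)). rewrite Rabs_pos_eq in HN by nonneg.
  assert (Hlt : (r ^ N * (Cmod z0 + 1) < 1)%R).
  { apply Rle_lt_trans with (/ (Cmod z0 + 2) * (Cmod z0 + 1))%R.
    - apply Rmult_le_compat_r; lra.
    - apply Rmult_lt_reg_r with (Cmod z0 + 2)%R; [lra|].
      replace (/ (Cmod z0 + 2) * (Cmod z0 + 1) * (Cmod z0 + 2))%R with (Cmod z0 + 1)%R by (field; lra).
      lra. }
  assert (HrN := rpow_nonneg r N ltac:(lra)).
  apply local_ps_ext with (fun w => / P (z0 + w) N * / Pi ((z0 + w) * q ^ N)).
  { intros w. rewrite (qpoch_inf_split hq (z0 + w) N), Cinv_product. reflexivity. }
  apply local_ps_mult; [apply qpoch_inv_local_ps, H|].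
  destruct (qpoch_inv_bounded hq q (q_regular hq)) as [M [HM HMk]].
  set (M' := (M * / (1 - r ^ N * (Cmod z0 + 1)))%R).
  exists 1%R, M'. split; [lra|].
  apply (has_ps_recenter (Cmod z0 + 1) 1 M' (fun z => / Pi (z * q ^ N))); [lra|lra|].
  exists (fun k => (q ^ N) ^ k / P q k). split.
  - intros n. apply Rle_trans with (rsum (fun k => M * (r ^ N * (Cmod z0 + 1)) ^ k)%R n).
    + apply rsum_le. intros k _. unfold Cdiv. rewrite Cmod_mult, !Cmod_pow, Rpow_mult_distr.
      replace ((r ^ N) ^ k * Cmod (/ P q k) * (Cmod z0 + 1) ^ k)%R
        with (Cmod (/ P q k) * ((r ^ N) ^ k * (Cmod z0 + 1) ^ k))%R by ring.
      apply Rmult_le_compat_r; [|apply HMk].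
      nonneg.
    + rewrite rsum_scal. apply Rmult_le_compat_l; [lra|]. apply geometric_le.
      split; [nonneg|exact Hlt].
  - intros z Hz. assert (Hs : (Cmod (z * q ^ N * 1) < 1)%R).
    { rewrite Cmult_1_r, Cmod_mult, Cmod_pow, Rmult_comm.
      apply Rle_lt_trans with (2 := Hlt). apply Rmult_le_compat_l; assumption. }
    assert (Hb := qbinomial_at hq 1 0 _ Hs).
    rewrite Cmult_0_r, (qpoch_inf_0 hq), Cmult_1_r in Hb.
    replace (1 / Pi (z * q ^ N)) with (/ Pi (z * q ^ N)) in Hb.
    2:{ unfold Cdiv. ring. }
    revert Hb. apply is_Cseries_ext. intros k.
    rewrite (qshift_1 0), Cpow_mult_l. assert (Hq := qpoch_q_neq0 hq k).
    replace (P 0 k) with (RtoC 1); [field; exact Hq|].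
    clear. induction k as [|k IH]; simpl; [reflexivity|rewrite <- IH; ring].
Qed.

Lemma jackson_local_ps (A B D z0 : C) :
  qregular q D -> local_power_series (fun w => jackson q A B D (z0 + w)).
Proof.
  intros HD. destruct (jackson_entire hq A B D HD) as (s & e & Hs1 & He & Hs).
  assert (Hz0 := Cmod_ge_0 z0).
  destruct (gauss_decay_bounded hq s e (Cmod z0 + 1) ltac:(lra) ltac:(lra) He) as [M HM].
  exists 1%R, M. split; [lra|].
  apply (has_ps_recenter (Cmod z0 + 1) 1 M (fun z => jackson q A B D z)); [lra|lra|].
  exists e. split; [exact HM|]. intros z _. apply Hs.
Qed.

Lemma jackson_ratio_analytic (A B D z0 : C) :
  qregular q D -> qregular q z0 -> analytic_at (fun z => jackson q A B D z / Pi z) z0.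
Proof.
  intros HD Hz. apply local_ps_analytic. unfold Cdiv.
  apply local_ps_mult; [apply jackson_local_ps, HD|apply qpoch_inf_inv_local_ps, Hz].
Qed.

End Continuation.

Lemma qregular_inv (q z : C) : q <> 0 -> (forall j : nat, z <> / (q ^ j)) -> qregular q z.
Proof.
  intros Hq H j E. apply (H j). assert (Hj := Cpow_nz q j Hq).
  replace z with (z * q ^ j * / (q ^ j)) by (field; exact Hj). rewrite E. ring.
Qed.

Lemma qregular_inv' (q z : C) : q <> 0 -> qregular q z -> (forall j : nat, z <> / (q ^ j)).
Proof.
  intros Hq H j E. apply (H j). assert (Hj := Cpow_nz q j Hq). rewrite E. field. exact Hj.
Qed.

Lemma Cmod_q (q : R) : (0 < q < 1)%R -> (0 < Cmod q < 1)%R.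
Proof. intros H. rewrite Cmod_R, Rabs_pos_eq; lra. Qed.

(** The poles lie on the positive half-line, so every other point can be
    joined to the unit disc by a segment that avoids them: a radius, or for a
    real point a segment that starts off the real axis. *)
Lemma phi21_continuation_unique (q : R) (A B D : C) (F G : C -> C) (z : C) :
  (0 < q < 1)%R ->
  phi21_continuation q A B D F -> phi21_continuation q A B D G ->
  (forall j : nat, z <> / (RtoC q ^ j)) -> F z = G z.
Proof.
  intros Hq [F1 F2] [G1 G2] Hz.
  assert (Hdisc : forall z, (Cmod z < 1)%R -> F z = G z).
  { intros w Hw. apply (is_Cseries_unique _ _ _ (F1 w Hw) (G1 w Hw)). }
  assert (Him : forall w : C, Im w <> 0%R -> forall j : nat, w <> / (RtoC q ^ j)).
  { intros w Hw j E. apply Hw. rewrite E, <- RtoC_pow, <- RtoC_inv; [reflexivity|]. apply pow_nonzero. lra. }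
  assert (Hseg : forall w d : C, (Cmod w < 1)%R ->
     (forall s, (0 <= s <= 1)%R -> forall j : nat, w + RtoC s * d <> / (RtoC q ^ j)) ->
     F (w + d) = G (w + d)).
  { intros w d Hw H. apply analytic_segment; auto. }
  destruct (Req_dec (Im z) 0) as [E|E].
  - replace z with (Ci / 2 + (z - Ci / 2)) by ring. apply Hseg.
    + unfold Cdiv. rewrite Cmod_mult, Cmod_Ci, Cmod_inv, Cmod_R, Rabs_pos_eq; try lra.
      intros H. apply RtoC_inj in H. lra.
    + intros s Hs. destruct (Req_dec s 1) as [->|Hs1].
      * replace (Ci / 2 + RtoC 1 * (z - Ci / 2)) with z by ring. exact Hz.
      * apply Him. replace (Ci / 2 + RtoC s * (z - Ci / 2)) with
          (RtoC ((1 - s) / 2) * Ci + RtoC s * z).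
        2:{ rewrite RtoC_div, RtoC_minus by lra. field. }
        destruct z as [x y]. simpl in E |- *. subst y.
        intros H. apply Hs1. nra.
  - replace z with (0 + z) by ring. apply Hseg; [rewrite Cmod_0; lra|].
    intros s Hs. destruct (Req_dec s 0) as [->|Hs0].
    + intros j H. replace (0 + RtoC 0 * z) with (RtoC 0) in H by ring.
      rewrite <- RtoC_pow, <- RtoC_inv in H by (apply pow_nonzero; lra). apply RtoC_inj in H.
      assert (Hp := pow_lt q j ltac:(lra)). apply Rinv_0_lt_compat in Hp. lra.
    + apply Him. destruct z as [x y]. simpl in E |- *. intros H. apply E.
      assert (s * y = 0)%R by lra. apply Rmult_integral in H0. destruct H0; [lra|assumption].
Qed.

(** By [jackson_transformation] the quotient extends the series, its only
    singularities are the zeros of [(z;q)_oo], and continuations are unique. *)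
Lemma phi21_jackson (q : R) (A B D z : C) :
  (0 < q < 1)%R -> qregular q D -> qregular q z ->
  phi21 q A B D z = jackson q A B D z / qpoch_inf q z.
Proof.
  intros Hq HD Hz. assert (hq := Cmod_q q Hq).
  assert (Hq0 : RtoC q <> 0) by (apply (q_neq0 hq)).
  assert (HF : phi21_continuation q A B D (fun z => jackson q A B D z / qpoch_inf q z)).
  { split.
    - intros w Hw. apply (jackson_transformation hq); assumption.
    - intros w Hw. apply (jackson_ratio_analytic hq); [exact HD|].
      apply qregular_inv; assumption. }
  apply the_eq.
  - exists (fun z => jackson q A B D z / qpoch_inf q z). split; [exact HF|reflexivity].
  - intros y [G [HG <-]].
    apply (phi21_continuation_unique q A B D _ _ z Hq HG HF).
    apply qregular_inv'; assumption.
Qed.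

(** * Laurent coefficients of the first factor *)

Section Laurent.
Context {q : C} (hq : (0 < Cmod q < 1)%R).
Local Notation P := (qpoch q).
Local Notation Pi := (qpoch_inf q).
Local Notation r := (Cmod q).
Local Notation tri := (qtri q).
Local Notation shf := (qshift q).

Lemma qtri_square (n : nat) : (q ^ n) ^ n = tri n * tri (S n).
Proof.
  induction n as [|n IH]; [simpl; ring|].
  rewrite (qtri_S (S n)), (qtri_S n) at 1.
  replace (tri n * q ^ n * (tri (S n) * q ^ S n)) with ((tri n * tri (S n)) * (q ^ n * q ^ S n)) by ring.
  rewrite <- IH, <- !Cpow_mult_r, <- !Cpow_add_r. f_equal. ring.
Qed.

Lemma phi21_term_eq (A B D z : C) (k : nat) :
  phi21_term q A B D z k = P A k * P B k / (P q k * P D k) * z ^ k.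
Proof.
  unfold phi21_term, qpochs, Cprod. simpl map. simpl fold_right.
  replace (P B k * 1) with (P B k) by ring. replace (P D k * 1) with (P D k) by ring.
  reflexivity.
Qed.

Lemma qregular_q_pow (n : nat) : qregular q (q * q ^ n).
Proof. apply qregular_shift, (q_regular hq). Qed.

Definition laurent_const (A D z0 : C) : C := Pi A * Pi q / (Pi D * Pi z0).

(** At [z = z0 q^(-n)] the factors [((q/z0) q^k z;q)_oo] of Jackson's series
    vanish for [k < n], and a second application of Jackson's transformation
    turns the rest into a convolution: up to a constant, the coefficient of
    [s^n] in the Laurent series of [(D s, z0/s;q)_oo / (A s, 1/s;q)_oo]. *)
Lemma laurent_expansion_pos (A D z0 : C) (n : nat) :
  A <> 0 -> z0 <> 0 -> (Cmod A < 1)%R -> qregular q D ->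
  qregular q z0 -> qregular q (z0 / q ^ n) ->
  is_Cseries (fun m => laurent_const A D z0 *
                (shf A D (n + m) / P q (n + m) * (P z0 m / P q m)))
    (jackson q (q / z0) A D (z0 / q ^ n) / Pi (z0 / q ^ n)).
Proof.
  intros HA Hz0 HA1 HD Hz Hzn.
  assert (Hq := qpoch_q_neq0 hq). assert (HqS := fun n k => qpoch_neq0 _ k (qregular_q_pow n)).
  assert (Hqn := qpow_neq0 hq n).
  assert (HPA := qpoch_inf_neq0 hq A (small_qregular hq A HA1)).
  assert (HPz := qpoch_inf_neq0 hq z0 Hz).
  assert (HPzn := qpoch_inf_neq0 hq _ Hzn).
  assert (HPDn := fun k => qpoch_neq0 D k HD).
  assert (HJ := jackson_transformation hq (D * q ^ n / A) z0 (q * q ^ n) A (qregular_q_pow n) HA1).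
  apply (is_Cseries_scal (laurent_const A D z0 * (shf A D n / P q n))) in HJ.
  set (X := jackson q (D * q ^ n / A) z0 (q * q ^ n) A) in *.
  assert (E : jackson q (q / z0) A D (z0 / q ^ n) / Pi (z0 / q ^ n) =
     laurent_const A D z0 * (shf A D n / P q n) * (X / Pi A)).
  { assert (H1 := jackson_is_series hq (q / z0) A D (z0 / q ^ n) HD).
    apply (is_Cseries_unshift _ _ n) in H1.
    rewrite csum_zero in H1.
    2:{ intros k Hk. rewrite (qpoch_inf_zero hq _ (n - 1 - k)); [ring|].
        transitivity (q * q ^ k * q ^ (n - 1 - k) / q ^ n); [field; auto|].
        replace (q * q ^ k * q ^ (n - 1 - k)) with (q ^ n); [field; auto|].
        change (q * q ^ k) with (q ^ S k). rewrite <- Cpow_add_r. f_equal. lia. }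
    assert (H2 := jackson_is_series hq (D * q ^ n / A) z0 (q * q ^ n) A (qregular_q_pow n)).
    fold X in H2.
    apply (is_Cseries_scal (laurent_const A D z0 * (shf A D n / P q n) / Pi A * Pi (z0 / q ^ n))) in H2.
    assert (E1 : jackson q (q / z0) A D (z0 / q ^ n) - 0 =
      laurent_const A D z0 * (shf A D n / P q n) / Pi A * Pi (z0 / q ^ n) * X).
    { refine (is_Cseries_unique _ _ _ H1 _). revert H2. apply is_Cseries_ext. intros k.
      unfold jackson_coef.
      replace (D * q ^ n / A * q ^ k * A) with (D * q ^ (n + k)).
      2:{ rewrite Cpow_add_r. field. exact HA. }
      replace (q / z0 * q ^ (n + k) * (z0 / q ^ n)) with (q * q ^ k).
      2:{ rewrite Cpow_add_r. field. auto. }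
      assert (ED := qpoch_inf_split hq D (n + k)).
      assert (Eq := qpoch_inf_split hq q k).
      assert (Ez := qpoch_inf_split hq (z0 / q ^ n) n).
      replace (z0 / q ^ n * q ^ n) with z0 in Ez by (field; exact Hqn).
      assert (Er := qpoch_reverse hq z0 n Hz0). rewrite qtri_S in Er.
      assert (Htn := qtri_neq0 hq n).
      assert (Er2 : P (z0 / q ^ n) n = P (q / z0) n * (- z0) ^ n / (tri n * q ^ n)).
      { rewrite <- Er. field. auto. }
      unfold laurent_const. rewrite Ez, Er2, ED, Eq.
      rewrite (qpoch_add q n k), (qpoch_add (q / z0) n k), (qshift_add A D n k), (qtri_add n k).
      rewrite (qshift_qpoch A (D * q ^ n) k HA), (qshift_qpoch z0 (q * q ^ n) k Hz0).
      replace (q / z0 * q ^ n) with (q * q ^ n / z0) by (field; exact Hz0).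
      replace (- z0) with (- (1) * z0) by ring.
      replace (z0 / q ^ n) with (/ (q ^ n) * z0) by (field; exact Hqn).
      rewrite !Cpow_mult_l, (Cpow_add_r (- (1)) n k), (Cpow_add_r z0 n k), (Cpow_add_r (/ q ^ n) n k).
      rewrite !Cpow_inv by exact Hqn. rewrite qtri_square, qtri_S, <- Cpow_mult_r.
      assert (Hnk := qpow_neq0 hq (n * k)).
      assert (HPDnk : Pi (D * q ^ (n + k)) <> 0) by (apply (qpoch_inf_neq0 hq), qregular_shift, HD).
      field. repeat split; auto. }
    replace (jackson q (q / z0) A D (z0 / q ^ n)) with (jackson q (q / z0) A D (z0 / q ^ n) - 0) by ring.
    rewrite E1. field. auto. }
  rewrite E. revert HJ. apply is_Cseries_ext. intros m. rewrite phi21_term_eq.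
  rewrite qshift_add, (qpoch_add q n m), (qshift_qpoch A (D * q ^ n) m HA).
  field. auto.
Qed.

(** At [z = z0 q^p] none of the factors [((q/z0) q^k z;q)_oo] vanishes: they are
    [(q^(p + 1 + k);q)_oo], so Jackson's series is again, by Jackson's
    transformation, a 2phi1 with lower parameter [q^(p + 1)]. *)
Lemma laurent_expansion_neg (A D z0 : C) (p : nat) :
  A <> 0 -> z0 <> 0 -> (Cmod A < 1)%R -> qregular q D -> qregular q z0 ->
  is_Cseries (fun l => laurent_const A D z0 *
                (shf A D l / P q l * (P z0 (p + l) / P q (p + l))))
    (jackson q (q / z0) A D (z0 * q ^ p) / Pi (z0 * q ^ p)).
Proof.
  intros HA Hz0 HA1 HD Hz.
  assert (Hq := qpoch_q_neq0 hq). assert (HqS := fun n k => qpoch_neq0 _ k (qregular_q_pow n)).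
  assert (Hqp := qpow_neq0 hq p).
  assert (HPA := qpoch_inf_neq0 hq A (small_qregular hq A HA1)).
  assert (Hzp := qregular_shift z0 p Hz).
  assert (HPzp := qpoch_inf_neq0 hq _ Hzp).
  assert (HPDn := fun k => qpoch_neq0 D k HD).
  assert (Hzpn := qpoch_neq0 z0 p Hz).
  assert (HJ := jackson_transformation hq (D / A) (z0 * q ^ p) (q * q ^ p) A (qregular_q_pow p) HA1).
  apply (is_Cseries_scal (laurent_const A D z0 * (P z0 p / P q p))) in HJ.
  set (X := jackson q (D / A) (z0 * q ^ p) (q * q ^ p) A) in *.
  assert (E : jackson q (q / z0) A D (z0 * q ^ p) / Pi (z0 * q ^ p) =
     laurent_const A D z0 * (P z0 p / P q p) * (X / Pi A)).
  { assert (H1 := jackson_is_series hq (q / z0) A D (z0 * q ^ p) HD).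
    assert (H2 := jackson_is_series hq (D / A) (z0 * q ^ p) (q * q ^ p) A (qregular_q_pow p)).
    fold X in H2.
    apply (is_Cseries_scal (laurent_const A D z0 * (P z0 p / P q p) / Pi A * Pi (z0 * q ^ p))) in H2.
    assert (E1 : jackson q (q / z0) A D (z0 * q ^ p) =
      laurent_const A D z0 * (P z0 p / P q p) / Pi A * Pi (z0 * q ^ p) * X).
    { refine (is_Cseries_unique _ _ _ H1 _). revert H2. apply is_Cseries_ext. intros k.
      unfold jackson_coef.
      replace (D / A * q ^ k * A) with (D * q ^ k) by (field; exact HA).
      replace (q / z0 * q ^ k * (z0 * q ^ p)) with (q * q ^ (p + k)).
      2:{ rewrite Cpow_add_r. field. auto. }
      assert (ED := qpoch_inf_split hq D k).
      assert (Eq := qpoch_inf_split hq q (p + k)). rewrite qpoch_add in Eq.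
      assert (Ez := qpoch_inf_split hq z0 p).
      unfold laurent_const. rewrite Ez, ED, Eq.
      assert (Hzq : z0 * q ^ p <> 0) by (apply Cmult_neq_0; assumption).
      rewrite (qshift_qpoch A D k HA), (qshift_qpoch (z0 * q ^ p) (q * q ^ p) k Hzq).
      replace (q * q ^ p / (z0 * q ^ p)) with (q / z0) by (field; auto).
      assert (HPDk : Pi (D * q ^ k) <> 0) by (apply (qpoch_inf_neq0 hq), qregular_shift, HD).
      field. repeat split; auto. }
    rewrite E1. field. auto. }
  rewrite E. revert HJ. apply is_Cseries_ext. intros m. rewrite phi21_term_eq.
  rewrite (qpoch_add q p m), (qpoch_add z0 p m), (qshift_qpoch A D m HA).
  field. auto.
Qed.

End Laurent.
Arguments laurent_const q A D z0 : clear implicits.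

(** * The sums of Saalschuetz and Rogers and the transformation of Watson *)

Section Watson.
Context {q : C} (hq : (0 < Cmod q < 1)%R).
Local Notation P := (qpoch q).
Local Notation tri := (qtri q).
Local Notation shf := (qshift q).

Lemma regular_factor (x : C) (n : nat) : qregular q x -> 1 - x * q ^ n <> 0.
Proof.
  intros H E. apply (H n). replace (x * q ^ n) with (1 - (1 - x * q ^ n)) by ring.
  rewrite E. ring.
Qed.

Definition saalschutz_term (alpha s beta tau : C) (k i : nat) : C :=
  (- (1)) ^ i * tri i * q ^ i / q ^ (k * i) * P (alpha * q ^ k) i * P tau i /
  (P q i * P q (k - i) * P s i * P (beta * tau) i).

(** A recurrence in [k] for the sum of all terms, refined to partial sums: the
    last term on the right is what telescopes, and it follows by induction on
    the number of terms. *)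
Lemma saalschutz_partial_sum (alpha s beta tau : C) (i m : nat) :
  alpha * q = s * beta -> qregular q s -> qregular q (beta * tau) ->
  let k := (i + m)%nat in
  (1 - q ^ S k) * (1 - s * q ^ k) * (1 - beta * tau * q ^ k) *
    csum (saalschutz_term alpha s beta tau (S k)) (S i) =
  (1 - beta * q ^ k) * (tau - s * q ^ k) * csum (saalschutz_term alpha s beta tau k) (S i) +
  (- (1)) ^ i * tri i / q ^ (k * i) * P (alpha * q ^ S k) i * P tau (S i) /
    (P q i * P q m * P s i * P (beta * tau) i) * (1 - alpha * q * q ^ (2 * k)).
Proof.
  intros Hal Hs Hbt. revert m. induction i as [|i IH]; intros m k.
  - assert (Hq := qpoch_q_neq0 hq). assert (Hq1 := one_minus_qpow_neq0 hq).
    unfold k, saalschutz_term. cbn [csum]. replace (2 * (0 + m))%nat with (m + m)%nat by lia.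
    rewrite !Nat.mul_0_r, Nat.add_0_l, !Nat.sub_0_r, Cpow_add_r, Hal, qpoch_S.
    change (q * q ^ m) with (q ^ S m). simpl Cpow. simpl qtri. rewrite qpoch_S. simpl (P _ 0). simpl Cpow.
    specialize (Hq m). specialize (Hq1 m). field. auto.
  - replace k with (i + S m)%nat by (unfold k; lia).
    specialize (IH (S m)). cbv zeta in IH.
    set (K := (i + S m)%nat) in *.
    set (sa := saalschutz_term alpha s beta tau) in *.
    change (csum (sa (S K)) (S (S i))) with (csum (sa (S K)) (S i) + sa (S K) (S i)).
    change (csum (sa K) (S (S i))) with (csum (sa K) (S i) + sa K (S i)).
    rewrite Cmult_plus_distr_l, IH.
    match goal with |- ?a + ?b + ?c = _ =>
      assert (E : b + c = (1 - beta * q ^ K) * (tau - s * q ^ K) * sa K (S i) +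
        (- (1)) ^ S i * tri (S i) / q ^ (K * S i) * P (alpha * q ^ S K) (S i) * P tau (S (S i)) /
    (P q (S i) * P q m * P s (S i) * P (beta * tau) (S i)) * (1 - alpha * q * q ^ (2 * K))) end.
    2:{ match goal with |- ?a + ?b + ?c = _ => replace (a + b + c) with (a + (b + c)) by ring end.
        rewrite E. ring. }
    unfold sa, saalschutz_term.
    replace (K - S i)%nat with m by (unfold K; lia).
    replace (S K - S i)%nat with (S m) by (unfold K; lia).
    rewrite (qpoch_S_l (alpha * q ^ K) i).
    replace (alpha * q ^ K * q) with (alpha * q ^ S K) by (simpl; ring).
    rewrite (qpoch_S (alpha * q ^ S K) i), (qpoch_S tau (S i)), (qpoch_S tau i), (qpoch_S q m), (qpoch_S q i),
      (qpoch_S s i), (qpoch_S (beta * tau) i), qtri_S.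
    replace (S K * S i)%nat with (K * i + K + S i)%nat by ring.
    replace (K * S i)%nat with (K * i + K)%nat by ring.
    replace (2 * K)%nat with (K + K)%nat by ring.
    rewrite !Cpow_add_r. change (q * q ^ m) with (q ^ S m). change (q * q ^ i) with (q ^ S i).
    assert (Hqm := qpoch_q_neq0 hq m). assert (Hqm1 := one_minus_qpow_neq0 hq m).
    assert (Hqi := qpoch_q_neq0 hq i). assert (Hqi1 := one_minus_qpow_neq0 hq i).
    assert (HqSi := qpow_neq0 hq (S i)).
    assert (HqKi := qpow_neq0 hq (K * i)).
    assert (Hsi := qpoch_neq0 s i Hs). assert (Hsi1 := regular_factor s i Hs).
    assert (Hbi := qpoch_neq0 _ i Hbt). assert (Hbi1 := regular_factor _ i Hbt).
    assert (EqK : q ^ K = q ^ i * q ^ m * q).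
    { unfold K. rewrite Nat.add_succ_r. simpl. rewrite Cpow_add_r. ring. }
    change (q ^ S K) with (q * q ^ K). change (q ^ S i) with (q * q ^ i) in *.
    change (q ^ S m) with (q * q ^ m) in *. change ((- (1)) ^ S i) with (- (1) * (- (1)) ^ i).
    assert (Hqq := q_neq0 hq). assert (Hqi0 := qpow_neq0 hq i). assert (Hqm0 := qpow_neq0 hq m).
    replace alpha with (s * beta / q) by (rewrite <- Hal; field; exact Hqq).
    set (PA := P (s * beta / q * (q * q ^ K)) i). clearbody PA.
    rewrite EqK in *. clear EqK IH. clearbody K sa.
    generalize dependent (q ^ (K * i)). intros qKi ? .
    generalize dependent (q ^ i). intros qi. intros. generalize dependent (q ^ m). intros qm. intros.
    field. repeat split; auto.
Qed.

(** For [m = 0] the partial sums in [saalschutz_partial_sum] lack only the last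
    term of the sum for [k + 1], which leaves a first-order recurrence. *)
Lemma q_saalschutz (alpha s beta tau : C) (k : nat) :
  alpha * q = s * beta -> qregular q s -> qregular q (beta * tau) ->
  csum (saalschutz_term alpha s beta tau k) (S k) =
  P beta k * shf tau s k / (P q k * P s k * P (beta * tau) k).
Proof.
  intros Hal Hs Hbt. induction k as [|k IH].
  { unfold saalschutz_term. simpl. field. }
  assert (H := saalschutz_partial_sum alpha s beta tau k 0 Hal Hs Hbt). cbv zeta in H.
  rewrite Nat.add_0_r in H. rewrite IH in H. clear IH.
  change (csum (saalschutz_term alpha s beta tau (S k)) (S (S k))) with
    (csum (saalschutz_term alpha s beta tau (S k)) (S k) + saalschutz_term alpha s beta tau (S k) (S k)).
  assert (Hq1 := one_minus_qpow_neq0 hq k). assert (Hqk := qpoch_q_neq0 hq k).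
  assert (Hs1 := regular_factor s k Hs). assert (Hsk := qpoch_neq0 s k Hs).
  assert (Hb1 := regular_factor _ k Hbt). assert (Hbk := qpoch_neq0 _ k Hbt).
  assert (H0 := qpow_neq0 hq (k * k)). assert (H1 := qpow_neq0 hq k). assert (H2 := q_neq0 hq).
  set (X := csum (saalschutz_term alpha s beta tau (S k)) (S k)) in *.
  assert (EX : X = ((1 - q ^ S k) * (1 - s * q ^ k) * (1 - beta * tau * q ^ k) * X) /
     ((1 - q ^ S k) * (1 - s * q ^ k) * (1 - beta * tau * q ^ k))) by (field; auto).
  rewrite EX, H. clear EX H. clearbody X.
  unfold saalschutz_term. rewrite Nat.sub_diag.
  rewrite !qpoch_S, qtri_S, qshift_S. change (q * q ^ k) with (q ^ S k).
  replace (S k * S k)%nat with (k * k + k + S k)%nat by ring.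
  replace (2 * k)%nat with (k + k)%nat by ring.
  rewrite !Cpow_add_r. change (P q 0) with (RtoC 1).
  change ((- (1)) ^ S k) with (- (1) * (- (1)) ^ k).
  change (q ^ S k) with (q * q ^ k) in *. field. repeat split; auto.
Qed.

(** The summand of a terminating very-well-poised 6phi5, multiplied by the
    denominators [(x;q)_n (w;q)_n], so that these are allowed to vanish. *)
Definition vwp65_term (alpha x w : C) (n k : nat) : C :=
  (1 - alpha * q ^ (2 * k)) / (1 - alpha) * P alpha k * ((- (1)) ^ k * tri k) /
  (P q k * P q (n - k) * P (alpha * q) (n + k)) *
  (shf x (alpha * q) k * shf w (alpha * q) k / (alpha * q) ^ k) *
  (P (x * q ^ k) (n - k) * P (w * q ^ k) (n - k)).

(** As for the Saalschuetz sum, a first-order recurrence in [n] with a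
    telescoping remainder. *)
Lemma vwp65_partial_sum (alpha x w : C) (k m : nat) :
  alpha <> 0 -> alpha <> 1 -> qregular q (alpha * q) ->
  let n := (k + m)%nat in
  (1 - q ^ S n) * csum (vwp65_term alpha x w (S n)) (S k) =
  (1 - x * w * q ^ n / (alpha * q)) * csum (vwp65_term alpha x w n) (S k) -
  q ^ m * (P alpha (S k) / (1 - alpha) * ((- (1)) ^ S k * tri (S k)) /
    (P q k * P q m * P (alpha * q) (S n + k)) *
    (shf x (alpha * q) (S k) * shf w (alpha * q) (S k) / (alpha * q) ^ S k) *
    (P (x * q ^ k) m * P (w * q ^ k) m)).
Proof.
  intros Hal0 Hal1 Hal.
  assert (Ha1 : 1 - alpha <> 0).
  { intros E. apply Hal1. replace alpha with (1 - (1 - alpha)) by ring. rewrite E. ring. }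
  assert (Hqq := q_neq0 hq).
  revert m. induction k as [|k IH]; intros m n.
  - unfold n, vwp65_term. cbn [csum]. rewrite Nat.add_0_l, !Nat.sub_0_r, !Nat.add_0_r.
    rewrite !qpoch_S, !qshift_S. change (P _ 0) with (RtoC 1). simpl qshift. simpl qtri. simpl (2 * 0)%nat.
    simpl (q ^ 0). simpl ((- (1)) ^ 1). simpl ((- (1)) ^ 0). simpl ((alpha * q) ^ 0). simpl ((alpha * q) ^ 1).
    change (q * q ^ m) with (q ^ S m).
    replace (x * 1) with x by ring. replace (w * 1) with w by ring.
    change (P alpha 0) with (RtoC 1). change (P q 0) with (RtoC 1).
    assert (Hqm := qpoch_q_neq0 hq m). assert (Hqm1 := one_minus_qpow_neq0 hq m).
    assert (Ham := qpoch_neq0 _ m Hal). assert (Ham1 := regular_factor _ m Hal).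
    change (q ^ S m) with (q * q ^ m) in *.
    generalize dependent (q ^ m). intros qm. intros.
    field. repeat split; auto.
  - replace n with (k + S m)%nat by (unfold n; lia).
    specialize (IH (S m)). cbv zeta in IH.
    set (N := (k + S m)%nat) in *.
    set (sa := vwp65_term alpha x w) in *.
    change (csum (sa (S N)) (S (S k))) with (csum (sa (S N)) (S k) + sa (S N) (S k)).
    change (csum (sa N) (S (S k))) with (csum (sa N) (S k) + sa N (S k)).
    rewrite Cmult_plus_distr_l, IH.
    match goal with |- ?a - ?b + ?c = ?d * (?e + ?f) - ?g =>
      assert (E : c - b = d * f - g) end.
    2:{ match goal with |- ?a - ?b + ?c = _ => replace (a - b + c) with (a + (c - b)) by ring end.
        rewrite E. ring. }
    unfold sa, vwp65_term.
    replace (N - S k)%nat with m by (unfold N; lia).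
    replace (S N - S k)%nat with (S m) by (unfold N; lia).
    replace (S N + S k)%nat with (S (N + S k)) by lia.
    replace (S N + k)%nat with (N + S k)%nat by lia.
    rewrite (qpoch_S_l (x * q ^ k) m), (qpoch_S_l (w * q ^ k) m).
    replace (x * q ^ k * q) with (x * q ^ S k) by (simpl; ring).
    replace (w * q ^ k * q) with (w * q ^ S k) by (simpl; ring).
    rewrite (qpoch_S (x * q ^ S k) m), (qpoch_S (w * q ^ S k) m), (qpoch_S q k), (qpoch_S q m).
    rewrite (qshift_S x (alpha * q) (S k)), (qshift_S w (alpha * q) (S k)).
    rewrite (qpoch_S alpha (S k)), (qpoch_S (alpha * q) (N + S k)), (qtri_S (S k)).
    replace (2 * S k)%nat with (S k + S k)%nat by ring.
    assert (Hqm := qpoch_q_neq0 hq m). assert (Hqm1 := one_minus_qpow_neq0 hq m).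
    assert (Hqi := qpoch_q_neq0 hq k). assert (Hqi1 := one_minus_qpow_neq0 hq k).
    assert (HaN := qpoch_neq0 _ (N + S k) Hal). assert (HaN1 := regular_factor _ (N + S k) Hal).
    assert (Hak : (alpha * q) ^ S k <> 0) by (apply Cpow_nz, Cmult_neq_0; assumption).
    assert (EN : q ^ (N + S k) = q ^ S k * q ^ S k * q ^ m).
    { unfold N. rewrite <- !Cpow_add_r. f_equal. lia. }
    assert (EN2 : q ^ N = q ^ S k * q ^ m).
    { unfold N. rewrite <- !Cpow_add_r. f_equal. lia. }
    assert (EN3 : q ^ S N = q * q ^ S k * q ^ m).
    { change (q ^ S N) with (q * q ^ N). rewrite EN2. ring. }
    change ((- (1)) ^ S (S k)) with (- (1) * (- (1)) ^ S k).
    change ((alpha * q) ^ S (S k)) with (alpha * q * (alpha * q) ^ S k).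
    rewrite (Cpow_add_r q (S k) (S k)).
    rewrite EN3, EN2, EN in *. clear EN EN2 EN3 IH. clearbody sa.
    set (PN := P (alpha * q) (N + S k)) in *. clearbody PN N.
    set (A1 := P alpha (S k)). set (X1 := shf x (alpha * q) (S k)). set (W1 := shf w (alpha * q) (S k)).
    set (T1 := tri (S k)). set (S1 := (- (1)) ^ S k). set (Z1 := (alpha * q) ^ S k) in *.
    change (q ^ S m) with (q * q ^ m) in *. change (q ^ S k) with (q * q ^ k) in *.
    set (PX := P (x * (q * q ^ k)) m). set (PW := P (w * (q * q ^ k)) m).
    clearbody A1 X1 W1 T1 S1 Z1 PX PW.
    generalize dependent (P q k). intros pk. intros. generalize dependent (P q m). intros pm. intros.
    generalize dependent (q ^ k). intros qk. intros. generalize dependent (q ^ m). intros qm. intros.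
    field. repeat split; auto.
Qed.

Lemma vwp65_sum (alpha x w : C) (n : nat) :
  alpha <> 0 -> alpha <> 1 -> qregular q (alpha * q) ->
  csum (vwp65_term alpha x w n) (S n) = P (x * w / (alpha * q)) n / P q n.
Proof.
  intros Hal0 Hal1 Hal.
  assert (Ha1 : 1 - alpha <> 0).
  { intros E. apply Hal1. replace alpha with (1 - (1 - alpha)) by ring. rewrite E. ring. }
  assert (Hqq := q_neq0 hq).
  induction n as [|n IH].
  { unfold vwp65_term. simpl. field. auto. }
  assert (H := vwp65_partial_sum alpha x w n 0 Hal0 Hal1 Hal). cbv zeta in H.
  rewrite Nat.add_0_r in H. rewrite IH in H. clear IH.
  change (csum (vwp65_term alpha x w (S n)) (S (S n))) with
    (csum (vwp65_term alpha x w (S n)) (S n) + vwp65_term alpha x w (S n) (S n)).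
  assert (Hq1 := one_minus_qpow_neq0 hq n). assert (Hqn := qpoch_q_neq0 hq n).
  set (X := csum (vwp65_term alpha x w (S n)) (S n)) in *.
  assert (EX : X = ((1 - q ^ S n) * X) / (1 - q ^ S n)) by (field; auto).
  rewrite EX, H. clear EX H. clearbody X.
  unfold vwp65_term. rewrite Nat.sub_diag.
  replace (S n + S n)%nat with (S (S n + n)) by lia.
  rewrite (qpoch_S (alpha * q) (S n + n)), (qpoch_S q n), (qpoch_S (x * w / (alpha * q)) n).
  assert (HaN := qpoch_neq0 _ (S n + n) Hal). assert (HaN1 := regular_factor _ (S n + n) Hal).
  assert (Hak : (alpha * q) ^ S n <> 0) by (apply Cpow_nz, Cmult_neq_0; assumption).
  change (q * q ^ n) with (q ^ S n).
  replace (2 * S n)%nat with (S (S n + n)) by lia. change (q ^ S (S n + n)) with (q * q ^ (S n + n)).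
  change (P _ 0) with (RtoC 1). change (P q 0) with (RtoC 1). change (q ^ 0) with (RtoC 1).
  generalize dependent (q ^ (S n + n)). intros.
  generalize dependent (P (alpha * q) (S n + n)). intros.
  change (P (x * q ^ n) 0) with (RtoC 1). change (P (w * q ^ n) 0) with (RtoC 1).
  change (P (x * q ^ S n) 0) with (RtoC 1). change (P (w * q ^ S n) 0) with (RtoC 1).
  field. repeat split; auto.
Qed.

Lemma csum_triangle (f : nat -> nat -> C) (n : nat) :
  csum (fun k => csum (fun i => f i (k - i)%nat) (S k)) n =
  csum (fun i => csum (f i) (n - i)) n.
Proof.
  induction n as [|n IH]; [reflexivity|].
  change (csum (fun k => csum (fun i => f i (k - i)%nat) (S k)) n
      + (csum (fun i => f i (n - i)%nat) n + f n (n - n)%nat) =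
    csum (fun i => csum (f i) (S n - i)) n + csum (f n) (S n - n)).
  rewrite IH.
  rewrite (csum_ext (fun i => csum (f i) (S n - i)) (fun i => csum (f i) (n - i) + f i (n - i)%nat)).
  - rewrite csum_plus. rewrite Nat.sub_diag. replace (S n - n)%nat with 1%nat by lia. simpl. ring.
  - intros i Hi. replace (S n - i)%nat with (S (n - i)) by lia. reflexivity.
Qed.

(** Watson's transformation of a terminating very-well-poised 8phi7 into a
    balanced 4phi3: the Saalschuetz sum expands one quotient, after which the
    inner sums are 6phi5's with [alpha q^(2 i)] in place of [alpha]. *)
Lemma watson (alpha s beta tau x w : C) (j : nat) :
  alpha <> 0 -> alpha <> 1 -> qregular q (alpha * q) -> alpha * q = s * beta ->
  qregular q s -> qregular q (beta * tau) ->
  csum (fun k => vwp65_term alpha x w j k * (P beta k * shf tau s k / (P s k * P (beta * tau) k))) (S j) =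
  csum (fun i => shf x (alpha * q) i * shf w (alpha * q) i / (alpha * q) ^ i / (P q i * P s i) *
    (P tau i / P (beta * tau) i) * (P (x * w / (alpha * q)) (j - i) / P q (j - i))) (S j).
Proof.
  intros Hal0 Hal1 Hal Hsb Hs Hbt.
  assert (Hqq := q_neq0 hq). assert (Hq := qpoch_q_neq0 hq).
  assert (Hsn := fun n => qpoch_neq0 s n Hs). assert (Hbn := fun n => qpoch_neq0 _ n Hbt).
  assert (Han := fun n => qpoch_neq0 _ n Hal).
  assert (Ha1 : 1 - alpha <> 0).
  { intros E. apply Hal1. replace alpha with (1 - (1 - alpha)) by ring. rewrite E. ring. }
  set (f := fun i p => vwp65_term alpha x w j (i + p) * P q (i + p) * saalschutz_term alpha s beta tau (i + p) i).
  transitivity (csum (fun k => csum (fun i => f i (k - i)%nat) (S k)) (S j)).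
  { apply csum_ext. intros k _.
    rewrite (csum_ext _ (fun i => vwp65_term alpha x w j k * P q k * saalschutz_term alpha s beta tau k i)).
    - rewrite csum_scal, (q_saalschutz alpha s beta tau k Hsb Hs Hbt).
         field. auto.
    - intros i Hi. unfold f. replace (i + (k - i))%nat with k by lia. reflexivity. }
  rewrite csum_triangle. apply csum_ext. intros i Hi.
  replace (S j - i)%nat with (S (j - i)) by lia.
  set (n := (j - i)%nat). assert (Hj : j = (i + n)%nat) by (unfold n; lia).
  clearbody n. subst j.
  assert (Hqi := qpow_neq0 hq i).
  assert (Hqi2 : q ^ (2 * i) <> 0) by apply (qpow_neq0 hq).
  assert (Hal0' : alpha * q ^ (2 * i) <> 0) by (apply Cmult_neq_0; assumption).
  assert (Hal' : qregular q (alpha * q ^ (2 * i) * q)).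
  { replace (alpha * q ^ (2 * i) * q) with (alpha * q * q ^ (2 * i)) by ring.
    apply qregular_shift, Hal. }
  assert (Hal1' : alpha * q ^ (2 * i) <> 1).
  { destruct i as [|i']; [simpl; rewrite Cmult_1_r; exact Hal1|].
    intros E. apply (Hal (S (2 * i'))). rewrite <- E.
    replace (2 * S i')%nat with (S (S (2 * i'))) by lia. simpl. ring. }
  assert (H := vwp65_sum (alpha * q ^ (2 * i)) (x * q ^ i) (w * q ^ i) n Hal0' Hal1' Hal').
  replace (x * q ^ i * (w * q ^ i) / (alpha * q ^ (2 * i) * q)) with (x * w / (alpha * q)) in H.
  2:{ replace (2 * i)%nat with (i + i)%nat by lia. rewrite Cpow_add_r. field. auto. }
  replace (P (x * w / (alpha * q)) n / P q n) with (csum (vwp65_term (alpha * q ^ (2 * i)) (x * q ^ i) (w * q ^ i) n) (S n)).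
  rewrite <- csum_scal. apply csum_ext. intros p Hp.
  unfold f, vwp65_term, saalschutz_term.
  replace (i + n - (i + p))%nat with (n - p)%nat by lia.
  replace (i + p - i)%nat with p by lia.
  replace (i + n + (i + p))%nat with (2 * i + (n + p))%nat by lia.
  assert (EPa : P alpha (i + p) * P (alpha * q ^ (i + p)) i = P alpha (2 * i) * P (alpha * q ^ (2 * i)) p).
  { rewrite <- !qpoch_add. f_equal. lia. }
  assert (EPa2 : P alpha (2 * i) * (1 - alpha * q ^ (2 * i)) = (1 - alpha) * P (alpha * q) (2 * i)).
  { rewrite <- qpoch_S_l. reflexivity. }
  assert (E1 : 1 - alpha * q ^ (2 * i) <> 0).
  { intros E. apply Hal1'. replace (alpha * q ^ (2 * i)) with (1 - (1 - alpha * q ^ (2 * i))) by ring.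
    rewrite E. ring. }
  assert (EPa3 : P alpha (2 * i) = (1 - alpha) * P (alpha * q) (2 * i) / (1 - alpha * q ^ (2 * i))).
  { rewrite <- EPa2. field. exact E1. }
  rewrite (qpoch_add (alpha * q) (2 * i) (n + p)).
  replace (alpha * q * q ^ (2 * i)) with (alpha * q ^ (2 * i) * q) by ring.
  rewrite !qshift_add, qtri_add.
  replace (shf (x * q ^ i) (alpha * q ^ (2 * i) * q) p) with ((q ^ i) ^ p * shf x (alpha * q * q ^ i) p).
  2:{ rewrite <- qshift_scale. replace (2 * i)%nat with (i + i)%nat by lia. rewrite Cpow_add_r. f_equal; ring. }
  replace (shf (w * q ^ i) (alpha * q ^ (2 * i) * q) p) with ((q ^ i) ^ p * shf w (alpha * q * q ^ i) p).
  2:{ rewrite <- qshift_scale. replace (2 * i)%nat with (i + i)%nat by lia. rewrite Cpow_add_r. f_equal; ring. }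
  replace (x * q ^ i * q ^ p) with (x * q ^ (i + p)) by (rewrite Cpow_add_r; ring).
  replace (w * q ^ i * q ^ p) with (w * q ^ (i + p)) by (rewrite Cpow_add_r; ring).
  replace (2 * (i + p))%nat with (2 * i + 2 * p)%nat by lia.
  replace (alpha * q ^ (2 * i + 2 * p)) with (alpha * q ^ (2 * i) * q ^ (2 * p)) by (rewrite Cpow_add_r; ring).
  replace ((alpha * q ^ (2 * i) * q) ^ p) with ((alpha * q) ^ p * ((q ^ i) ^ p * (q ^ i) ^ p)).
  2:{ rewrite <- (Cpow_mult_l (q ^ i) (q ^ i) p), <- (Cpow_mult_l (alpha * q)). f_equal. replace (2 * i)%nat with (i + i)%nat by lia. rewrite Cpow_add_r. ring. }
  rewrite (Cpow_add_r (- (1)) i p), (Cpow_add_r (alpha * q) i p).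
  replace ((i + p) * i)%nat with (i * i + i * p)%nat by ring.
  rewrite (Cpow_add_r q (i * i) (i * p)), !(Cpow_mult_r q i p).
  assert (Esign : (- (1)) ^ i * (- (1)) ^ i = 1).
  { rewrite <- Cpow_mult_l. replace (- (1) * - (1)) with (RtoC 1) by ring. apply Cpow_1_l. }
  assert (Etri : tri i * tri i * q ^ i = q ^ (i * i)).
  { clear. induction i as [|i IH]; [simpl; ring|].
    replace (S i * S i)%nat with (i * i + i + S i)%nat by ring.
    rewrite !Cpow_add_r, <- IH. simpl. ring. }
  assert (Hqip : (q ^ i) ^ p <> 0) by (apply Cpow_nz, Hqi).
  assert (Hgi : (alpha * q) ^ i <> 0) by (apply Cpow_nz, Cmult_neq_0; assumption).
  assert (Hgp : (alpha * q) ^ p <> 0) by (apply Cpow_nz, Cmult_neq_0; assumption).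
  assert (Hti := qtri_neq0 hq i).
  assert (Ha3 := qpoch_neq0 _ (n + p) Hal').
  rewrite <- Etri.
  match goal with |- ?L = ?Rr =>
    transitivity ((P alpha (i + p) * P (alpha * q ^ (i + p)) i) * ((- (1)) ^ i * (- (1)) ^ i) *
     ((1 - alpha * q ^ (2 * i) * q ^ (2 * p)) / (1 - alpha) * ((- (1)) ^ p * (tri p)) /
      (P q (n - p) * (P (alpha * q) (2 * i) * P (alpha * q ^ (2 * i) * q) (n + p))) *
      (shf x (alpha * q) i * shf x (alpha * q * q ^ i) p * (shf w (alpha * q) i * shf w (alpha * q * q ^ i) p) / ((alpha * q) ^ i * (alpha * q) ^ p)) *
      (P (x * q ^ (i + p)) (n - p) * P (w * q ^ (i + p)) (n - p)) * P tau i / (P q i * P q p * P s i * P (beta * tau) i))) end.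
  - field. repeat split; auto.
  - rewrite EPa, Esign, EPa3. field. repeat split; auto.
Qed.

End Watson.

(** * Terminating sums over the grid *)

Section Terminating.
Context {q : C} (hq : (0 < Cmod q < 1)%R).
Local Notation P := (qpoch q).
Local Notation Pi := (qpoch_inf q).
Local Notation r := (Cmod q).
Local Notation tri := (qtri q).
Local Notation shf := (qshift q).

Lemma qtri_decay (w v : R) :
  (0 <= w)%R -> (0 < v)%R ->
  exists M, (0 < M)%R /\ forall k, (w ^ k * Cmod (tri k) <= M * v ^ k)%R.
Proof.
  intros Hw Hv. destruct (qtri_geometric_bounded hq (w / v)%R) as [M [HM HMn]].
  { apply Rdiv_le_0_compat; assumption. }
  exists M. split; [exact HM|]. intros k.
  assert (Hk := HMn (S k)). simpl in Hk.
  assert (H0 : (0 <= rsum (fun k => (w / v) ^ k * Cmod (tri k))%R k)%R).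
  { apply rsum_nonneg. intros. apply Rmult_le_pos; [|apply Cmod_ge_0].
    apply rpow_nonneg, Rdiv_le_0_compat; assumption. }
  assert (Hvk : (0 < v ^ k)%R) by pos.
  replace (w ^ k)%R with ((w / v) ^ k * v ^ k)%R.
  2:{ rewrite <- Rpow_mult_distr. f_equal. field. lra. }
  replace ((w / v) ^ k * v ^ k * Cmod (tri k))%R with ((w / v) ^ k * Cmod (tri k) * v ^ k)%R by ring.
  apply Rmult_le_compat_r; lra.
Qed.

(** [s] is kept explicit since [entire_with_step] must not change it. *)
Definition entire_with (s : R) (f : C -> C) : Prop :=
  exists e, gauss_decay q s e /\ forall z, is_Cseries (fun k => e k * z ^ k) (f z).

(** If [f z / (z;q)_oo] is replaced by its value at [q z], the numerator over
    [(z;q)_oo] becomes [(1 - z) f (q z)]. As [s >= 1], multiplication by [z]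
    does not increase the rate, so one [s] serves all iterates. *)
Lemma entire_with_step (s : R) (f : C -> C) :
  (1 <= s)%R -> entire_with s f -> entire_with s (fun z => (1 - z) * f (z * q)).
Proof.
  intros Hs (e & (M & HM & He) & Hf).
  exists (fun k => q ^ k * e k - match k with O => RtoC 0 | S k' => q ^ k' * e k' end). split.
  - exists (M * 2)%R. split; [lra|]. intros k.
    assert (Hk : (Cmod (q ^ k * e k) <= M * s ^ k * Cmod (tri k))%R).
    { rewrite Cmod_mult, Cmod_pow. apply Rle_trans with (1 * Cmod (e k))%R.
      - apply Rmult_le_compat_r; [apply Cmod_ge_0|apply (qpow_lt1 hq)].
      - rewrite Rmult_1_l. apply He. }
    assert (Hk' : (Cmod match k with O => RtoC 0 | S k' => (q ^ k' * e k')%C end <= M * s ^ k * Cmod (tri k))%R).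
    { destruct k as [|k'].
      - rewrite Cmod_0. simpl. rewrite Cmod_1. lra.
      - rewrite Cmod_mult, qtri_S, Cmod_mult, Rmult_comm.
        replace (M * s ^ S k' * (Cmod (tri k') * Cmod (q ^ k')))%R
          with (s * (M * s ^ k' * Cmod (tri k')) * Cmod (q ^ k'))%R by (simpl; ring).
        apply Rmult_le_compat_r; [apply Cmod_ge_0|].
        apply Rle_trans with (1 := He k').
        assert (0 <= M * s ^ k' * Cmod (tri k'))%R.
        { nonneg. }
        nra. }
    unfold Cminus. apply Rle_trans with (1 := Cmod_triangle _ _). rewrite Cmod_opp. lra.
  - intros z. assert (H1 := Hf (z * q)).
    assert (H2 : is_Cseries (fun k => match k with O => RtoC 0 | S k' => q ^ k' * e k' end * z ^ k)
       (z * f (z * q))).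
    { assert (H := is_Cseries_shift (fun k => match k with O => RtoC 0 | S k' => q ^ k' * e k' end * z ^ k) (z * f (z * q)) 1).
      simpl in H. replace (0 + 0 * 1 + z * f (z * q)) with (z * f (z * q)) in H by ring.
      apply H. apply (is_Cseries_scal z) in H1. revert H1. apply is_Cseries_ext.
      intros k. rewrite Cpow_mult_l. ring. }
    apply (is_Cseries_scal (- (1))) in H2.
    assert (H3 := is_Cseries_plus _ _ _ _ H1 H2).
    replace ((1 - z) * f (z * q)) with (f (z * q) + - (1) * (z * f (z * q))) by ring.
    revert H3. apply is_Cseries_ext. intros k. rewrite Cpow_mult_l. ring.
Qed.

Lemma entire_with_iter (s : R) (f : C -> C) (m : nat) :
  (1 <= s)%R -> entire_with s f -> entire_with s (fun z => P z m * f (z * q ^ m)).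
Proof.
  intros Hs Hf. induction m as [|m IH].
  - destruct Hf as (e & He & Hf). exists e. split; [exact He|]. intros z.
    simpl. replace (1 * f (z * 1)) with (f z) by (rewrite !Cmult_1_r; ring). apply Hf.
  - apply (entire_with_step s _ Hs) in IH. destruct IH as (e & He & IH).
    exists e. split; [exact He|]. intros z. specialize (IH z).
    rewrite qpoch_S_l. replace (z * q ^ S m) with (z * q * q ^ m) by (simpl; ring).
    rewrite <- Cmult_assoc. exact IH.
Qed.

Lemma euler_abs_bound : exists M, forall n,
  (rsum (fun k => Cmod ((- (1)) ^ k * tri k / P q k) * (/ 2) ^ k)%R n <= M)%R.
Proof.
  destruct (qpoch_inv_bounded hq q (q_regular hq)) as [M [HM HMk]].
  destruct (qtri_geometric_bounded hq (/ 2)%R ltac:(lra)) as [N [HN HNn]].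
  exists (M * N)%R. intros n.
  apply Rle_trans with (rsum (fun k => M * ((/ 2) ^ k * Cmod (tri k)))%R n).
  - apply rsum_le. intros k _. unfold Cdiv. rewrite !Cmod_mult, (Cmod_sign k).
    replace (M * ((/ 2) ^ k * Cmod (tri k)))%R with (Cmod (tri k) * M * (/ 2) ^ k)%R by ring.
    apply Rmult_le_compat_r; [nonneg|]. rewrite Rmult_1_l.
    apply Rmult_le_compat_l; [apply Cmod_ge_0|apply HMk].
  - rewrite rsum_scal. apply Rmult_le_compat_l; [lra|apply HNn].
Qed.

(** The Taylor coefficients of an entire multiple of [(z;q)_oo] in terms of
    those of the quotient: Euler's series for [(z;q)_oo] is multiplied out. *)
Lemma entire_coefficients (s M : R) (e c : nat -> C) (f : C -> C) :
  (0 <= s)%R -> gauss_decay q s e -> (forall z, is_Cseries (fun k => e k * z ^ k) (f z)) ->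
  (forall n, (rsum (fun k => Cmod (c k) * (/ 2) ^ k)%R n <= M)%R) ->
  (forall z, (Cmod z <= / 2)%R -> is_Cseries (fun k => c k * z ^ k) (f z / Pi z)) ->
  forall k, e k = csum (fun i => c i * ((- (1)) ^ (k - i) * tri (k - i) / P q (k - i))) (S k).
Proof.
  intros Hs He Hf HM Hc.
  destruct euler_abs_bound as [N HN].
  destruct (gauss_decay_bounded hq s e (/ 2) ltac:(lra) Hs He) as [M' HM'].
  set (eu := fun k => (- (1)) ^ k * tri k / P q k) in *.
  set (d := fun k => csum (fun i => c i * eu (k - i)%nat) (S k)).
  assert (HA : forall z, (Cmod z <= / 2)%R -> forall I J,
    (rsum (fun i => rsum (fun j => Cmod (c i * z ^ i * (eu j * z ^ j))) J) I <= M * N)%R).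
  { intros z Hz I J.
    apply Rle_trans with (rsum (fun i => rsum (fun j => (Cmod (c i) * (/ 2) ^ i) * (Cmod (eu j) * (/ 2) ^ j))%R J) I).
    - apply rsum_le. intros i _. apply rsum_le. intros j _.
      rewrite !Cmod_mult, !Cmod_pow.
      assert (Hp : forall n, (0 <= Cmod z ^ n <= (/ 2) ^ n)%R).
      { intros n. split; [nonneg|apply rpow_le; split; [apply Cmod_ge_0|exact Hz]]. }
      assert (H1 := Hp i). assert (H2 := Hp j). assert (H3 := Cmod_ge_0 (c i)). assert (H4 := Cmod_ge_0 (eu j)).
      apply Rmult_le_compat; try nonneg; apply Rmult_le_compat_l; lra.
    - apply (product_rsum (fun i => Cmod (c i) * (/ 2) ^ i)%R (fun j => Cmod (eu j) * (/ 2) ^ j)%R); auto;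
      intros; nonneg. }
  assert (Ed : forall z k, csum (fun i => c i * z ^ i * (eu (k - i)%nat * z ^ (k - i))) (S k) = d k * z ^ k).
  { intros z k. unfold d. rewrite (Cmult_comm _ (z ^ k)), <- csum_scal. apply csum_ext. intros i Hi.
    replace (z ^ k) with (z ^ i * z ^ (k - i)) by (rewrite <- Cpow_add_r; f_equal; lia). ring. }
  assert (Hps : power_series (fun k => e k - d k) (/ 2) (M' + M * N) (fun _ => 0)).
  { split.
    - intros n.
      assert (H2 : (Cmod (RtoC (/ 2)) <= / 2)%R) by (rewrite Cmod_R, Rabs_pos_eq; lra).
      destruct (Cseries_diagonal _ _ (HA _ H2)) as (x & _ & _ & Hd).
      apply Rle_trans with (2 := Rplus_le_compat _ _ _ _ (HM' n) (Hd n)).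
      rewrite <- rsum_plus. apply rsum_le. intros k _. rewrite Ed, Cmod_mult, Cmod_pow, Cmod_R, Rabs_pos_eq by lra.
      rewrite <- Rmult_plus_distr_r. apply Rmult_le_compat_r; [nonneg|].
      unfold Cminus. apply Rle_trans with (1 := Cmod_triangle _ _). rewrite Cmod_opp. lra.
    - intros z Hz. destruct (Cseries_diagonal _ _ (HA _ Hz)) as (x & Ha & Hb & _).
      assert (HPz : Pi z <> 0) by (apply (qpoch_inf_neq0 hq), (small_qregular hq); lra).
      assert (Ex : x = f z).
      { assert (H := is_Cseries_scal (Pi z) _ _ (Hc z Hz)).
        replace (Pi z * (f z / Pi z)) with (f z) in H by (field; exact HPz).
        refine (is_Cseries_unique _ _ _ Ha _). revert H. apply is_Cseries_ext.
        intros i. symmetry. apply Cseries_eq. rewrite (Cmult_comm (Pi z)). apply is_Cseries_scal.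
        apply (euler_series hq). }
      subst x. assert (H := is_Cseries_plus _ _ _ _ (Hf z) (is_Cseries_scal (- (1)) _ _ Hb)).
      replace (f z + - (1) * f z) with (RtoC 0) in H by ring.
      revert H. apply is_Cseries_ext. intros k. rewrite Ed. ring. }
  intros k. assert (Hhalf : (0 < / 2)%R) by lra.
  assert (H := power_series_identity _ _ _ _ Hhalf Hps).
  assert (Hz : forall eps, (0 < eps)%R -> exists z, (0 < Cmod z < eps)%R /\ RtoC 0 = 0).
  { intros eps Heps. exists (RtoC (eps / 2)). rewrite Cmod_R, Rabs_pos_eq by lra.
    split; [lra|reflexivity]. }
  specialize (H Hz k).
  replace (e k) with ((e k - d k) + d k) by ring. cbv beta in H. rewrite H. apply Cplus_0_l.
Qed.

(** Rearranged by powers of [Z], the series becomes finite: by Euler the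
    coefficient of [Z^k] contains [(q^(j+1-k);q)_oo], which vanishes for [k > j]. *)
Lemma terminating_sum (s M : R) (f : C -> C) (c : nat -> C) (Z : C) (j : nat) :
  (1 <= s)%R -> entire_with s f ->
  (forall n, (rsum (fun k => Cmod (c k) * (/ 2) ^ k)%R n <= M)%R) ->
  (forall z, (Cmod z <= / 2)%R -> is_Cseries (fun k => c k * z ^ k) (f z / Pi z)) ->
  (s * Cmod Z * r ^ j <= / 4)%R ->
  is_Cseries (fun l => (- (1)) ^ l * tri (S l) * (q ^ j) ^ l / P q l * f (Z / q ^ l))
    (Pi q * csum (fun i => c i * Z ^ i * (P Z (j - i) / P q (j - i))) (S j)).
Proof.
  intros Hs (e & He & Hf) HM Hc HZ.
  assert (Hec := entire_coefficients s M e c f ltac:(lra) He Hf HM Hc).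
  assert (Hq := qpoch_q_neq0 hq). assert (Hqn := qpow_neq0 hq).
  assert (HZ0 := Cmod_ge_0 Z). assert (HsZ : (0 <= s * Cmod Z)%R) by nonneg.
  destruct He as (N & HN & He).
  destruct (qpoch_inv_bounded hq q (q_regular hq)) as [M1 [HM1 HM1k]].
  destruct (qtri_decay 1 (/ 2) ltac:(lra) ltac:(lra)) as [M2 [HM2 HM2k]].
  destruct (qtri_decay (s * Cmod Z) (/ 2) HsZ ltac:(lra)) as [M3 [HM3 HM3k]].
  set (a := fun l k => (- (1)) ^ l * tri (S l) * (q ^ j) ^ l / P q l * (e k * (Z / q ^ l) ^ k)).
  assert (Hqpos : forall n, (0 < r ^ n)%R) by (intros; pos).
  (* the exponent of |q| is a square in l - k *)
  assert (Hcore : forall l k, (Cmod (tri (S l)) * r ^ (j * l) * (Cmod (tri k) * (s * Cmod Z) ^ k / r ^ (l * k))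
     <= (M2 + M3) * ((/ 2) ^ l * (/ 2) ^ k))%R).
  { intros l k. destruct (Nat.le_ge_cases k l) as [Hkl|Hkl].
    - replace l with (k + (l - k))%nat by lia. generalize (l - k)%nat. clear l Hkl. intros d.
      rewrite qtri_S, qtri_add.
      assert (E := f_equal Cmod (qtri_square (q := q) k)). rewrite qtri_S in E.
      rewrite !Cmod_mult, !Cmod_pow in *.
      replace ((/ 2) ^ (k + d) * (/ 2) ^ k)%R with ((/ 4) ^ k * (/ 2) ^ d)%R.
      2:{ rewrite pow_add. replace (/ 4)%R with (/ 2 * / 2)%R by field. rewrite Rpow_mult_distr. ring. }
      apply Rle_trans with ((s * Cmod Z * r ^ j) ^ k * (Cmod (tri d) * (r ^ (j * d) * r ^ d)))%R.
      + apply Req_le. rewrite !Rpow_mult_distr, <- !pow_mult in *.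
        rewrite Nat.mul_add_distr_l, Nat.mul_add_distr_r, !pow_add.
        replace (r ^ (k * k))%R with (Cmod (tri k) * (Cmod (tri k) * r ^ k))%R by (symmetry; exact E).
        rewrite (Nat.mul_comm d k).
        assert (H1 := Hqpos k). assert (H2 := Hqpos (k * d)%nat).
        assert (H3 : (0 < Cmod (tri k))%R) by (apply Cmod_gt_0, (qtri_neq0 hq)).
        field. repeat split; lra.
      + assert (Hx : (0 <= (s * Cmod Z * r ^ j) ^ k <= (/ 4) ^ k)%R).
        { assert (H := Hqpos j). split; [nonneg|].
          apply rpow_le. split; [nonneg|exact HZ]. }
        assert (Hy : (0 <= Cmod (tri d) * (r ^ (j * d) * r ^ d) <= M2 * (/ 2) ^ d)%R).
        { assert (H1 := qpow_lt1 hq (j * d)). assert (H2 := qpow_lt1 hq d).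
          assert (H3 := HM2k d). rewrite pow1, Rmult_1_l in H3. assert (H4 := Cmod_ge_0 (tri d)).
          split; [nonneg|].
          apply Rle_trans with (Cmod (tri d) * (1 * 1))%R; [|lra].
          apply Rmult_le_compat_l; [lra|]. apply Rmult_le_compat; lra. }
        assert (H5 := rpow_nonneg (/ 2) d ltac:(lra)).
        apply Rle_trans with ((/ 4) ^ k * (M2 * (/ 2) ^ d))%R; [apply Rmult_le_compat; lra|].
        replace ((M2 + M3) * ((/ 4) ^ k * (/ 2) ^ d))%R with
          ((/ 4) ^ k * (M2 * (/ 2) ^ d) + (/ 4) ^ k * (M3 * (/ 2) ^ d))%R by ring.
        assert (0 <= (/ 4) ^ k * (M3 * (/ 2) ^ d))%R; [|lra].
        nonneg.
    - replace k with (l + (k - l))%nat by lia. generalize (k - l)%nat. clear k Hkl. intros d.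
      rewrite (qtri_add l d).
      assert (E := f_equal Cmod (qtri_square (q := q) l)).
      rewrite !Cmod_mult, !Cmod_pow in *.
      replace ((/ 2) ^ l * (/ 2) ^ (l + d))%R with ((/ 4) ^ l * (/ 2) ^ d)%R.
      2:{ rewrite pow_add. replace (/ 4)%R with (/ 2 * / 2)%R by field. rewrite Rpow_mult_distr. ring. }
      apply Rle_trans with ((s * Cmod Z * r ^ j) ^ l * ((s * Cmod Z) ^ d * Cmod (tri d)))%R.
      + apply Req_le. rewrite !Rpow_mult_distr, <- !pow_mult in *.
        rewrite Nat.mul_add_distr_l, !pow_add.
        replace (r ^ (l * l))%R with (Cmod (tri l) * Cmod (tri (S l)))%R by (symmetry; exact E).
        assert (H2 := Hqpos (l * d)%nat).
        assert (H3 : (0 < Cmod (tri l))%R) by (apply Cmod_gt_0, (qtri_neq0 hq)).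
        assert (H4 : (0 < Cmod (tri (S l)))%R) by (apply Cmod_gt_0, (qtri_neq0 hq)).
        field. repeat split; lra.
      + assert (Hx : (0 <= (s * Cmod Z * r ^ j) ^ l <= (/ 4) ^ l)%R).
        { assert (H := Hqpos j). split; [nonneg|].
          apply rpow_le. split; [nonneg|exact HZ]. }
        assert (Hy : (0 <= (s * Cmod Z) ^ d * Cmod (tri d) <= M3 * (/ 2) ^ d)%R).
        { split; [nonneg|apply HM3k]. }
        assert (H5 := rpow_nonneg (/ 2) d ltac:(lra)).
        apply Rle_trans with ((/ 4) ^ l * (M3 * (/ 2) ^ d))%R; [apply Rmult_le_compat; lra|].
        replace ((M2 + M3) * ((/ 4) ^ l * (/ 2) ^ d))%R with
          ((/ 4) ^ l * (M3 * (/ 2) ^ d) + (/ 4) ^ l * (M2 * (/ 2) ^ d))%R by ring.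
        assert (0 <= (/ 4) ^ l * (M2 * (/ 2) ^ d))%R; [|lra].
        nonneg. }
  assert (Ha : forall l k, (Cmod (a l k) <= (M1 * N * (M2 + M3) * (/ 2) ^ l) * (/ 2) ^ k)%R).
  { intros l k. unfold a.
    replace ((Z / q ^ l) ^ k) with (Z ^ k / q ^ (l * k)).
    2:{ unfold Cdiv. rewrite Cpow_mult_l, Cpow_inv by apply Hqn. rewrite <- Cpow_mult_r. reflexivity. }
    unfold Cdiv. rewrite !Cmod_mult, (Cmod_sign l), (Cmod_inv (q ^ (l * k))), !Cmod_pow by apply Hqn.
    rewrite <- pow_mult.
    apply Rle_trans with (M1 * N * (Cmod (tri (S l)) * r ^ (j * l) * (Cmod (tri k) * (s * Cmod Z) ^ k / r ^ (l * k))))%R.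
    - rewrite Rpow_mult_distr.
      replace (M1 * N * (Cmod (tri (S l)) * r ^ (j * l) * (Cmod (tri k) * (s ^ k * Cmod Z ^ k) / r ^ (l * k))))%R
       with ((Cmod (tri (S l)) * r ^ (j * l) * M1) * ((N * s ^ k * Cmod (tri k)) * (Cmod Z ^ k * / r ^ (l * k))))%R
       by (unfold Rdiv; ring).
      assert (H1 := Hqpos (j * l)%nat). assert (H2 := Rinv_0_lt_compat _ (Hqpos (l * k)%nat)).
      assert (H3 := rpow_nonneg (Cmod Z) k HZ0). assert (H4 := Cmod_ge_0 (tri (S l))).
      assert (H5 : (0 <= Cmod Z ^ k * / r ^ (l * k))%R) by nonneg.
      apply Rmult_le_compat.
      + rewrite Rmult_1_l. nonneg.
      + nonneg.
      + rewrite Rmult_1_l. apply Rmult_le_compat_l; [nonneg|apply HM1k].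
      + apply Rmult_le_compat_r; [exact H5|apply He].
    - replace (M1 * N * (M2 + M3) * (/ 2) ^ l * (/ 2) ^ k)%R with (M1 * N * ((M2 + M3) * ((/ 2) ^ l * (/ 2) ^ k)))%R by ring.
      apply Rmult_le_compat_l; [nonneg|apply Hcore]. }
  assert (HA : forall I J, (rsum (fun l => rsum (fun k => Cmod (a l k)) J) I <=
     (M1 * N * (M2 + M3) * / (1 - / 2)) * / (1 - / 2))%R).
  { intros I J.
    apply Rle_trans with (rsum (fun l => rsum (fun k => (M1 * N * (M2 + M3) * (/ 2) ^ l) * (/ 2) ^ k)%R J) I).
    - apply rsum_le. intros l _. apply rsum_le. intros k _. apply Ha.
    - apply (product_rsum (fun l => M1 * N * (M2 + M3) * (/ 2) ^ l)%R (fun k => (/ 2) ^ k)%R).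
      + intros. nonneg.
      + intros. nonneg.
      + intros. rewrite rsum_scal. apply Rmult_le_compat_l; [nonneg|].
        apply geometric_le; lra.
      + intros. apply geometric_le; lra. }
  destruct (Cseries_fubini _ _ HA) as (x & H1 & H2 & _).
  assert (Ecol : forall k, Cseries (fun l => a l k) = e k * Z ^ k * Pi (q ^ S j / q ^ k)).
  { intros k. apply Cseries_eq.
    assert (H := is_Cseries_scal (e k * Z ^ k) _ _ (euler_series hq (q ^ S j / q ^ k))).
    revert H. apply is_Cseries_ext. intros l. unfold a. rewrite qtri_S.
    unfold Cdiv. rewrite !Cpow_mult_l, !Cpow_inv by apply Hqn.
    rewrite <- !Cpow_mult_r, (Nat.mul_comm l k). change (S j * l)%nat with (l + j * l)%nat. rewrite Cpow_add_r. ring. }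
  assert (Efin : x = csum (fun k => e k * Z ^ k * Pi (q ^ S j / q ^ k)) (S j)).
  { refine (is_Cseries_unique _ _ _ H2 _).
    apply is_Cseries_ext with (fun k => e k * Z ^ k * Pi (q ^ S j / q ^ k)); [intros; symmetry; apply Ecol|].
    apply is_Cseries_finite. intros k Hk.
    rewrite (qpoch_inf_zero hq _ (k - S j)); [ring|].
    transitivity (q ^ S j * q ^ (k - S j) / q ^ k); [field; apply Hqn|].
    rewrite <- Cpow_add_r. replace (S j + (k - S j))%nat with k by lia. field. apply Hqn. }
  assert (Ex : x = Pi q * csum (fun i => c i * Z ^ i * (P Z (j - i) / P q (j - i))) (S j)).
  { rewrite Efin.
    set (g := fun i p => c i * Z ^ i * ((- (1)) ^ p * tri p / P q p * Z ^ p * (Pi q / P q (j - i - p)))).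
    transitivity (csum (fun k => csum (fun i => g i (k - i)%nat) (S k)) (S j)).
    - apply csum_ext. intros k Hk. rewrite Hec.
      replace (q ^ S j / q ^ k) with (q * q ^ (j - k)).
      2:{ replace (q ^ S j) with (q * q ^ (j - k) * q ^ k); [field; apply Hqn|].
          rewrite <- Cmult_assoc, <- Cpow_add_r. replace (j - k + k)%nat with j by lia. reflexivity. }
      assert (EP := qpoch_inf_split hq q (j - k)). assert (H0 := Hq (j - k)%nat).
      replace (Pi (q * q ^ (j - k))) with (Pi q / P q (j - k)) by (rewrite EP; field; exact H0).
      match goal with |- csum ?u ?v * ?w * ?z = _ => replace (csum u v * w * z) with ((w * z) * csum u v) by ring end.
      rewrite <- csum_scal. apply csum_ext. intros i Hi. unfold g.
      replace (j - i - (k - i))%nat with (j - k)%nat by lia.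
      replace (Z ^ k) with (Z ^ i * Z ^ (k - i)) by (rewrite <- Cpow_add_r; f_equal; lia). ring.
    - rewrite csum_triangle, <- csum_scal. apply csum_ext. intros i Hi. unfold g.
      rewrite csum_scal. replace (S j - i)%nat with (S (j - i)) by lia.
      rewrite <- (qvandermonde hq (j - i) Z 0).
      match goal with |- _ = ?u * (?v * ?w) => replace (u * (v * w)) with (v * (u * w)) by ring end.
      f_equal. rewrite <- csum_scal. apply csum_ext. intros p Hp.
      replace (shf Z 0 p) with (Z ^ p).
      2:{ clear. induction p as [|p IH]; simpl; [reflexivity|rewrite <- IH; ring]. }
      rewrite Cmult_0_l. replace (P 0 (j - i - p)) with (RtoC 1).
      2:{ clear. induction (j - i - p)%nat as [|n IH]; simpl; [reflexivity|rewrite <- IH; ring]. }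
      field. auto. }
  rewrite <- Ex. revert H1. apply is_Cseries_ext. intros l.
  apply Cseries_eq. apply is_Cseries_scal. apply Hf.
Qed.

End Terminating.

(** * Growth along the grids *)

Section Growth.
Context {q : C} (hq : (0 < Cmod q < 1)%R).
Local Notation P := (qpoch q).
Local Notation Pi := (qpoch_inf q).
Local Notation r := (Cmod q).
Local Notation tri := (qtri q).
Local Notation shf := (qshift q).

Lemma qpoch_inf_inverse_base (Z : C) (l : nat) :
  Z <> 0 -> Pi (Z / q ^ l) * tri (S l) = P (q / Z) l * (- Z) ^ l * Pi Z.
Proof.
  intros HZ. assert (Hl := qpow_neq0 hq l).
  rewrite (qpoch_inf_split hq (Z / q ^ l) l).
  replace (Z / q ^ l * q ^ l) with Z by (field; exact Hl).
  rewrite <- (qpoch_reverse hq Z l HZ). ring.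
Qed.

Lemma qpoch_inf_inverse_base_upper (Z : C) : Z <> 0 ->
  exists M, (0 < M)%R /\ forall l, (Cmod (Pi (Z / q ^ l)) * Cmod (tri (S l)) <= M * Cmod Z ^ l)%R.
Proof.
  intros HZ. exists (qbound q (Cmod (q / Z)) * qbound q (Cmod Z))%R.
  split; [pos|]. intros l.
  rewrite <- Cmod_mult, (qpoch_inf_inverse_base Z l HZ), !Cmod_mult, Cmod_pow, Cmod_opp.
  replace (qbound q (Cmod (q / Z)) * qbound q (Cmod Z) * Cmod Z ^ l)%R
    with (qbound q (Cmod (q / Z)) * Cmod Z ^ l * qbound q (Cmod Z))%R by ring.
  assert (H := rpow_nonneg (Cmod Z) l (Cmod_ge_0 _)).
  apply Rmult_le_compat.
  - nonneg.
  - apply Cmod_ge_0.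
  - apply Rmult_le_compat_r; [exact H|apply (qpoch_bound hq)].
  - apply (qpoch_inf_bound hq). lra.
Qed.

Lemma qpoch_inf_inverse_base_lower (Z : C) :
  Z <> 0 -> qregular q Z -> qregular q (q / Z) ->
  exists M, (0 < M)%R /\ forall l, Pi (Z / q ^ l) <> 0 /\
    (/ Cmod (Pi (Z / q ^ l)) <= M * (Cmod (tri (S l)) / Cmod Z ^ l))%R.
Proof.
  intros HZ HZ1 HZ2. destruct (qpoch_inv_bounded hq _ HZ2) as [M [HM HMk]].
  assert (HPZ := qpoch_inf_neq0 hq Z HZ1).
  assert (HPZ' : (0 < Cmod (Pi Z))%R) by (apply Cmod_gt_0, HPZ).
  exists (M * / Cmod (Pi Z))%R.
  split; [pos|]. intros l.
  assert (E := qpoch_inf_inverse_base Z l HZ).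
  assert (Ht := qtri_neq0 hq (S l)). assert (Hp := qpoch_neq0 _ l HZ2).
  assert (HZl : (- Z) ^ l <> 0).
  { apply Cpow_nz. intros E0. apply HZ. replace Z with (- - Z) by ring. rewrite E0. ring. }
  assert (Hn : Pi (Z / q ^ l) <> 0).
  { intros E0. rewrite E0, Cmult_0_l in E. symmetry in E.
    revert E. repeat apply Cmult_neq_0; assumption. }
  split; [exact Hn|].
  assert (E2 : / Pi (Z / q ^ l) = / P (q / Z) l * / Pi Z * (tri (S l) / (- Z) ^ l)).
  { assert (E3 : Pi (Z / q ^ l) = P (q / Z) l * (- Z) ^ l * Pi Z / tri (S l)).
    { rewrite <- E. field. exact Ht. }
    rewrite E3. field. auto. }
  rewrite <- Cmod_inv by exact Hn. rewrite E2, !Cmod_mult, Cmod_div, Cmod_pow, Cmod_opp, (Cmod_inv (Pi Z)) by assumption.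
  apply Rmult_le_compat_r.
  - apply Rdiv_le_0_compat; [apply Cmod_ge_0|]. pos.
  - apply Rmult_le_compat_r; [left; apply Rinv_0_lt_compat, HPZ'|apply HMk].
Qed.

(** The gap between [sg] and [rho] absorbs the factor [l] that the convolution
    of two equal geometric sequences has. *)
Lemma geometric_convolution (sg rho : R) (l : nat) :
  (0 <= sg < rho)%R ->
  (rsum (fun k => rho ^ k * sg ^ (l - k))%R l <= sg / (rho - sg) * rho ^ l)%R.
Proof.
  intros H. assert (H0 : (0 <= sg / (rho - sg))%R) by (apply Rdiv_le_0_compat; lra).
  induction l as [|l IH]; [simpl; lra|].
  change (rsum (fun k => rho ^ k * sg ^ (S l - k))%R (S l)) with
    (rsum (fun k => rho ^ k * sg ^ (S l - k))%R l + rho ^ l * sg ^ (S l - l))%R.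
  rewrite (rsum_ext _ (fun k => sg * (rho ^ k * sg ^ (l - k)))%R).
  2:{ intros k Hk. replace (S l - k)%nat with (S (l - k)) by lia. simpl. ring. }
  rewrite rsum_scal. replace (S l - l)%nat with 1%nat by lia. rewrite pow_1.
  apply Rle_trans with (sg * (sg / (rho - sg) * rho ^ l) + rho ^ l * sg)%R.
  - apply Rplus_le_compat_r, Rmult_le_compat_l; [lra|exact IH].
  - apply Req_le. simpl. field. lra.
Qed.

(** On the grid [Z q^(-l)] the l-th and later terms of Jackson's series are of
    size [|B|^l] relative to [(Z q^(-l);q)_oo], and the k-th term with [k < l]
    is of size [|B|^k |A|^(l-k)]. *)
Lemma jackson_growth (A B D Z : C) (sg rho : R) :
  A <> 0 -> Z <> 0 -> (Cmod A <= sg)%R -> (Cmod B <= sg)%R -> (sg < rho)%R ->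
  qregular q D -> qregular q Z -> qregular q (q / Z) ->
  exists M, (0 < M)%R /\
    forall l, (Cmod (jackson q A B D (Z / q ^ l) / Pi (Z / q ^ l)) <= M * rho ^ l)%R.
Proof.
  intros HA HZ HAs HBs Hsr HD HZ1 HZ2.
  assert (HA0 := Cmod_ge_0 A). assert (HZ0 : (0 < Cmod Z)%R) by (apply Cmod_gt_0, HZ).
  assert (HAZ : A * Z <> 0) by (apply Cmult_neq_0; assumption).
  destruct (jackson_coef_bound hq A B D rho ltac:(lra) HD) as [M1 [HM1 HM1k]].
  destruct (qpoch_inf_inverse_base_upper (A * Z) HAZ) as [M2 [HM2 HM2k]].
  destruct (qpoch_inf_inverse_base_lower Z HZ HZ1 HZ2) as [M3 [HM3 HM3k]].
  destruct (qtri_geometric_bounded hq (rho * Cmod Z)%R) as [N [HN HNk]].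
  { nonneg. }
  set (Q := qbound q (Cmod (A * Z))). assert (HQ : (0 < Q)%R) by apply qbound_pos.
  exists (M1 * M2 * M3 * (sg / (rho - sg)) + M1 * Q * M3 * N)%R.
  assert (H123 : (0 < M1 * M2 * M3)%R) by pos.
  assert (H1Q3 : (0 < M1 * Q * M3)%R) by pos.
  split.
  { assert (0 <= sg / (rho - sg))%R by (apply Rdiv_le_0_compat; lra).
    assert (0 < M1 * Q * M3 * N)%R by pos.
    assert (0 <= M1 * M2 * M3 * (sg / (rho - sg)))%R by nonneg. lra. }
  intros l. destruct (HM3k l) as [Hn Hinv].
  assert (Hqpos : forall n, (0 < r ^ n)%R) by (intros; pos).
  assert (Hql := qpow_neq0 hq l).
  assert (Htpos : forall n, (0 < Cmod (tri n))%R) by (intros; apply Cmod_gt_0, (qtri_neq0 hq)).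
  assert (HZpos : forall n, (0 < Cmod Z ^ n)%R) by (intros; pos).
  set (f := fun k => / Pi (Z / q ^ l) * (jackson_coef q A B D k * (Z / q ^ l) ^ k * Pi (A * q ^ k * (Z / q ^ l)))).
  assert (Hf0 : forall k, (Cmod (f k) <= M1 * M3 * (Cmod (tri (S l)) / Cmod Z ^ l) *
     (rho ^ k * Cmod (tri k)) * (Cmod Z ^ k / (r ^ l) ^ k) * Cmod (Pi (A * q ^ k * (Z / q ^ l))))%R).
  { intros k. unfold f. rewrite !Cmod_mult, (Cmod_inv (Pi (Z / q ^ l))), (Cmod_pow (Z / q ^ l)), (Cmod_div Z), Cmod_pow by assumption.
    replace ((Cmod Z / r ^ l) ^ k)%R with (Cmod Z ^ k / (r ^ l) ^ k)%R.
    2:{ unfold Rdiv. rewrite Rpow_mult_distr, pow_inv. reflexivity. }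
    set (X := Cmod (Pi (A * q ^ k * (Z / q ^ l)))).
    assert (HX : (0 <= X)%R) by apply Cmod_ge_0.
    set (Y := (Cmod Z ^ k / (r ^ l) ^ k)%R).
    assert (HY : (0 <= Y)%R) by (apply Rdiv_le_0_compat; [left; apply HZpos|pos]).
    replace (M1 * M3 * (Cmod (tri (S l)) / Cmod Z ^ l) * (rho ^ k * Cmod (tri k)) * Y * X)%R
      with ((M3 * (Cmod (tri (S l)) / Cmod Z ^ l)) * ((M1 * (rho ^ k * Cmod (tri k))) * Y * X))%R by ring.
    apply Rmult_le_compat.
    - left. apply Rinv_0_lt_compat, Cmod_gt_0, Hn.
    - nonneg.
    - exact Hinv.
    - apply Rmult_le_compat_r; [exact HX|]. apply Rmult_le_compat_r; [exact HY|]. apply HM1k. }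
  assert (Hlow : forall k, (k < l)%nat -> (Cmod (f k) <= M1 * M2 * M3 * (rho ^ k * sg ^ (l - k)))%R).
  { intros k Hk. apply Rle_trans with (1 := Hf0 k).
    assert (Hup := HM2k (l - k)%nat).
    replace (A * Z / q ^ (l - k)) with (A * q ^ k * (Z / q ^ l)) in Hup.
    2:{ replace (q ^ l) with (q ^ k * q ^ (l - k)) by (rewrite <- Cpow_add_r; f_equal; lia).
        field. split; apply (qpow_neq0 hq). }
    revert Hup Hk. set (X := Cmod (Pi (A * q ^ k * (Z / q ^ l)))). intros Hup Hk.
    assert (Hl : l = (k + (l - k))%nat) by lia. revert Hup Hl. generalize (l - k)%nat. intros d Hup Hl.
    assert (Hid : (Cmod (tri k) * Cmod (tri (S l)) = Cmod (tri (S d)) * (r ^ l) ^ k)%R).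
    { rewrite Hl. replace (S (k + d)) with (k + S d)%nat by lia. rewrite qtri_add.
      assert (E := f_equal Cmod (qtri_square (q := q) k)). rewrite qtri_S in E.
      rewrite !Cmod_mult, !Cmod_pow in *. rewrite <- !pow_mult in *.
      replace ((k + d) * k)%nat with (k * k + k * d)%nat by ring. rewrite !pow_add, E.
      replace (k * S d)%nat with (k + k * d)%nat by ring. rewrite pow_add. ring. }
    apply Rle_trans with (M1 * M3 * rho ^ k * (Cmod (tri (S d)) * X) * (Cmod Z ^ k / Cmod Z ^ l))%R.
    - apply Req_le.
      assert (Hid2 : (Cmod (tri k) = Cmod (tri (S d)) * (r ^ l) ^ k / Cmod (tri (S l)))%R).
      { rewrite <- Hid. field. apply Rgt_not_eq, Htpos. }
      rewrite Hid2. assert (H1 := Htpos (S l)). assert (H2 := HZpos l).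
      assert (H3 : (0 < (r ^ l) ^ k)%R) by pos. field. repeat split; lra.
    - rewrite Cmod_mult, Rpow_mult_distr in Hup.
      rewrite Hl, (pow_add (Cmod Z)).
      apply Rle_trans with (M1 * M3 * rho ^ k * (M2 * (Cmod A ^ d * Cmod Z ^ d)) * (Cmod Z ^ k / (Cmod Z ^ k * Cmod Z ^ d)))%R.
      + apply Rmult_le_compat_r.
        { apply Rdiv_le_0_compat; [left; apply HZpos|pos]. }
        apply Rmult_le_compat_l; [|lra].
        nonneg.
      + apply Rle_trans with (M1 * M2 * M3 * (rho ^ k * Cmod A ^ d))%R.
        * apply Req_le. assert (H1 := HZpos k). assert (H2 := HZpos d). field. split; lra.
        * apply Rmult_le_compat_l; [lra|]. apply Rmult_le_compat_l; [nonneg|].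
          apply rpow_le. lra. }
  assert (Hhigh : forall d, (Cmod (f (l + d)%nat) <= M1 * Q * M3 * rho ^ l * ((rho * Cmod Z) ^ d * Cmod (tri d)))%R).
  { intros d. apply Rle_trans with (1 := Hf0 _).
    assert (HX : (Cmod (Pi (A * q ^ (l + d) * (Z / q ^ l))) <= Q)%R).
    { apply (qpoch_inf_bound hq).
      replace (A * q ^ (l + d) * (Z / q ^ l)) with (A * Z * q ^ d).
      2:{ rewrite Cpow_add_r. field. exact Hql. }
      rewrite (Cmod_mult (A * Z)), Cmod_pow. rewrite <- (Rmult_1_r (Cmod (A * Z))) at 2.
      apply Rmult_le_compat_l; [apply Cmod_ge_0|apply (qpow_lt1 hq)]. }
    apply Rle_trans with (M1 * M3 * (Cmod (tri (S l)) / Cmod Z ^ l) * (rho ^ (l + d) * Cmod (tri (l + d))) *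
       (Cmod Z ^ (l + d) / (r ^ l) ^ (l + d)) * Q)%R.
    { apply Rmult_le_compat_l; [|exact HX].
      assert (H1 := Htpos (S l)). assert (H2 := HZpos l). assert (H3 := Htpos (l + d)%nat).
      assert (H4 := HZpos (l + d)%nat). assert (H5 : (0 < (r ^ l) ^ (l + d))%R) by pos.
      assert (H6 := rpow_nonneg rho (l + d) ltac:(lra)).
      repeat apply Rmult_le_pos; try nonneg|| (left; apply Rinv_0_lt_compat; lra) || idtac. }
    apply Req_le. rewrite qtri_add, !Cmod_mult, Cmod_pow, Rpow_mult_distr, !pow_add.
    assert (E := f_equal Cmod (qtri_square (q := q) l)). rewrite Cmod_mult, !Cmod_pow in E.
    rewrite E. replace ((r ^ l) ^ d)%R with (r ^ (l * d))%R by (rewrite pow_mult; reflexivity).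
    assert (H1 := Htpos (S l)). assert (H2 := HZpos l). assert (H3 := Htpos l).
    assert (H4 := Hqpos (l * d)%nat). field. repeat split; lra. }
  assert (Hb : abs_le f ((M1 * M2 * M3 * (sg / (rho - sg)) + M1 * Q * M3 * N) * rho ^ l)).
  { intros n. apply Rle_trans with (rsum (fun k => Cmod (f k)) (l + n)).
    { apply rsum_mono; [intros; apply Cmod_ge_0|lia]. }
    rewrite rsum_add, Rmult_plus_distr_r. apply Rplus_le_compat.
    - apply Rle_trans with (rsum (fun k => M1 * M2 * M3 * (rho ^ k * sg ^ (l - k)))%R l).
      + apply rsum_le. exact Hlow.
      + rewrite rsum_scal, (Rmult_assoc (M1 * M2 * M3)). apply Rmult_le_compat_l; [lra|].
        apply geometric_convolution. lra.
    - apply Rle_trans with (rsum (fun d => M1 * Q * M3 * rho ^ l * ((rho * Cmod Z) ^ d * Cmod (tri d)))%R n).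
      + apply rsum_le. intros; apply Hhigh.
      + rewrite rsum_scal.
        replace (M1 * Q * M3 * N * rho ^ l)%R with (M1 * Q * M3 * rho ^ l * N)%R by ring.
        apply Rmult_le_compat_l; [|apply HNk].
        nonneg. }
  destruct (abs_le_series _ _ Hb) as [x [Hx Hxb]].
  assert (H := is_Cseries_scal (/ Pi (Z / q ^ l)) _ _ (jackson_is_series hq A B D (Z / q ^ l) HD)).
  assert (E := is_Cseries_unique _ _ _ Hx H).
  replace (jackson q A B D (Z / q ^ l) / Pi (Z / q ^ l)) with x; [exact Hxb|].
  rewrite E. unfold Cdiv. ring.
Qed.

(** On the grid where the larger of the two exponential solutions is absent the
    growth is governed by [A] alone. *)
Lemma laurent_growth (A D z0 : C) (rho : R) :
  A <> 0 -> z0 <> 0 -> (Cmod A < 1)%R -> (Cmod A < rho)%R ->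
  qregular q D -> qregular q z0 ->
  exists M, (0 < M)%R /\ forall n, qregular q (z0 / q ^ n) ->
    (Cmod (jackson q (q / z0) A D (z0 / q ^ n) / Pi (z0 / q ^ n)) <= M * rho ^ n)%R.
Proof.
  intros HA Hz0 HA1 HAr HD Hz. assert (HA0 := Cmod_ge_0 A).
  set (x := Rmin rho ((1 + Cmod A) / 2)).
  assert (Hx : (Cmod A < x)%R) by (apply Rmin_glb_lt; lra).
  assert (Hx1 : (x <= (1 + Cmod A) / 2)%R) by apply Rmin_r.
  assert (Hx2 : (x <= rho)%R) by apply Rmin_l.
  destruct (qshift_ratio_bound hq A D x ltac:(lra) ltac:(lra)) as [M1 [HM1 HM1k]].
  destruct (ratio_bounded hq z0 q (q_regular hq)) as [M2 [HM2 HM2k]].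
  set (K := laurent_const q A D z0). assert (HK := Cmod_ge_0 K).
  exists ((Cmod K * M1 * M2 + 1) * / (1 - x))%R.
  assert (HKM : (0 <= Cmod K * M1 * M2)%R) by nonneg.
  assert (Hix : (0 < / (1 - x))%R) by (apply Rinv_0_lt_compat; lra).
  split; [pos|].
  intros n Hn. assert (H := laurent_expansion_pos hq A D z0 n HA Hz0 HA1 HD Hz Hn). fold K in H.
  assert (Hb : abs_le (fun m => K * (shf A D (n + m) / P q (n + m) * (P z0 m / P q m)))
     (Cmod K * M1 * M2 * x ^ n * / (1 - x))).
  { apply abs_le_dom with (fun m => Cmod K * M1 * M2 * x ^ n * x ^ m)%R.
    - intros m. rewrite !Cmod_mult.
      replace (Cmod K * M1 * M2 * x ^ n * x ^ m)%R with (Cmod K * ((M1 * x ^ (n + m)) * M2))%R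
        by (rewrite pow_add; ring).
      apply Rmult_le_compat_l; [exact HK|].
      apply Rmult_le_compat; try apply Cmod_ge_0; [apply HM1k|apply HM2k].
    - intros m. rewrite rsum_scal. apply Rmult_le_compat_l.
      + nonneg.
      + apply geometric_le. lra. }
  destruct (abs_le_series _ _ Hb) as [y [Hy Hyb]].
  rewrite (is_Cseries_unique _ _ _ H Hy). apply Rle_trans with (1 := Hyb).
  assert (Hxn := rpow_nonneg x n ltac:(lra)).
  assert (Hxr : (x ^ n <= rho ^ n)%R) by (apply rpow_le; lra).
  replace (Cmod K * M1 * M2 * x ^ n * / (1 - x))%R with (Cmod K * M1 * M2 * / (1 - x) * x ^ n)%R by ring.
  apply Rmult_le_compat; [nonneg|exact Hxn| |exact Hxr].
  apply Rmult_le_compat_r; lra.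
Qed.

(** The numerator is bounded on the disc of radius [|Z|], and
    [1/(Z q^m;q)_oo = (Z;q)_m / (Z;q)_oo]. *)
Lemma jackson_bounded_at_0 (A B D Z : C) :
  qregular q D -> qregular q Z ->
  exists M, (0 < M)%R /\
    forall m, (Cmod (jackson q A B D (Z * q ^ m) / Pi (Z * q ^ m)) <= M)%R.
Proof.
  intros HD HZ. destruct (jackson_entire hq A B D HD) as (s & e & Hs & He & Hf).
  assert (HZ0 := Cmod_ge_0 Z).
  destruct (gauss_decay_bounded hq s e (Cmod Z) HZ0 ltac:(lra) He) as [M HM].
  assert (HM0 : (0 <= M)%R) by exact (HM O).
  assert (HPZ := qpoch_inf_neq0 hq Z HZ). assert (HPZ' : (0 < Cmod (Pi Z))%R) by (apply Cmod_gt_0, HPZ).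
  exists ((M + 1) * (qbound q (Cmod Z) * / Cmod (Pi Z)))%R.
  assert (HB : (0 < qbound q (Cmod Z) * / Cmod (Pi Z))%R).
  { pos. }
  split; [pos|]. intros m.
  assert (Hm : (Cmod (Z * q ^ m) <= Cmod Z)%R).
  { rewrite Cmod_mult, Cmod_pow. rewrite <- (Rmult_1_r (Cmod Z)) at 2.
    apply Rmult_le_compat_l; [exact HZ0|apply (qpow_lt1 hq)]. }
  assert (H1 := coef_abs_le e (Cmod Z) M (Z * q ^ m) HM Hm).
  destruct (abs_le_series _ _ H1) as [y [Hy Hyb]].
  rewrite (is_Cseries_unique _ _ _ (Hf (Z * q ^ m)) Hy).
  assert (Hpm : Pi (Z * q ^ m) <> 0) by (apply (qpoch_inf_neq0 hq), qregular_shift, HZ).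
  replace (y / Pi (Z * q ^ m)) with (y * (P Z m * / Pi Z)).
  2:{ assert (Hs' := qpoch_inf_split hq Z m). assert (Hp := qpoch_neq0 Z m HZ).
      rewrite Hs'. field. auto. }
  rewrite !Cmod_mult, (Cmod_inv (Pi Z)) by exact HPZ.
  apply Rmult_le_compat; [apply Cmod_ge_0| |lra|].
  - apply Rmult_le_pos; [apply Cmod_ge_0|left; apply Rinv_0_lt_compat, HPZ'].
  - apply Rmult_le_compat_r; [left; apply Rinv_0_lt_compat, HPZ'|apply (qpoch_bound hq)].
Qed.

End Growth.

(** * Bilateral sums and spectral values *)

Lemma geometric_rect (a : nat -> nat -> C) (K x w : R) :
  (0 <= K)%R -> (0 <= x < 1)%R -> (0 <= w < 1)%R ->
  (forall i j, (Cmod (a i j) <= K * x ^ i * w ^ j)%R) ->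
  forall I J, (rsum (fun i => rsum (fun j => Cmod (a i j)) J) I <= K * / (1 - x) * / (1 - w))%R.
Proof.
  intros HK Hx Hw Ha I J.
  apply Rle_trans with (rsum (fun i => rsum (fun j => (K * x ^ i) * w ^ j)%R J) I).
  - apply rsum_le. intros i _. apply rsum_le. intros j _. apply Ha.
  - apply (product_rsum (fun i => K * x ^ i)%R (fun j => w ^ j)%R).
    + intros. nonneg.
    + intros. nonneg.
    + intros. rewrite rsum_scal. apply Rmult_le_compat_l; [exact HK|]. apply geometric_le, Hx.
    + intros. apply geometric_le, Hw.
Qed.

(** Summation of a double series along the lines [l - m = n], for all integers
    [n]: the part below the diagonal and the part above it are summed by
    antidiagonals of shifted arrays. *)
Lemma double_series_by_difference (a : nat -> nat -> C) (K x w : R) :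
  (0 <= K)%R -> (0 <= x < 1)%R -> (0 <= w < 1)%R ->
  (forall i j, (Cmod (a i j) <= K * x ^ i * w ^ j)%R) ->
  exists s1 s2,
    is_Cseries (fun n => Cseries (fun m => a (n + m)%nat m)) s1 /\
    is_Cseries (fun p => Cseries (fun l => a l (S p + l)%nat)) s2 /\
    is_Cseries (fun l => Cseries (a l)) (s1 + s2) /\
    is_Cseries (fun m => Cseries (fun l => a l m)) (s1 + s2) /\
    (forall l, is_Cseries (a l) (Cseries (a l))) /\
    (forall m, is_Cseries (fun l => a l m) (Cseries (fun l => a l m))).
Proof.
  intros HK Hx Hw Ha.
  assert (Hxw : (0 <= x * w < 1)%R).
  { split; [nonneg|]. apply Rle_lt_trans with (x * 1)%R; [apply Rmult_le_compat_l; lra|lra]. }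
  destruct (Cseries_fubini _ _ (geometric_rect a K x w HK Hx Hw Ha)) as (s & H1 & H2 & _ & _ & H3 & H4).
  set (b := fun m n => a (n + m)%nat m).
  assert (Hb : forall m n, (Cmod (b m n) <= K * (x * w) ^ m * x ^ n)%R).
  { intros m n. apply Rle_trans with (1 := Ha _ _). apply Req_le.
    rewrite pow_add, Rpow_mult_distr. ring. }
  destruct (Cseries_diagonal _ _ (geometric_rect b K _ _ HK Hxw Hx Hb)) as (s1 & B1 & B2 & _).
  destruct (Cseries_fubini _ _ (geometric_rect b K _ _ HK Hxw Hx Hb)) as (s1' & B3 & B4 & _).
  assert (E1 : s1' = s1) by exact (is_Cseries_unique _ _ _ B3 B1). subst s1'.
  set (c := fun l p => a l (S p + l)%nat).
  assert (Hc : forall l p, (Cmod (c l p) <= K * (x * w) ^ l * w ^ p)%R).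
  { intros l p. apply Rle_trans with (1 := Ha _ _).
    rewrite Nat.add_succ_l, Rpow_mult_distr. simpl. rewrite pow_add.
    replace (K * x ^ l * (w * (w ^ p * w ^ l)))%R with (w * (K * (x ^ l * w ^ l) * w ^ p))%R by ring.
    rewrite <- (Rmult_1_l (K * (x ^ l * w ^ l) * w ^ p)) at 2.
    apply Rmult_le_compat_r; [|lra].
    nonneg. }
  destruct (Cseries_fubini _ _ (geometric_rect c K _ _ HK Hxw Hw Hc)) as (s2 & C1 & C2 & _ & _ & C3 & _).
  exists s1, s2. split; [exact B4|]. split; [exact C2|].
  assert (Hrow : forall l, Cseries (a l) = csum (fun m => b m (l - m)%nat) (S l) + Cseries (c l)).
  { intros l. apply Cseries_eq.
    rewrite (csum_ext _ (a l)).
    - apply is_Cseries_shift. apply is_Cseries_ext with (c l); [|apply C3].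
      intros k. unfold c. f_equal. lia.
    - intros m Hm. unfold b. f_equal. lia. }
  assert (E : s = s1 + s2).
  { refine (is_Cseries_unique _ _ _ H1 _).
    apply is_Cseries_ext with (fun l => csum (fun m => b m (l - m)%nat) (S l) + Cseries (c l)).
    - intros l. symmetry. apply Hrow.
    - apply is_Cseries_plus; assumption. }
  rewrite <- E. auto.
Qed.

Lemma is_Cseries_csum_swap (f : nat -> nat -> C) (s : nat -> C) (n : nat) :
  (forall i, (i < n)%nat -> is_Cseries (f i) (s i)) ->
  is_Cseries (fun m => csum (fun i => f i m) n) (csum s n).
Proof.
  induction n as [|n IH]; intros H.
  - exact (is_Cseries_finite (fun _ => 0) 0 (fun _ _ => eq_refl)).
  - simpl. apply is_Cseries_plus; [apply IH; intros; apply H; lia|apply H; lia].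
Qed.

Lemma finite_bound (f : nat -> C) (rho : R) (N : nat) :
  (0 < rho)%R -> exists M, (0 < M)%R /\ forall l, (l < N)%nat -> (Cmod (f l) <= M * rho ^ l)%R.
Proof.
  intros Hr. induction N as [|N [M [HM IH]]].
  - exists 1%R. split; [lra|intros; lia].
  - assert (HN : (0 < rho ^ N)%R) by pos. assert (Hf := Cmod_ge_0 (f N)).
    assert (Hd : (0 <= Cmod (f N) / rho ^ N)%R) by (apply Rdiv_le_0_compat; lra).
    exists (M + Cmod (f N) / rho ^ N)%R. split; [lra|]. intros l Hl.
    rewrite Rmult_plus_distr_r. assert (Hl0 : (0 < rho ^ l)%R) by pos.
    destruct (Nat.eq_dec l N) as [->|Hne].
    + replace (Cmod (f N) / rho ^ N * rho ^ N)%R with (Cmod (f N)) by (field; lra).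
      assert (0 < M * rho ^ N)%R by pos. lra.
    + specialize (IH l ltac:(lia)).
      assert (0 <= Cmod (f N) / rho ^ N * rho ^ l)%R by nonneg. lra.
Qed.

Section Main.
Context {q : C} (hq : (0 < Cmod q < 1)%R).
Local Notation P := (qpoch q).
Local Notation Pi := (qpoch_inf q).
Local Notation r := (Cmod q).
Local Notation tri := (qtri q).
Local Notation shf := (qshift q).

Lemma Cpowz_nat (n : nat) : Cpowz q (Z.of_nat n) = q ^ n.
Proof. destruct n as [|n]; [reflexivity|]. simpl. rewrite SuccNat2Pos.id_succ. reflexivity. Qed.

Lemma Cpowz_neg (n : nat) : Cpowz q (- Z.of_nat n) = / q ^ n.
Proof.
  destruct n as [|n]; [simpl; field|]. simpl. rewrite SuccNat2Pos.id_succ. reflexivity.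
Qed.

Lemma not_in_qZ_regular (Z : C) (i j : nat) :
  ~ in_qZ q 1 Z -> Z <> 0 -> qregular q (Z * q ^ i / q ^ j) /\ qregular q (q / Z).
Proof.
  intros H HZ. assert (Hq := qpow_neq0 hq). split; intros n E; apply H.
  - exists (Z.of_nat j - Z.of_nat i - Z.of_nat n)%Z.
    replace (Z.of_nat j - Z.of_nat i - Z.of_nat n)%Z with (Z.of_nat j - Z.of_nat (i + n))%Z by lia.
    assert (EZ : Z = q ^ j / q ^ (i + n)).
    { transitivity (Z * q ^ i / q ^ j * q ^ n * q ^ j / q ^ (i + n)).
      - rewrite Cpow_add_r. field. auto.
      - rewrite E. field. auto. }
    destruct (Nat.le_ge_cases (i + n) j) as [Hle|Hle].
    + replace (Z.of_nat j - Z.of_nat (i + n))%Z with (Z.of_nat (j - (i + n))) by lia.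
      rewrite Cpowz_nat, EZ. replace (q ^ j) with (q ^ (i + n) * q ^ (j - (i + n))).
      * field. auto.
      * rewrite <- Cpow_add_r. f_equal. lia.
    + replace (Z.of_nat j - Z.of_nat (i + n))%Z with (- Z.of_nat (i + n - j))%Z by lia.
      rewrite Cpowz_neg, EZ. replace (q ^ (i + n)) with (q ^ j * q ^ (i + n - j)).
      * field. auto.
      * rewrite <- Cpow_add_r. f_equal. lia.
  - exists (Z.of_nat (S n)). rewrite Cpowz_nat.
    transitivity (Z * (q / Z * q ^ n)); [rewrite E; ring|]. simpl. field. exact HZ.
Qed.

Lemma in_qZ_shift (w : C) (x : C) : in_qZ q x w -> exists i j : nat, w * q ^ j = x * q ^ i.
Proof.
  intros [k ->]. assert (Hq := qpow_neq0 hq). destruct (Z.le_ge_cases 0 k) as [Hk|Hk].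
  - exists (Z.to_nat k), O. replace k with (Z.of_nat (Z.to_nat k)) at 1 by lia.
    rewrite Cpowz_nat. simpl. ring.
  - exists O, (Z.to_nat (- k)). replace k with (- Z.of_nat (Z.to_nat (- k)))%Z at 1 by lia.
    rewrite Cpowz_neg. simpl. field. apply Hq.
Qed.

(** Growth of the second factor for a spectral value of [u]. If [|u| = 1] both
    exponential solutions have size [|a|^l]. If [|u| < 1], then [u] is in
    [a c q^Z] and the grid is one on which the solution of size [|a/u|^l] is absent. *)
Lemma spectral_growth (a c u e eb : C) (rho : R) :
  e * eb = 1 -> Cmod e = 1%R -> Cmod eb = 1%R -> a <> 0 -> c <> 0 -> u <> 0 ->
  (Cmod a <= 1)%R -> ~ in_qZ q 1 (c * eb) -> qregular q (a ^ 2) ->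
  (Cmod u = 1%R \/ ((Cmod u < 1)%R /\ in_qZ q (a * c) u)) ->
  (Cmod (a * u) < rho)%R ->
  exists M, (0 < M)%R /\ forall l,
    (Cmod (jackson q (a * e / u) (a * u * e) (a ^ 2) (c * eb / q ^ l) / Pi (c * eb / q ^ l)) <= M * rho ^ l)%R.
Proof.
  intros Hee He1 Heb1 Ha Hc Hu Ha1 HZ Hs Hspec Hrho.
  assert (He : e <> 0) by (apply Cmod_gt_0; lra). assert (Heb : eb <> 0) by (apply Cmod_gt_0; lra).
  assert (HZ0 : c * eb <> 0) by (apply Cmult_neq_0; assumption).
  assert (HA : a * e / u <> 0).
  { unfold Cdiv. repeat apply Cmult_neq_0; try assumption.
    intros E. apply C1_nz. rewrite <- (Cinv_r u Hu), E. ring. }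
  assert (HB : a * u * e <> 0) by (repeat apply Cmult_neq_0; assumption).
  assert (Hq := qpow_neq0 hq).
  assert (Hreg := fun i j => proj1 (not_in_qZ_regular _ i j HZ HZ0)).
  assert (HZr : qregular q (c * eb)).
  { specialize (Hreg O O). simpl in Hreg. replace (c * eb * 1 / 1) with (c * eb) in Hreg by field. exact Hreg. }
  destruct Hspec as [Hu1|[Hu1 Hqz]].
  - apply (jackson_growth hq _ _ _ _ (Cmod a)); auto.
    + rewrite Cmod_div, Cmod_mult, He1, Hu1 by exact Hu. apply Req_le. field.
    + rewrite !Cmod_mult, He1, Hu1. apply Req_le. ring.
    + rewrite Cmod_mult, Hu1 in Hrho. lra.
    + exact (proj2 (not_in_qZ_regular _ 0 0 HZ HZ0)).
  - destruct (in_qZ_shift u (a * c) Hqz) as (i & j & Hij).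
    (* the base point at which the factors of Jackson's series start to vanish *)
    set (z0 := c * eb * q ^ (S i) / q ^ j).
    assert (Hz0 : q / z0 = a * e / u).
    { assert (E1 : c = u * q ^ j / (a * q ^ i)) by (rewrite Hij; field; auto).
      unfold z0. rewrite E1. replace e with (/ eb).
      - simpl. field. repeat split; auto. apply (q_neq0 hq).
      - rewrite <- (Cmult_1_l (/ eb)), <- Hee. field. exact Heb. }
    assert (Hz0n : z0 <> 0).
    { intros E. apply HA. rewrite <- Hz0, E. unfold Cdiv. replace (/ RtoC 0) with (RtoC 0); [ring|].
      unfold Cinv. simpl. unfold Rdiv. apply injective_projections; simpl; ring. }
    assert (HBm : (Cmod (a * u * e) = Cmod (a * u))%R) by (rewrite (Cmod_mult (a * u)), He1; ring).
    assert (Hau : (Cmod (a * u) < 1)%R).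
    { rewrite Cmod_mult. assert (H1 := Cmod_ge_0 u).
      apply Rle_lt_trans with (1 * Cmod u)%R; [apply Rmult_le_compat_r; lra|lra]. }
    destruct (laurent_growth hq (a * u * e) (a ^ 2) z0 rho HB Hz0n ltac:(lra) ltac:(lra) Hs (Hreg (S i) j))
      as [M [HM HMn]].
    rewrite Hz0 in HMn.
    assert (Hr0 : (0 < rho)%R) by (assert (H := Cmod_ge_0 (a * u)); lra).
    set (f := fun l => jackson q (a * e / u) (a * u * e) (a ^ 2) (c * eb / q ^ l) / Pi (c * eb / q ^ l)).
    destruct (finite_bound f rho j Hr0) as [M' [HM' HMf]].
    assert (Hri : (0 < rho ^ S i)%R) by pos.
    assert (Hrj : (0 < rho ^ j)%R) by pos.
    assert (Hpos : (0 < M * (rho ^ S i / rho ^ j))%R).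
    { apply Rmult_lt_0_compat; [exact HM|]. pos. }
    exists (M' + M * (rho ^ S i / rho ^ j))%R. split; [lra|]. intros l.
    assert (Hl0 : (0 < rho ^ l)%R) by pos.
    rewrite Rmult_plus_distr_r.
    assert (0 < M' * rho ^ l)%R by pos.
    assert (0 < M * (rho ^ S i / rho ^ j) * rho ^ l)%R by pos.
    destruct (Nat.lt_ge_cases l j) as [Hl|Hl].
    + specialize (HMf l Hl). unfold f in HMf. lra.
    + assert (E : c * eb / q ^ l = z0 / q ^ (l - j + S i)).
      { unfold z0. replace (q ^ l) with (q ^ j * q ^ (l - j)) by (rewrite <- Cpow_add_r; f_equal; lia).
        rewrite Cpow_add_r. field. repeat split; apply Hq. }
      specialize (HMn (l - j + S i)%nat). rewrite <- E in HMn.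
      assert (Hrl : qregular q (c * eb / q ^ l)).
      { specialize (Hreg O l). simpl in Hreg. rewrite Cmult_1_r in Hreg. exact Hreg. }
      specialize (HMn Hrl).
      replace (M * (rho ^ S i / rho ^ j) * rho ^ l)%R with (M * rho ^ (l - j + S i))%R; [lra|].
      rewrite pow_add. replace (rho ^ l)%R with (rho ^ (l - j) * rho ^ j)%R.
      * field. lra.
      * rewrite <- pow_add. f_equal. lia.
Qed.

End Main.

(** * The identity of power series *)

Section Identity.
Context {q : C} (hq : (0 < Cmod q < 1)%R).
Local Notation P := (qpoch q).
Local Notation Pi := (qpoch_inf q).
Local Notation r := (Cmod q).
Local Notation tri := (qtri q).
Local Notation shf := (qshift q).

Lemma qpoch_inf_has_ps (X Y : R) :
  (0 <= X)%R -> (0 <= Y)%R ->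
  exists M, (0 < M)%R /\ forall x, (Cmod x <= X)%R -> has_power_series Y M (fun y => Pi (x * y)).
Proof.
  intros HX HY. destruct (qpoch_inv_bounded hq q (q_regular hq)) as [M [HM HMk]].
  destruct (qtri_geometric_bounded hq (X * Y)%R) as [N [HN HNn]].
  { nonneg. }
  exists (M * N)%R. split; [pos|]. intros x Hx.
  exists (fun k => (- (1)) ^ k * tri k / P q k * x ^ k). split.
  - intros n. apply Rle_trans with (rsum (fun k => M * ((X * Y) ^ k * Cmod (tri k)))%R n).
    + apply rsum_le. intros k _. unfold Cdiv. rewrite !Cmod_mult, (Cmod_sign k), (Cmod_pow x), Rpow_mult_distr.
      replace (M * (X ^ k * Y ^ k * Cmod (tri k)))%R with (Cmod (tri k) * M * X ^ k * Y ^ k)%R by ring.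
      apply Rmult_le_compat_r; [nonneg|]. rewrite Rmult_1_l.
      apply Rmult_le_compat.
      * nonneg.
      * nonneg.
      * apply Rmult_le_compat_l; [apply Cmod_ge_0|apply HMk].
      * apply rpow_le. split; [apply Cmod_ge_0|exact Hx].
    + rewrite rsum_scal. apply Rmult_le_compat_l; [lra|apply HNn].
  - intros y _. assert (H := euler_series hq (x * y)). revert H. apply is_Cseries_ext.
    intros k. rewrite Cpow_mult_l. ring.
Qed.

Lemma qshift_has_ps (c : C) (Y : R) (k : nat) :
  (0 < Y)%R -> has_power_series Y (Y ^ k * qbound q (Cmod c / Y)) (fun y => shf y c k).
Proof.
  intros HY. assert (Hc := Cmod_ge_0 c).
  assert (Hy : (0 <= Cmod c / Y)%R) by (apply Rdiv_le_0_compat; assumption).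
  apply has_ps_le with (Y ^ k * exp (Cmod c / Y * rsum (fun k => r ^ k)%R k))%R.
  { apply Rmult_le_compat_l; [nonneg|]. apply (exp_geometric_le hq), Hy. }
  induction k as [|k IH].
  - apply has_ps_le with (Cmod 1); [|exact (has_ps_const Y 1)].
    simpl. rewrite Cmod_1, Rmult_0_r, exp_0. lra.
  - apply has_ps_le with (Y ^ k * exp (Cmod c / Y * rsum (fun k => r ^ k)%R k) * (Y + Cmod (- (c * q ^ k))))%R.
    + assert (Ee : exp (Cmod c / Y * rsum (fun k => r ^ k)%R (S k)) =
        (exp (Cmod c / Y * rsum (fun k => r ^ k)%R k) * exp (Cmod c / Y * r ^ k))%R).
      { rewrite <- exp_plus. f_equal. simpl. ring. }
      rewrite Ee, Cmod_opp, Cmod_mult, Cmod_pow.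
      replace (Y ^ S k * (exp (Cmod c / Y * rsum (fun k => r ^ k)%R k) * exp (Cmod c / Y * r ^ k)))%R
        with (Y ^ k * exp (Cmod c / Y * rsum (fun k => r ^ k)%R k) * (Y * exp (Cmod c / Y * r ^ k)))%R by (simpl; ring).
      apply Rmult_le_compat_l.
      * apply Rmult_le_pos; [nonneg|left; apply exp_pos].
      * apply Rle_trans with (Y * (1 + Cmod c / Y * r ^ k))%R.
        -- apply Req_le. field. lra.
        -- apply Rmult_le_compat_l; [lra|apply exp_ge].
    + apply (has_ps_mult Y _ _ (fun y => shf y c k) (fun y => y - c * q ^ k)); [lra|exact IH|].
      apply has_ps_ext with (fun y => y + - (c * q ^ k)); [intros; ring|].
      apply has_ps_plus; [lra|apply has_ps_id; lra|apply has_ps_const].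
Qed.

(* [e] is [e^(i psi)] and [eb] its inverse, [tau] is [1/t]; the variable [y] is
   [b t]. With [alpha], [s], [beta], [x] and [w] the very-well-poised series is
   the one in [watson]. *)
Context (a c u e eb tau : C).
Local Notation A1 := (a * e / u).
Local Notation B1 := (a * u * e).
Local Notation s := (a ^ 2).
Local Notation Z := (c * eb).
Local Notation beta := (c * e).
Local Notation alpha := (a ^ 2 * c * e / q).
Local Notation x := (a * c / u).
Local Notation w := (a * c * u).

Context (Hee : e * eb = 1) (He1 : Cmod e = 1%R) (Heb1 : Cmod eb = 1%R).
Context (Ha0 : a <> 0) (Hc0 : c <> 0) (Hu0 : u <> 0) (Hta0 : tau <> 0) (Hta1 : (Cmod tau < 1)%R).
Context (HZq : ~ in_qZ q 1 Z) (Hs : qregular q s) (Hw : qregular q w)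
  (Hbt : qregular q (beta * tau)) (Hal : qregular q (a ^ 2 * c * e)) (Hal1 : alpha <> 1).

(** The second factor of the bilateral series, continued; its grid is [Z q^n]. *)
Definition phi2 (z : C) : C := jackson q A1 B1 s z / Pi z.

(* the growth that a spectral value of [u] guarantees *)
Context (Hgrow : forall rho, (Cmod (a * u) < rho)%R ->
  exists M, (0 < M)%R /\ forall l, (Cmod (phi2 (Z / q ^ l)) <= M * rho ^ l)%R).

Lemma e_neq0 : e <> 0.
Proof. apply Cmod_gt_0. lra. Qed.

Lemma eb_neq0 : eb <> 0.
Proof. apply Cmod_gt_0. lra. Qed.

Lemma Z_neq0 : Z <> 0.
Proof. apply Cmult_neq_0; [exact Hc0|apply eb_neq0]. Qed.

Lemma Z_grid_regular (i j : nat) : qregular q (Z * q ^ i / q ^ j).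
Proof. exact (proj1 (not_in_qZ_regular hq _ i j HZq Z_neq0)). Qed.

Lemma Z_regular : qregular q Z.
Proof.
  assert (H := Z_grid_regular 0 0). simpl in H.
  replace (Z * 1 / 1) with Z in H by field. exact H.
Qed.

Definition col_term (l m : nat) : C := P beta m / P q m * tau ^ m * phi2 (Z * q ^ m / q ^ l).

Definition row_coef (l : nat) : C := shf eb (q / c) l / P q l.

(** For [m <= l] the argument is a point of the outward grid, where the growth
    hypothesis applies. For [m >= l] the values stay bounded, and
    [rho^l max(1, 1/rho)^m >= 1]. *)
Lemma phi2_grid_bound (rho : R) :
  (Cmod (a * u) < rho)%R ->
  exists M, (0 < M)%R /\ forall l m,
    (Cmod (phi2 (Z * q ^ m / q ^ l)) <= M * rho ^ l * Rmax 1 (/ rho) ^ m)%R.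
Proof.
  intros Hrho. assert (Hr0 : (0 < rho)%R) by (assert (H := Cmod_ge_0 (a * u)); lra).
  destruct (Hgrow rho Hrho) as [M [HM HMl]].
  destruct (jackson_bounded_at_0 hq A1 B1 s Z Hs Z_regular) as [M' [HM' HMm0]].
  assert (HMm : forall m, (Cmod (phi2 (Z * q ^ m)) <= M')%R) by (unfold phi2; exact HMm0).
  assert (Hir : (0 < / rho)%R) by (apply Rinv_0_lt_compat, Hr0).
  set (ka := Rmax 1 (/ rho)). assert (Hk1 : (1 <= ka)%R) by apply Rmax_l.
  assert (Hk2 : (/ rho <= ka)%R) by apply Rmax_r.
  assert (Hq := qpow_neq0 hq).
  exists (M + M')%R. split; [lra|]. intros l m.
  assert (Hrl : (0 < rho ^ l)%R) by pos.
  assert (Hkm : (0 < ka ^ m)%R) by pos.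
  assert (Hprod : (0 < rho ^ l * ka ^ m)%R) by pos.
  destruct (Nat.le_ge_cases m l) as [Hml|Hml].
  - replace (Z * q ^ m / q ^ l) with (Z / q ^ (l - m)).
    2:{ replace (q ^ l) with (q ^ m * q ^ (l - m)) by (rewrite <- Cpow_add_r; f_equal; lia).
        field. auto. }
    apply Rle_trans with (1 := HMl _).
    assert (E : (rho ^ (l - m) = rho ^ l * (/ rho) ^ m)%R).
    { replace (rho ^ l)%R with (rho ^ (l - m) * rho ^ m)%R by (rewrite <- pow_add; f_equal; lia).
      rewrite pow_inv. field. apply pow_nonzero. lra. }
    assert (H1 : (rho ^ (l - m) <= rho ^ l * ka ^ m)%R).
    { rewrite E. apply Rmult_le_compat_l; [lra|]. apply rpow_le. lra. }
    apply Rle_trans with (M * (rho ^ l * ka ^ m))%R; [apply Rmult_le_compat_l; lra|].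
    assert (0 < M' * (rho ^ l * ka ^ m))%R by pos. lra.
  - replace (Z * q ^ m / q ^ l) with (Z * q ^ (m - l)).
    2:{ replace (q ^ m) with (q ^ l * q ^ (m - l)) by (rewrite <- Cpow_add_r; f_equal; lia).
        field. auto. }
    apply Rle_trans with (1 := HMm _).
    assert (H1 : (1 <= rho ^ l * ka ^ m)%R).
    { apply Rle_trans with (rho ^ l * ka ^ l)%R.
      - rewrite <- Rpow_mult_distr. apply pow_R1_Rle.
        apply Rle_trans with (rho * / rho)%R; [rewrite Rinv_r; lra|apply Rmult_le_compat_l; lra].
      - apply Rmult_le_compat_l; [lra|]. apply Rle_pow; assumption. }
    assert (0 < M * (rho ^ l * ka ^ m))%R by pos.
    assert (M' * 1 <= M' * (rho ^ l * ka ^ m))%R by (apply Rmult_le_compat_l; lra). lra.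
Qed.

(** For [rho] between [max(|a u|, |tau|)] and [1/Y] both geometric ratios,
    [Y rho] and [|tau| max(1, 1/rho)], are less than [1]. *)
Lemma double_bound (Y : R) :
  (0 < Y)%R -> (Cmod (a * u) * Y < 1)%R -> (Cmod tau * Y < 1)%R ->
  exists M rho W, (0 < M)%R /\ (0 < rho)%R /\ (Y * rho < 1)%R /\ (0 <= W < 1)%R /\
    (forall l, (Cmod (row_coef l) <= M)%R) /\
    forall l m, (Cmod (col_term l m) <= M * rho ^ l * W ^ m)%R.
Proof.
  intros HY H1 H2. set (mx := Rmax (Cmod (a * u)) (Cmod tau)).
  assert (Hm1 : (Cmod (a * u) <= mx)%R) by apply Rmax_l. assert (Hm2 : (Cmod tau <= mx)%R) by apply Rmax_r.
  assert (HmY : (mx * Y < 1)%R).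
  { unfold mx. apply Rmax_case; assumption. }
  assert (HmY' : (mx < / Y)%R).
  { apply Rmult_lt_reg_r with Y; [exact HY|]. rewrite Rinv_l by lra. exact HmY. }
  set (rho := ((mx + / Y) / 2)%R).
  assert (Hta' := Cmod_ge_0 tau).
  destruct (phi2_grid_bound rho ltac:(unfold rho; lra)) as [M1 [HM1 HM1k]].
  destruct (ratio_bounded hq beta q (q_regular hq)) as [M2 [HM2 HM2k]].
  destruct (qshift_ratio_bound hq eb (q / c) 1 Rlt_0_1 ltac:(lra)) as [M3 [HM3 HM3k]].
  assert (Hrho : (0 < rho)%R) by (unfold rho; lra).
  assert (HM12 : (0 < M2 * M1)%R) by pos.
  exists (M3 + M2 * M1)%R, rho, (Cmod tau * Rmax 1 (/ rho))%R.
  split; [lra|]. split; [exact Hrho|]. split.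
  { unfold rho. replace (Y * ((mx + / Y) / 2))%R with ((mx * Y + 1) / 2)%R by (field; lra). lra. }
  split.
  { split; [apply Rmult_le_pos; [exact Hta'|]; apply Rle_trans with 1%R; [lra|apply Rmax_l]|].
    apply Rmax_case; [lra|]. apply Rmult_lt_reg_r with rho; [exact Hrho|].
    rewrite Rmult_assoc, Rinv_l by lra. unfold rho. lra. }
  split.
  { intros l. assert (H := HM3k l). rewrite pow1 in H. unfold row_coef. lra. }
  intros l m. unfold col_term. rewrite !Cmod_mult, Cmod_pow, Rpow_mult_distr.
  set (ka := Rmax 1 (/ rho)).
  assert (Hk1 : (1 <= ka)%R) by apply Rmax_l. assert (Hkm : (0 < ka ^ m)%R) by pos.
  assert (Hrl : (0 < rho ^ l)%R) by pos.
  assert (Htm := rpow_nonneg _ m Hta').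
  apply Rle_trans with (M2 * Cmod tau ^ m * (M1 * rho ^ l * ka ^ m))%R.
  - apply Rmult_le_compat.
    + nonneg.
    + apply Cmod_ge_0.
    + apply Rmult_le_compat_r; [exact Htm|apply HM2k].
    + apply HM1k.
  - replace (M2 * Cmod tau ^ m * (M1 * rho ^ l * ka ^ m))%R with (M2 * M1 * (rho ^ l * (Cmod tau ^ m * ka ^ m)))%R by ring.
    replace ((M3 + M2 * M1) * rho ^ l * (Cmod tau ^ m * ka ^ m))%R with ((M3 + M2 * M1) * (rho ^ l * (Cmod tau ^ m * ka ^ m)))%R by ring.
    apply Rmult_le_compat_r; [|lra].
    nonneg.
Qed.

Definition double_term (y : C) (l m : nat) : C := row_coef l * y ^ l * col_term l m.

Lemma double_term_bound (y : C) :
  y <> 0 -> (Cmod (a * u) * Cmod y < 1)%R -> (Cmod tau * Cmod y < 1)%R ->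
  exists K X W, (0 <= K)%R /\ (0 <= X < 1)%R /\ (0 <= W < 1)%R /\
    forall l m, (Cmod (double_term y l m) <= K * X ^ l * W ^ m)%R.
Proof.
  intros Hy H1 H2. assert (Hy0 : (0 < Cmod y)%R) by (apply Cmod_gt_0, Hy).
  destruct (double_bound (Cmod y) Hy0 H1 H2) as (M & rho & W & HM & Hrho & HYr & HW & Hp & Hc).
  exists (M * M)%R, (Cmod y * rho)%R, W.
  split; [nonneg|]. split; [split; [nonneg|exact HYr]|].
  split; [exact HW|]. intros l m. unfold double_term. rewrite !Cmod_mult, Cmod_pow, Rpow_mult_distr.
  replace (M * M * (Cmod y ^ l * rho ^ l) * W ^ m)%R with (M * Cmod y ^ l * (M * rho ^ l * W ^ m))%R by ring.
  assert (Hyl := rpow_nonneg _ l (Cmod_ge_0 y)).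
  apply Rmult_le_compat; [nonneg|apply Cmod_ge_0| |apply Hc].
  apply Rmult_le_compat_r; [exact Hyl|apply Hp].
Qed.

(** Up to a constant factor, the bilateral series as a function of [y = b t] with
    [tau] held fixed; [b] no longer occurs. *)
Definition double_sum (y : C) : C := Cseries (fun l => Cseries (double_term y l)).

Lemma double_sum_has_ps (Y : R) :
  (0 < Y)%R -> (Cmod (a * u) * Y < 1)%R -> (Cmod tau * Y < 1)%R ->
  exists M, has_power_series Y M double_sum.
Proof.
  intros HY H1 H2.
  destruct (double_bound Y HY H1 H2) as (M & rho & W & HM & Hrho & HYr & HW & Hp & Hc).
  assert (HiW : (0 < / (1 - W))%R) by (apply Rinv_0_lt_compat; lra).
  assert (Hcol : forall l, abs_le (col_term l) (M * rho ^ l * / (1 - W))).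
  { intros l. apply abs_le_dom with (fun m => M * rho ^ l * W ^ m)%R; [apply Hc|].
    intros n. rewrite rsum_scal. apply Rmult_le_compat_l; [|apply geometric_le, HW].
    nonneg. }
  exists (M * M * / (1 - W) * / (1 - Y * rho))%R.
  exists (fun l => row_coef l * Cseries (col_term l)).
  assert (Hbnd : forall n, (rsum (fun l => Cmod (row_coef l * Cseries (col_term l)) * Y ^ l)%R n <= M * M * / (1 - W) * / (1 - Y * rho))%R).
  { intros n. apply Rle_trans with (rsum (fun l => M * M * / (1 - W) * (Y * rho) ^ l)%R n).
    - apply rsum_le. intros l _. rewrite Cmod_mult, Rpow_mult_distr.
      destruct (abs_le_series _ _ (Hcol l)) as [v [Hv Hvb]]. rewrite (Cseries_eq _ _ Hv).
      replace (M * M * / (1 - W) * (Y ^ l * rho ^ l))%R with (M * (M * rho ^ l * / (1 - W)) * Y ^ l)%R by ring.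
      apply Rmult_le_compat_r; [nonneg|].
      apply Rmult_le_compat; try apply Cmod_ge_0; [apply Hp|exact Hvb].
    - rewrite rsum_scal. apply Rmult_le_compat_l.
      + nonneg.
      + apply geometric_le. split; [nonneg|exact HYr]. }
  split; [exact Hbnd|]. intros y Hy.
  assert (E : forall l, Cseries (double_term y l) = row_coef l * Cseries (col_term l) * y ^ l).
  { intros l. apply Cseries_eq.
    replace (row_coef l * Cseries (col_term l) * y ^ l) with (row_coef l * y ^ l * Cseries (col_term l)) by ring.
    apply is_Cseries_scal. apply (abs_le_is_series _ _ (Hcol l)). }
  assert (Hser := abs_le_is_series _ _ (coef_abs_le _ _ _ y Hbnd Hy)).
  assert (H : is_Cseries (fun l => Cseries (double_term y l))
    (Cseries (fun k => row_coef k * Cseries (col_term k) * y ^ k))).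
  { revert Hser. apply is_Cseries_ext. intros l. symmetry. apply E. }
  unfold double_sum. rewrite (Cseries_eq _ _ H). exact Hser.
Qed.

(** Together with [vwp_factor], the k-th term of the 8W7 and of the infinite
    products before it. The products are taken from [q^k] on, instead of being
    divided by shifted factorials, so that [a c/u = q^(-j)] is included and every
    term is a power series in [y]. *)
Definition vwp_coef (k : nat) : C :=
  (1 - alpha * q ^ (2 * k)) / (1 - alpha) * (P alpha k * P B1 k * P A1 k * P beta k) /
  (P q k * P w k * P s k) * Pi (x * q ^ k) * Pi (beta * tau * q ^ k) * shf tau s k * eb ^ k.

Definition vwp_factor (k : nat) (y : C) : C :=
  Pi (a ^ 2 * e * q ^ k * y) * Pi (q / c * y) * shf y c k.

Definition vwp_sum (y : C) : C := Cseries (fun k => vwp_coef k * vwp_factor k y).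

Lemma one_minus_alpha_neq0 : 1 - alpha <> 0.
Proof. intros E. apply Hal1. replace alpha with (1 - (1 - alpha)) by ring. rewrite E. ring. Qed.

Lemma Cmod_qpow_le (z : C) (k : nat) : (Cmod (z * q ^ k) <= Cmod z)%R.
Proof.
  rewrite Cmod_mult, Cmod_pow. rewrite <- (Rmult_1_r (Cmod z)) at 2.
  apply Rmult_le_compat_l; [apply Cmod_ge_0|apply (qpow_lt1 hq)].
Qed.

Lemma vwp_coef_bound :
  exists M, (0 < M)%R /\ forall k, (Cmod (vwp_coef k) <= M * Cmod tau ^ k)%R.
Proof.
  assert (Hta' : (0 < Cmod tau)%R) by (apply Cmod_gt_0, Hta0).
  destruct (ratio_bounded hq alpha q (q_regular hq)) as [M1 [HM1 HM1k]].
  destruct (ratio_bounded hq B1 w Hw) as [M2 [HM2 HM2k]].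
  destruct (ratio_bounded hq A1 s Hs) as [M3 [HM3 HM3k]].
  set (M0 := ((1 + Cmod alpha) * Cmod (/ (1 - alpha)))%R).
  set (M4 := qbound q (Cmod beta)). set (M5 := qbound q (Cmod x)). set (M6 := qbound q (Cmod (beta * tau))).
  set (M7 := qbound q (Cmod s / Cmod tau)).
  assert (HM0 : (0 < M0)%R).
  { apply Rmult_lt_0_compat; [assert (H := Cmod_ge_0 alpha); lra|]. rewrite Cmod_inv by apply one_minus_alpha_neq0.
    apply Rinv_0_lt_compat, Cmod_gt_0, one_minus_alpha_neq0. }
  exists (M0 * M1 * M2 * M3 * M4 * M5 * M6 * M7)%R. split.
  { do 7 (apply Rmult_lt_0_compat; [|assumption || apply qbound_pos]). exact HM0. }
  intros k.
  replace (vwp_coef k) with (((1 - alpha * q ^ (2 * k)) / (1 - alpha)) * (P alpha k / P q k) * (P B1 k / P w k) * (P A1 k / P s k) *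
     P beta k * Pi (x * q ^ k) * Pi (beta * tau * q ^ k) * shf tau s k * eb ^ k).
  2:{ unfold vwp_coef, Cdiv.
      rewrite !Cinv_product. ring. }
  rewrite !Cmod_mult, (Cmod_pow eb), Heb1, pow1, Rmult_1_r.
  replace (M0 * M1 * M2 * M3 * M4 * M5 * M6 * M7 * Cmod tau ^ k)%R
    with (M0 * M1 * M2 * M3 * M4 * M5 * M6 * (Cmod tau ^ k * M7))%R by ring.
  assert (B0 : (Cmod ((1 - alpha * q ^ (2 * k)) / (1 - alpha)) <= M0)%R).
  { unfold Cdiv at 1. rewrite Cmod_mult. apply Rmult_le_compat_r; [apply Cmod_ge_0|].
    unfold Cminus at 1. apply Rle_trans with (1 := Cmod_triangle _ _). rewrite Cmod_opp, Cmod_1.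
    assert (H := Cmod_qpow_le alpha (2 * k)). lra. }
  repeat match goal with |- (_ * _ <= _ * _)%R =>
    apply Rmult_le_compat; [nonneg|apply Cmod_ge_0| |] end; auto.
  - apply (qpoch_bound hq).
  - apply (qpoch_inf_bound hq), Cmod_qpow_le.
  - apply (qpoch_inf_bound hq), Cmod_qpow_le.
  - apply (qshift_bound hq); lra.
Qed.

Lemma vwp_sum_has_ps (Y : R) :
  (0 < Y)%R -> (Cmod tau * Y < 1)%R ->
  exists M, has_power_series Y M vwp_sum /\
    forall y, (Cmod y <= Y)%R -> abs_le (fun k => vwp_coef k * vwp_factor k y) M.
Proof.
  intros HY HtY. destruct vwp_coef_bound as [M1 [HM1 HM1k]].
  destruct (qpoch_inf_has_ps (Cmod (a ^ 2 * e)) Y (Cmod_ge_0 _) (Rlt_le _ _ HY)) as [M2 [HM2 HM2k]].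
  destruct (qpoch_inf_has_ps (Cmod (q / c)) Y (Cmod_ge_0 _) (Rlt_le _ _ HY)) as [M3 [HM3 HM3k]].
  set (M4 := qbound q (Cmod c / Y)). assert (HM4 : (0 < M4)%R) by apply qbound_pos.
  assert (Hta' := Cmod_ge_0 tau).
  set (K := (M1 * M2 * M3 * M4)%R).
  assert (HK : (0 < K)%R) by (unfold K; pos).
  exists (K * / (1 - Cmod tau * Y))%R.
  apply (has_ps_sum Y _ (fun k y => vwp_coef k * vwp_factor k y) (fun k => K * (Cmod tau * Y) ^ k)%R HY).
  - intros k. apply has_ps_le with (Cmod (vwp_coef k) * (M2 * M3 * (Y ^ k * M4)))%R.
    + rewrite Rpow_mult_distr. unfold K.
      replace (M1 * M2 * M3 * M4 * (Cmod tau ^ k * Y ^ k))%R with (M1 * Cmod tau ^ k * (M2 * M3 * (Y ^ k * M4)))%R by ring.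
      apply Rmult_le_compat_r; [|apply HM1k].
      assert (H := pow_lt Y k HY).
      nonneg.
    + apply has_ps_scal. unfold vwp_factor.
      apply (has_ps_mult Y (M2 * M3) (Y ^ k * M4) (fun y => Pi (a ^ 2 * e * q ^ k * y) * Pi (q / c * y)) (fun y => shf y c k));
        [lra| |apply qshift_has_ps, HY].
      apply (has_ps_mult Y M2 M3 (fun y => Pi (a ^ 2 * e * q ^ k * y)) (fun y => Pi (q / c * y))); [lra| |].
      * apply HM2k, Cmod_qpow_le.
      * apply HM3k. lra.
  - intros n. rewrite rsum_scal. apply Rmult_le_compat_l; [lra|].
    apply geometric_le. split; [nonneg|exact HtY].
Qed.

(** What remains of the prefactor of the 8W7 without the factors of
    [laurent_const], those that contain [y], and those absorbed into [vwp_coef]. *)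
Definition vwp_const : C := Pi w / (Pi Z * Pi (a ^ 2 * c * e) * Pi tau).

Definition gauss_coef (i : nat) : C := P A1 i * P B1 i / (P q i * P s i).

Lemma gauss_coef_bound :
  exists M, (0 < M)%R /\ forall i, (Cmod (gauss_coef i) <= M)%R.
Proof.
  destruct (ratio_bounded hq A1 q (q_regular hq)) as [M1 [HM1 HM1k]].
  destruct (ratio_bounded hq B1 s Hs) as [M2 [HM2 HM2k]].
  exists (M1 * M2)%R. split; [pos|]. intros i.
  replace (gauss_coef i) with ((P A1 i / P q i) * (P B1 i / P s i)).
  - rewrite Cmod_mult. apply Rmult_le_compat; try apply Cmod_ge_0; auto.
  - unfold gauss_coef. assert (H1 := qpoch_q_neq0 hq i). assert (H2 := qpoch_neq0 s i Hs). field. auto.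
Qed.

(** At [y = c q^j] the row coefficient and [1/(Z q^(-l);q)_oo] combine to the
    coefficient [(-1)^l q^(l (l + 1) / 2) / (q;q)_l] of an Euler series, so the sum
    over [l] is a [terminating_sum], for the entire numerator of [phi2 (q^m z)]. *)
Lemma column_sum :
  exists J, forall j m, (J <= j)%nat ->
    is_Cseries (fun l => double_term (c * q ^ j) l m)
      (P beta m / P q m * tau ^ m * (Pi q / Pi Z) *
        csum (fun i => gauss_coef i * (q ^ m) ^ i * Z ^ i * (P Z (j - i) / P q (j - i))) (S j)).
Proof.
  destruct (jackson_entire hq A1 B1 s Hs) as (sg & e0 & Hsg & He0 & Hf0).
  assert (Hent : entire_with (q := q) sg (jackson q A1 B1 s)) by (exists e0; split; assumption).
  assert (HZ0 := Cmod_ge_0 Z). assert (Hden : (0 < 4 * (sg * Cmod Z + 1))%R) by nra.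
  destruct (pow_lt_1_zero r) with (y := (/ (4 * (sg * Cmod Z + 1)))%R) as [J HJ].
  { rewrite Rabs_pos_eq; lra. }
  { apply Rinv_0_lt_compat, Hden. }
  exists J. intros j m Hj. specialize (HJ j Hj).
  rewrite Rabs_pos_eq in HJ by nonneg.
  assert (HZj : (sg * Cmod Z * r ^ j <= / 4)%R).
  { assert (H0 : (0 <= sg * Cmod Z)%R) by nra.
    apply Rle_trans with (sg * Cmod Z * / (4 * (sg * Cmod Z + 1)))%R.
    - apply Rmult_le_compat_l; lra.
    - apply Rmult_le_reg_r with (4 * (sg * Cmod Z + 1))%R; [exact Hden|].
      rewrite Rmult_assoc, Rinv_l by lra. lra. }
  destruct gauss_coef_bound as [M [HM HMi]].
  set (f := fun z => P z m * jackson q A1 B1 s (z * q ^ m)).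
  assert (Hf : entire_with (q := q) sg f) by exact (entire_with_iter hq sg _ m Hsg Hent).
  assert (HPq := qpoch_q_neq0 hq). assert (Hq := qpow_neq0 hq).
  assert (Hqm : (Cmod (q ^ m) <= 1)%R) by (rewrite Cmod_pow; apply (qpow_lt1 hq)).
  assert (Hc : forall n, (rsum (fun k => Cmod (gauss_coef k * (q ^ m) ^ k) * (/ 2) ^ k)%R n <= M * / (1 - / 2))%R).
  { intros n. apply Rle_trans with (rsum (fun k => M * (/ 2) ^ k)%R n).
    - apply rsum_le. intros k _. apply Rmult_le_compat_r; [nonneg|].
      rewrite Cmod_mult, Cmod_pow. rewrite <- (Rmult_1_r M).
      apply Rmult_le_compat; [apply Cmod_ge_0|nonneg|apply HMi|].
      rewrite <- (pow1 k). apply rpow_le. split; [apply Cmod_ge_0|exact Hqm].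
    - rewrite rsum_scal. apply Rmult_le_compat_l; [lra|apply geometric_le; lra]. }
  assert (Hcs : forall z, (Cmod z <= / 2)%R ->
     is_Cseries (fun k => gauss_coef k * (q ^ m) ^ k * z ^ k) (f z / Pi z)).
  { intros z Hz. assert (Hzm := Cmod_qpow_le z m).
    assert (HJ2 := jackson_transformation hq A1 B1 s (z * q ^ m) Hs ltac:(lra)).
    assert (Hreg : qregular q z) by (apply (small_qregular hq); lra).
    assert (H1 := qpoch_neq0 z m Hreg).
    assert (H2 : Pi (z * q ^ m) <> 0) by (apply (qpoch_inf_neq0 hq), qregular_shift, Hreg).
    replace (f z / Pi z) with (jackson q A1 B1 s (z * q ^ m) / Pi (z * q ^ m)).
    2:{ unfold f. rewrite (qpoch_inf_split hq z m). field. auto. }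
    revert HJ2. apply is_Cseries_ext. intros k. rewrite phi21_term_eq, Cpow_mult_l.
    unfold gauss_coef. ring. }
  assert (Hsum := terminating_sum hq sg _ f _ Z j Hsg Hf Hc Hcs HZj).
  apply (is_Cseries_scal (P beta m / P q m * tau ^ m / Pi Z)) in Hsum.
  assert (HPZ := qpoch_inf_neq0 hq Z Z_regular).
  match type of Hsum with is_Cseries _ ?v =>
    match goal with |- is_Cseries _ ?v' => replace v' with v end end.
  2:{ field. auto. }
  revert Hsum. apply is_Cseries_ext. intros l.
  unfold double_term, col_term, phi2, row_coef, f.
  replace (Z / q ^ l * q ^ m) with (Z * q ^ m / q ^ l) by (field; auto).
  assert (Hb := qpoch_inf_inverse_base hq Z l Z_neq0).
  assert (Hm := qpoch_inf_split hq (Z / q ^ l) m).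
  replace (Z / q ^ l * q ^ m) with (Z * q ^ m / q ^ l) in Hm by (field; auto).
  assert (Hrl : qregular q (Z / q ^ l)).
  { assert (H := Z_grid_regular 0 l). simpl in H. rewrite Cmult_1_r in H. exact H. }
  assert (HP3 : Pi (Z / q ^ l) <> 0) by (apply (qpoch_inf_neq0 hq), Hrl).
  assert (Eshf : shf eb (q / c) l * c ^ l = Z ^ l * P (q / Z) l).
  { rewrite <- (qshift_qpoch Z q l Z_neq0), (Cmult_comm (shf _ _ _)), <- qshift_scale. f_equal.
    field. exact Hc0. }
  rewrite (Cpow_mult_l c).
  (* [(Z q^(-l);q)_oo] on both sides is traded for [(q/Z;q)_l] *)
  assert (Esgn : (- Z) ^ l = (- (1)) ^ l * Z ^ l).
  { rewrite <- Cpow_mult_l. f_equal. ring. }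
  assert (Hsg2 : (- (1)) ^ l * (- (1)) ^ l = 1).
  { rewrite <- Cpow_mult_l. replace (- (1) * - (1)) with (RtoC 1) by ring. apply Cpow_1_l. }
  rewrite Esgn in Hb.
  assert (Ekey : shf eb (q / c) l * c ^ l / Pi (Z / q ^ l) = (- (1)) ^ l * tri (S l) / Pi Z).
  { rewrite Eshf.
    assert (E1 : Z ^ l * P (q / Z) l = (- (1)) ^ l * (Pi (Z / q ^ l) * tri (S l)) / Pi Z).
    { rewrite Hb. transitivity ((- (1)) ^ l * (- (1)) ^ l * (Z ^ l * P (q / Z) l)); [rewrite Hsg2; ring|].
      field. exact HPZ. }
    rewrite E1. field. auto. }
  transitivity (P beta m / P q m * tau ^ m * ((- (1)) ^ l * tri (S l) / Pi Z) * (q ^ j) ^ l / P q l *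
    (P (Z / q ^ l) m * jackson q A1 B1 s (Z * q ^ m / q ^ l))); [field; auto|].
  rewrite <- Ekey, Hm. field.
  repeat split; auto; intros E0; apply HP3; rewrite Hm, E0; ring.
Qed.

Lemma alpha_q : alpha * q = a ^ 2 * c * e.
Proof. field. apply (q_neq0 hq). Qed.

Lemma alpha_neq0 : alpha <> 0.
Proof.
  intros E. assert (H := alpha_q). rewrite E, Cmult_0_l in H. symmetry in H.
  revert H. repeat apply Cmult_neq_0; try assumption; [apply C1_nz|apply e_neq0].
Qed.

(** The terminating balanced 4phi3 in which the two sides meet at [y = c q^j],
    multiplied by a shifted factorial. *)
Definition balanced_sum (j : nat) : C :=
  csum (fun i => shf x (alpha * q) i * shf w (alpha * q) i / (alpha * q) ^ i / (P q i * P s i) *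
    (P tau i / P (beta * tau) i) * (P (x * w / (alpha * q)) (j - i) / P q (j - i))) (S j).

Lemma xw_alpha : x * w / (alpha * q) = Z.
Proof.
  rewrite alpha_q. assert (H := e_neq0). assert (Eeb : eb = / e).
  { rewrite <- (Cmult_1_l (/ e)), <- Hee. field. exact H. }
  rewrite Eeb. field. auto.
Qed.

Lemma gauss_coef_shift (i : nat) :
  gauss_coef i * Z ^ i = shf x (alpha * q) i * shf w (alpha * q) i / (alpha * q) ^ i / (P q i * P s i).
Proof.
  assert (Hx0 : x <> 0).
  { intros E. apply Z_neq0. rewrite <- xw_alpha, E. unfold Cdiv. ring. }
  assert (Hw0 : w <> 0).
  { intros E. apply Z_neq0. rewrite <- xw_alpha, E. unfold Cdiv. ring. }
  assert (Ha : alpha * q <> 0) by (apply Cmult_neq_0; [apply alpha_neq0|apply (q_neq0 hq)]).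
  rewrite (qshift_qpoch x _ i Hx0), (qshift_qpoch w _ i Hw0).
  replace (alpha * q / x) with B1 by (rewrite alpha_q; field; auto).
  replace (alpha * q / w) with A1 by (rewrite alpha_q; field; auto).
  assert (Epow : forall X W Y : C, Y <> 0 -> (X * W / Y) ^ i = X ^ i * W ^ i / Y ^ i).
  { intros X W Y HY. unfold Cdiv. rewrite !Cpow_mult_l, Cpow_inv by exact HY. reflexivity. }
  unfold gauss_coef. rewrite <- xw_alpha, Epow by exact Ha.
  assert (H1 := qpoch_q_neq0 hq i). assert (H2 := qpoch_neq0 s i Hs).
  assert (H3 : (alpha * q) ^ i <> 0) by apply Cpow_nz, Ha.
  field. auto.
Qed.

(** The sum over [l] comes first, by [column_sum]; the sum over [m] is then
    evaluated by the q-binomial theorem. *)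
Lemma double_sum_at_grid :
  exists J, forall j, (J <= j)%nat ->
    double_sum (c * q ^ j) = Pi q / Pi Z * (Pi (beta * tau) / Pi tau) * balanced_sum j.
Proof.
  destruct column_sum as [J1 HJ1].
  assert (Hc' : (0 < Cmod c)%R) by (apply Cmod_gt_0, Hc0).
  assert (Hau := Cmod_ge_0 (a * u)). assert (Htap := Cmod_ge_0 tau).
  set (X := (Cmod (a * u) + Cmod tau + 1)%R).
  destruct (pow_lt_1_zero r) with (y := (/ (X * Cmod c))%R) as [J2 HJ2].
  { rewrite Rabs_pos_eq; lra. }
  { apply Rinv_0_lt_compat, Rmult_lt_0_compat; unfold X; lra. }
  exists (J1 + J2)%nat. intros j Hj. specialize (HJ2 j ltac:(lia)).
  rewrite Rabs_pos_eq in HJ2 by nonneg.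
  assert (Hy : c * q ^ j <> 0) by (apply Cmult_neq_0; [exact Hc0|apply (qpow_neq0 hq)]).
  assert (HX : (X * Cmod (c * q ^ j) < 1)%R).
  { rewrite Cmod_mult, Cmod_pow, <- Rmult_assoc.
    assert (HXc : (0 < X * Cmod c)%R) by (apply Rmult_lt_0_compat; unfold X; lra).
    apply Rlt_le_trans with (X * Cmod c * / (X * Cmod c))%R; [apply Rmult_lt_compat_l; assumption|].
    rewrite Rinv_r; lra. }
  assert (Hyp := Cmod_ge_0 (c * q ^ j)).
  assert (B1' : (Cmod (a * u) * Cmod (c * q ^ j) < 1)%R).
  { apply Rle_lt_trans with (2 := HX). apply Rmult_le_compat_r; unfold X; lra. }
  assert (B2' : (Cmod tau * Cmod (c * q ^ j) < 1)%R).
  { apply Rle_lt_trans with (2 := HX). apply Rmult_le_compat_r; unfold X; lra. }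
  destruct (double_term_bound (c * q ^ j) Hy B1' B2') as (K & X' & W & HK & HX' & HW & Hbnd).
  destruct (double_series_by_difference _ K X' W HK HX' HW Hbnd) as (s1 & s2 & _ & _ & D1 & D2 & _ & _).
  unfold double_sum. rewrite (Cseries_eq _ _ D1). refine (is_Cseries_unique _ _ _ D2 _).
  clear D1 D2.
  apply is_Cseries_ext with (fun m => csum (fun i => (Pi q / Pi Z) * (gauss_coef i * Z ^ i * (P Z (j - i) / P q (j - i))) *
     (P beta m / P q m * (tau * q ^ i) ^ m)) (S j)).
  - intros m. symmetry. rewrite (Cseries_eq _ _ (HJ1 j m ltac:(lia))).
    rewrite <- csum_scal. apply csum_ext. intros i _.
    rewrite (Cpow_mult_l tau), <- (Cpow_mult_r q i m), <- (Cpow_mult_r q m i), (Nat.mul_comm i m). ring.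
  -
    replace (Pi q / Pi Z * (Pi (beta * tau) / Pi tau) * balanced_sum j) with
      (csum (fun i => (Pi q / Pi Z) * (gauss_coef i * Z ^ i * (P Z (j - i) / P q (j - i))) *
         (Pi (tau * q ^ i * beta) / Pi (tau * q ^ i * 1))) (S j)).
    + apply is_Cseries_csum_swap. intros i _. apply is_Cseries_scal.
      assert (Hti : (Cmod (tau * q ^ i * 1) < 1)%R).
      { rewrite Cmult_1_r. assert (H := Cmod_qpow_le tau i). lra. }
      assert (H := qbinomial_at hq 1 beta (tau * q ^ i) Hti). revert H. apply is_Cseries_ext.
      intros m. rewrite qshift_1. reflexivity.
    + unfold balanced_sum. rewrite <- csum_scal. apply csum_ext. intros i _.
      rewrite gauss_coef_shift, xw_alpha, Cmult_1_r.
      assert (E1 := qpoch_inf_split hq tau i). assert (E2 := qpoch_inf_split hq (beta * tau) i).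
      replace (tau * q ^ i * beta) with (beta * tau * q ^ i) by ring.
      assert (H1 := qpoch_neq0 tau i (small_qregular hq tau Hta1)). assert (H2 := qpoch_neq0 _ i Hbt).
      assert (H3 : Pi (tau * q ^ i) <> 0) by (apply (qpoch_inf_neq0 hq), qregular_shift, (small_qregular hq), Hta1).
      assert (HPZ := qpoch_inf_neq0 hq Z Z_regular).
      rewrite E1, E2.
      set (G := shf x (alpha * q) i * shf w (alpha * q) i / (alpha * q) ^ i / (P q i * P s i)).
      set (G2 := P Z (j - i) / P q (j - i)). field. auto.
Qed.

Lemma qshift_vanish (j k : nat) : (j < k)%nat -> shf (c * q ^ j) c k = 0.
Proof.
  intros H. replace k with (S j + (k - S j))%nat by lia. rewrite qshift_add, qshift_S. ring.
Qed.

Lemma qshift_grid (j k : nat) : (k <= j)%nat ->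
  shf (c * q ^ j) c k = c ^ k * ((- (1)) ^ k * tri k) * (P q j / P q (j - k)).
Proof.
  intros H. induction k as [|k IH].
  - rewrite Nat.sub_0_r. simpl. assert (Hj := qpoch_q_neq0 hq j). field. exact Hj.
  - rewrite qshift_S, IH by lia. replace (j - k)%nat with (S (j - S k)) by lia.
    rewrite qpoch_S, qtri_S. set (d := (j - S k)%nat).
    replace (q ^ j) with (q ^ k * (q * q ^ d)).
    2:{ change (q * q ^ d) with (q ^ S d). rewrite <- Cpow_add_r. f_equal. unfold d. lia. }
    assert (H1 := qpoch_q_neq0 hq d). assert (H2 := one_minus_qpow_neq0 hq d).
    change (q ^ S d) with (q * q ^ d) in H2. simpl. field. auto.
Qed.

(** At [y = c q^j] the factor [(c/y;q)_k] vanishes for [k > j], and the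
    terminating series is subject to [watson]. *)
Lemma vwp_sum_at_grid (j : nat) :
  vwp_const * vwp_sum (c * q ^ j) =
  Pi (w * q ^ j) * Pi (x * q ^ j) * (Pi q / Pi Z * (Pi (beta * tau) / Pi tau) * balanced_sum j).
Proof.
  assert (Hsb : alpha * q = s * beta) by (rewrite alpha_q; ring).
  assert (Hal' : qregular q (alpha * q)) by (rewrite alpha_q; exact Hal).
  unfold balanced_sum. rewrite <- (watson hq alpha s beta tau x w j alpha_neq0 Hal1 Hal' Hsb Hs Hbt).
  assert (Efin : vwp_sum (c * q ^ j) = csum (fun k => vwp_coef k * vwp_factor k (c * q ^ j)) (S j)).
  { apply Cseries_eq. apply is_Cseries_finite. intros k Hk. unfold vwp_factor.
    rewrite (qshift_vanish j k) by lia. ring. }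
  rewrite Efin, <- !csum_scal. apply csum_ext. intros k Hk.
  unfold vwp_coef, vwp_factor, vwp65_term, vwp_const.
  rewrite (qshift_grid j k) by lia.
  replace (a ^ 2 * e * q ^ k * (c * q ^ j)) with (a ^ 2 * c * e * q ^ (j + k)) by (rewrite Cpow_add_r; ring).
  replace (q / c * (c * q ^ j)) with (q * q ^ j) by (field; exact Hc0).
  assert (E1 := qpoch_inf_split hq w j).
  assert (E2 : P w j = P w k * P (w * q ^ k) (j - k)) by (rewrite <- qpoch_add; f_equal; lia).
  assert (E3 : Pi (x * q ^ k) = P (x * q ^ k) (j - k) * Pi (x * q ^ j)).
  { rewrite (qpoch_inf_split hq (x * q ^ k) (j - k)). f_equal. f_equal.
    rewrite <- Cmult_assoc, <- Cpow_add_r. f_equal. f_equal. lia. }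
  assert (E4 := qpoch_inf_split hq (beta * tau) k).
  assert (E5 := qpoch_inf_split hq (a ^ 2 * c * e) (j + k)).
  assert (E6 := qpoch_inf_split hq q j).
  rewrite E1, E2, E3, E4, E5, E6, alpha_q.
  assert (Exw : shf x (a ^ 2 * c * e) k * shf w (a ^ 2 * c * e) k / (a ^ 2 * c * e) ^ k =
     P A1 k * P B1 k * Z ^ k).
  { rewrite <- alpha_q. assert (H := gauss_coef_shift k). unfold gauss_coef in H.
    assert (H1 := qpoch_q_neq0 hq k). assert (H2 := qpoch_neq0 s k Hs).
    replace (P A1 k * P B1 k * Z ^ k) with (P A1 k * P B1 k / (P q k * P s k) * Z ^ k * (P q k * P s k)) by (field; auto).
    rewrite H. set (T := shf x (alpha * q) k * shf w (alpha * q) k / (alpha * q) ^ k). field. auto. }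
  rewrite Exw. rewrite (Cpow_mult_l c eb k).
  assert (HPZ := qpoch_inf_neq0 hq Z Z_regular).
  assert (HPta := qpoch_inf_neq0 hq tau (small_qregular hq tau Hta1)).
  assert (H1 := qpoch_q_neq0 hq k). assert (H2 := qpoch_neq0 s k Hs). assert (H3 := qpoch_neq0 w k Hw).
  assert (H4 := qpoch_neq0 _ k Hbt).  assert (H6 := qpoch_q_neq0 hq (j - k)).
  assert (H7 := qpoch_neq0 _ (j + k) Hal).
  assert (H8 : Pi (a ^ 2 * c * e * q ^ (j + k)) <> 0) by (apply (qpoch_inf_neq0 hq), qregular_shift, Hal).
  assert (H9 := one_minus_alpha_neq0).
  set (z1 := 1 - alpha) in *. set (z2 := 1 - alpha * q ^ (2 * k)).
  set (z3 := P alpha k). set (z4 := P A1 k). set (z5 := P B1 k). clearbody z1 z2 z3 z4 z5.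
  field. repeat split; auto.
Qed.

(** Both sides are power series in [y], and they agree at [y = c q^j] for all
    large [j]: a sequence of points that accumulates at the centre [0]. *)
Lemma vwp_identity (y : C) :
  y <> 0 -> (Cmod (a * u) * Cmod y < 1)%R -> (Cmod tau * Cmod y < 1)%R ->
  Pi (a * u * y) * Pi (a / u * y) * double_sum y = vwp_const * vwp_sum y.
Proof.
  intros Hy H1 H2. assert (HY : (0 < Cmod y)%R) by (apply Cmod_gt_0, Hy).
  destruct (double_sum_has_ps _ HY H1 H2) as [M1 HM1].
  destruct (vwp_sum_has_ps _ HY H2) as [M2 [HM2 _]].
  destruct (qpoch_inf_has_ps _ _ (Cmod_ge_0 (a * u)) (Rlt_le _ _ HY)) as [M3 [_ HM3]].
  destruct (qpoch_inf_has_ps _ _ (Cmod_ge_0 (a / u)) (Rlt_le _ _ HY)) as [M4 [_ HM4]].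
  assert (HL := has_ps_mult _ _ _ _ _ (Rlt_le _ _ HY)
    (has_ps_mult _ _ _ _ _ (Rlt_le _ _ HY) (HM3 _ (Rle_refl _)) (HM4 _ (Rle_refl _))) HM1).
  assert (HR := has_ps_scal _ _ (- vwp_const) _ HM2).
  destruct (has_ps_plus _ _ _ _ _ (Rlt_le _ _ HY) HL HR) as [d Hd].
  assert (Hz : forall k, d k = 0).
  { apply (power_series_identity _ _ _ _ HY Hd). intros eps Heps.
    destruct double_sum_at_grid as [J HJ].
    assert (Hc' : (0 < Cmod c)%R) by (apply Cmod_gt_0, Hc0).
    destruct (pow_lt_1_zero r) with (y := (eps / Cmod c)%R) as [J2 HJ2].
    { rewrite Rabs_pos_eq; lra. }
    { pos. }
    set (j := (J + J2)%nat). specialize (HJ2 j ltac:(unfold j; lia)).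
    rewrite Rabs_pos_eq in HJ2 by nonneg.
    exists (c * q ^ j). split.
    - rewrite Cmod_mult, Cmod_pow. split; [pos|].
      apply Rlt_le_trans with (Cmod c * (eps / Cmod c))%R; [apply Rmult_lt_compat_l; assumption|].
      apply Req_le. field. lra.
    - rewrite (HJ j ltac:(unfold j; lia)).
      replace (- vwp_const * vwp_sum (c * q ^ j)) with (- (vwp_const * vwp_sum (c * q ^ j))) by ring.
      rewrite vwp_sum_at_grid.
      replace (a * u * (c * q ^ j)) with (w * q ^ j) by ring.
      replace (a / u * (c * q ^ j)) with (x * q ^ j) by (field; exact Hu0). ring. }
  assert (H := proj2 Hd y (Rle_refl _)).
  assert (H0 : is_Cseries (fun k => d k * y ^ k) 0).
  { apply (is_Cseries_finite (fun k => d k * y ^ k) 0). intros k _. rewrite Hz. ring. }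
  assert (E := is_Cseries_unique _ _ _ H H0). cbv beta in E.
  transitivity (Pi (a * u * y) * Pi (a / u * y) * double_sum y + - vwp_const * vwp_sum y + vwp_const * vwp_sum y); [ring|].
  rewrite E. ring.
Qed.

End Identity.

Arguments phi2 q a u e z : clear implicits.
Arguments double_term q a c u e eb tau y l m : clear implicits.
Arguments double_sum q a c u e eb tau y : clear implicits.
Arguments vwp_coef q a c u e eb tau k : clear implicits.
Arguments vwp_factor q a c e k y : clear implicits.
Arguments vwp_sum q a c u e eb tau y : clear implicits.
Arguments vwp_const q a c u e eb tau : clear implicits.

(** * The bilateral sum *)

Lemma cis_mult_opp (x : R) : cis x * cis (- x) = 1.
Proof.
  unfold cis. rewrite cos_neg, sin_neg. apply injective_projections; simpl.
  - replace (cos x * cos x - sin x * - sin x)%R with (Rsqr (sin x) + Rsqr (cos x))%R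
      by (unfold Rsqr; ring). apply sin2_cos2.
  - ring.
Qed.

Lemma Cmod_cis (x : R) : Cmod (cis x) = 1%R.
Proof.
  unfold Cmod, cis. simpl.
  replace (cos x * (cos x * 1) + sin x * (sin x * 1))%R with (Rsqr (sin x) + Rsqr (cos x))%R
    by (unfold Rsqr; ring). rewrite sin2_cos2. apply sqrt_1.
Qed.

(** The 2phi1 is symmetric in its upper parameters, Jackson's form of it is not;
    the Laurent expansions need [q/z0] in the first place. *)
Lemma phi21_jackson_swap (q : R) (A B D z : C) :
  (0 < q < 1)%R -> qregular q D -> qregular q z ->
  phi21 q A B D z = jackson q B A D z / qpoch_inf q z.
Proof.
  intros Hq HD Hz. rewrite <- (phi21_jackson q B A D z Hq HD Hz).
  assert (Hs : forall A B F, phi21_continuation q A B D F -> phi21_continuation q B A D F).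
  { intros A' B' F [F1 F2]. split; [|exact F2]. intros w Hw. specialize (F1 w Hw).
    revert F1. apply is_Cseries_ext. intros k. rewrite !phi21_term_eq. unfold Cdiv. ring. }
  apply the_eq.
  - rewrite (phi21_jackson q B A D z Hq HD Hz). assert (hq := Cmod_q q Hq).
    exists (fun z => jackson q B A D z / qpoch_inf q z). split; [|reflexivity].
    apply Hs. split.
    + intros w Hw. apply (jackson_transformation hq); assumption.
    + intros w Hw. apply (jackson_ratio_analytic hq); [exact HD|].
      apply qregular_inv; [apply (q_neq0 hq)|exact Hw].
  - intros v [F [HF <-]]. apply Hs in HF. symmetry. apply the_eq.
    + exists F. split; [exact HF|reflexivity].
    + intros v' [G [HG <-]].
      apply (phi21_continuation_unique q B A D _ _ z Hq HG HF).
      apply qregular_inv'; [apply (q_neq0 (Cmod_q q Hq))|exact Hz].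
Qed.

(** If [L = 0] nothing is known about the convergence of [g], but then both sides
    vanish. *)
Lemma Cseries_factor (f g : nat -> C) (L s : C) :
  (forall k, f k = L * g k) -> is_Cseries f s -> s = L * Cseries g.
Proof.
  intros E H. destruct (Ceq_dec L 0) as [->|HL].
  - rewrite Cmult_0_l. refine (is_Cseries_unique _ _ _ H _).
    apply (is_Cseries_finite f 0). intros k _. rewrite E. ring.
  - apply (is_Cseries_scal (/ L)) in H.
    assert (H' : is_Cseries g (/ L * s)).
    { revert H. apply is_Cseries_ext. intros k. rewrite E. field. exact HL. }
    rewrite (Cseries_eq _ _ H'). field. exact HL.
Qed.

Lemma qregular_in (q : C) (l : list C) (x : C) : List.Forall (qregular q) l -> In x l -> qregular q x.
Proof. rewrite Forall_forall. auto. Qed.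

Theorem theorem4p4 (q psi : R) (a b c u t : C)
  (hq : (0 < q < 1)%R)
  (ha0 : a <> 0) (hb0 : b <> 0) (hc0 : c <> 0) (hu0 : u <> 0) (ht0 : t <> 0)
  (ha : (Cmod a <= 1)%R) (hb : (Cmod b < 1)%R) (hu : (Cmod u <= 1)%R)
  (ht : (1 < Cmod t < / Cmod (a * b * u))%R)
  (hspec : Cmod u = 1%R \/ ((Cmod u < 1)%R /\ in_qZ q (a * c) u))
  (* c e^{i psi} and c e^{-i psi} are not in q^Z *)
  (hpsi : ~ in_qZ q 1 (c * cis psi)) (hpsi' : ~ in_qZ q 1 (c * cis (- psi)))
  (* no denominator vanishes: in the 2phi1's, in the prefactor, in the 8W7,
     with the exception of a c / u *)
  (hphi : List.Forall (qregular q) [b * q / c; a ^ 2])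
  (hpref : List.Forall (qregular q)
     [c * cis psi; c * cis (- psi); a ^ 2 * c * cis psi; b * q / c; 1 / t;
      a * b * t * u; a * b * t / u])
  (hW1 : a ^ 2 * c * cis psi / q <> 1)
  (hW : List.Forall (qregular q)
     [a * c * u; a ^ 2; c * cis psi / t; a ^ 2 * b * t * cis psi]) :
  let summand (n : Z) : C :=
    phi21 q (b * cis (- psi)) (q * cis (- psi) / c) (b * q / c)
      (c * Cpowz q (- n) * cis psi) *
    phi21 q (a * cis psi / u) (a * u * cis psi) (a ^ 2)
      (c * Cpowz q (- n) * cis (- psi)) *
    Cpowz t n in
  let denominator : C :=
    qpochs_inf q
      [c * cis psi; c * cis (- psi); a ^ 2 * c * cis psi; b * q / c; 1 / t;
       a * b * t * u; a * b * t / u] in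
  (qregular q (a * c / u) ->
   is_Zseries summand
     (qpochs_inf q
        [RtoC q; b * cis (- psi); c * cis psi / t; a ^ 2 * b * t * cis psi;
         b * q * t / c; a * c * u; a * c / u] / denominator *
      W87 q (a ^ 2 * c * cis psi / q)
        (a * u * cis psi) (a * cis psi / u) (c * cis psi) (a ^ 2 * t)
        (c / (b * t)) (b * cis (- psi)))) /\
  ((exists j : nat, a * c / u = / (q ^ j)) ->
   is_Zseries summand
     (qpochs_inf q
        [RtoC q; b * cis (- psi); c * cis psi / t; a ^ 2 * b * t * cis psi;
         b * q * t / c; a * c * u] / denominator *
      W87_termwise q (a ^ 2 * c * cis psi / q)
        (a * u * cis psi) (a * cis psi / u) (c * cis psi) (a ^ 2 * t)
        (c / (b * t)) (b * cis (- psi)))).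
Proof.
  intros summand denominator.
  assert (Hq := Cmod_q q hq).
  assert (Hee := cis_mult_opp psi). assert (He1 := Cmod_cis psi). assert (Heb1 := Cmod_cis (- psi)).
  set (e := cis psi) in *. set (eb := cis (- psi)) in *. clearbody e eb.
  assert (He0 : e <> 0) by (apply Cmod_gt_0; lra).
  assert (Heb0 : eb <> 0) by (apply Cmod_gt_0; lra).
  assert (Eeb : eb = / e) by (rewrite <- (Cmult_1_l (/ e)), <- Hee; field; exact He0).
  assert (Rbq : qregular q (b * q / c)) by (apply (qregular_in _ _ _ hphi); simpl; auto).
  assert (Rs : qregular q (a ^ 2)) by (apply (qregular_in _ _ _ hphi); simpl; auto).
  assert (Rce : qregular q (c * e)) by (apply (qregular_in _ _ _ hpref); simpl; auto).
  assert (Rceb : qregular q (c * eb)) by (apply (qregular_in _ _ _ hpref); simpl; auto).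
  assert (Ral : qregular q (a ^ 2 * c * e)) by (apply (qregular_in _ _ _ hpref); simpl; auto).
  assert (Rt : qregular q (1 / t)) by (apply (qregular_in _ _ _ hpref); simpl; auto 10).
  assert (Rp : qregular q (a * b * t * u)) by (apply (qregular_in _ _ _ hpref); simpl; auto 10).
  assert (Rm : qregular q (a * b * t / u)) by (apply (qregular_in _ _ _ hpref); simpl; auto 10).
  assert (Rw : qregular q (a * c * u)) by (apply (qregular_in _ _ _ hW); simpl; auto 10).
  assert (Rct : qregular q (c * e / t)) by (apply (qregular_in _ _ _ hW); simpl; auto 10).
  assert (Rabt : qregular q (a ^ 2 * b * t * e)) by (apply (qregular_in _ _ _ hW); simpl; auto 10).
  clear hphi hpref hW.
  assert (Hta1 : (Cmod (/ t) < 1)%R).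
  { rewrite Cmod_inv by exact ht0. rewrite <- Rinv_1. apply Rinv_lt_contravar; lra. }
  assert (Hta0 : / t <> 0).
  { intros E. apply C1_nz. rewrite <- (Cinv_r t ht0), E. ring. }
  assert (Hy0 : b * t <> 0) by (apply Cmult_neq_0; assumption).
  assert (Habu : (0 < Cmod (a * b * u))%R) by (apply Cmod_gt_0; repeat apply Cmult_neq_0; assumption).
  assert (HB1 : (Cmod (a * u) * Cmod (b * t) < 1)%R).
  { rewrite <- Cmod_mult. replace (a * u * (b * t)) with (a * b * u * t) by ring.
    rewrite Cmod_mult. apply Rlt_le_trans with (Cmod (a * b * u) * / Cmod (a * b * u))%R.
    - apply Rmult_lt_compat_l; lra.
    - rewrite Rinv_r; lra. }
  assert (HB2 : (Cmod (/ t) * Cmod (b * t) < 1)%R).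
  { rewrite <- Cmod_mult. replace (/ t * (b * t)) with b by (field; exact ht0). exact hb. }
  assert (Hgrow : forall rho, (Cmod (a * u) < rho)%R ->
     exists M, (0 < M)%R /\ forall l, (Cmod (phi2 q a u e (c * eb / RtoC q ^ l)) <= M * rho ^ l)%R).
  { intros rho Hrho. exact (spectral_growth Hq a c u e eb rho Hee He1 Heb1 ha0 hc0 hu0 ha hpsi' Rs hspec Hrho). }
  assert (Rct' : qregular q (c * e * / t)) by exact Rct.
  assert (HZ0 : c * eb <> 0) by (apply Cmult_neq_0; assumption).
  assert (Hz0 : c * e <> 0) by (apply Cmult_neq_0; assumption).
  assert (Hid := vwp_identity Hq a c u e eb (/ t) Hee He1 Heb1 ha0 hc0 hu0 Hta0 Hta1 hpsi' Rs Rw Rct' Ral hW1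
     Hgrow (b * t) Hy0 HB1 HB2).
  assert (Hqn := qpow_neq0 Hq).
  (* the first 2phi1 has the upper parameter [q / (c e)], its grid is [c e q^n] *)
  set (K := laurent_const q (b * eb) (b * q / c) (c * e)).
  assert (HLHS : is_Zseries summand (K * double_sum q a c u e eb (/ t) (b * t))).
  { destruct (double_term_bound Hq a c u e eb (/ t) Heb1 hc0 Hta1 hpsi' Rs Hgrow (b * t) Hy0 HB1 HB2)
      as (KK & X & W & HK & HX & HW & Hbnd).
    destruct (double_series_by_difference _ KK X W HK HX HW Hbnd) as (s1 & s2 & D1 & D2 & D3 & _ & _ & _).
    unfold double_sum. rewrite (Cseries_eq _ _ D3).
    assert (HA0 : b * eb <> 0) by (apply Cmult_neq_0; assumption).
    assert (HA1 : (Cmod (b * eb) < 1)%R) by (rewrite Cmod_mult, Heb1; lra).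
    assert (EB : q * eb / c = q / (c * e)) by (rewrite Eeb; field; auto).
    assert (EA : forall k, qshift q (b * eb) (b * q / c) k = b ^ k * qshift q eb (q / c) k).
    { intros k. rewrite <- qshift_scale. f_equal. unfold Cdiv. ring. }
    exists (K * s1), (K * s2). split; [|split; [|ring]].
    - apply (is_Cseries_scal K) in D1. revert D1. apply is_Cseries_ext. intros n.
      unfold summand. rewrite Cpowz_neg.
      replace (Cpowz t (Z.of_nat n)) with (t ^ n).
      2:{ destruct n as [|n]; [reflexivity|]. simpl. rewrite SuccNat2Pos.id_succ. reflexivity. }
      replace (c * / RtoC q ^ n * e) with (c * e / RtoC q ^ n) by (field; auto).
      replace (c * / RtoC q ^ n * eb) with (c * eb / RtoC q ^ n) by (field; auto).
      assert (Rn : qregular q (c * e / RtoC q ^ n)).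
      { assert (H := proj1 (not_in_qZ_regular Hq (c * e) 0 n hpsi Hz0)). simpl in H.
        rewrite Cmult_1_r in H. exact H. }
      assert (Rn' : qregular q (c * eb / RtoC q ^ n)).
      { assert (H := proj1 (not_in_qZ_regular Hq (c * eb) 0 n hpsi' HZ0)). simpl in H.
        rewrite Cmult_1_r in H. exact H. }
      rewrite (phi21_jackson_swap q _ _ _ _ hq Rbq Rn), (phi21_jackson q _ _ _ _ hq Rs Rn').
      rewrite EB. assert (HL := laurent_expansion_pos Hq (b * eb) (b * q / c) (c * e) n HA0 Hz0 HA1 Rbq Rce Rn).
      fold K in HL.
      set (g := jackson q (a * e / u) (a * u * e) (a ^ 2) (c * eb / RtoC q ^ n) / qpoch_inf q (c * eb / RtoC q ^ n)).
      set (f := jackson q (q / (c * e)) (b * eb) (b * q / c) (c * e / RtoC q ^ n) / qpoch_inf q (c * e / RtoC q ^ n)) in *.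
      apply (is_Cseries_scal (g * t ^ n)) in HL.
      symmetry. replace (f * g * t ^ n) with (g * t ^ n * f) by ring.
      apply (Cseries_factor (fun m => g * t ^ n * (K * (qshift q (b * eb) (b * q / c) (n + m) / qpoch q q (n + m) *
        (qpoch q (c * e) m / qpoch q q m))))); [|exact HL].
      intros m. unfold double_term, row_coef, col_term, phi2.
      replace (c * eb * RtoC q ^ m / RtoC q ^ (n + m)) with (c * eb / RtoC q ^ n).
      2:{ rewrite Cpow_add_r. field. auto. }
      fold g. rewrite EA, Cpow_mult_l, (Cpow_add_r t n m), Cpow_inv by exact ht0.
      assert (Htm : t ^ m <> 0) by (apply Cpow_nz, ht0).
      assert (H1 := qpoch_q_neq0 Hq (n + m)). assert (H2 := qpoch_q_neq0 Hq m). field. auto.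
    - apply (is_Cseries_scal K) in D2. revert D2. apply is_Cseries_ext. intros p.
      unfold summand. rewrite Z.opp_involutive, Cpowz_nat.
      replace (Cpowz t (- Z.of_nat (S p))) with (/ t ^ S p).
      2:{ simpl. rewrite SuccNat2Pos.id_succ. reflexivity. }
      set (p1 := S p).
      replace (c * RtoC q ^ p1 * e) with (c * e * RtoC q ^ p1) by ring.
      replace (c * RtoC q ^ p1 * eb) with (c * eb * RtoC q ^ p1) by ring.
      rewrite (phi21_jackson_swap q _ _ _ _ hq Rbq (qregular_shift _ p1 Rce)),
        (phi21_jackson q _ _ _ _ hq Rs (qregular_shift _ p1 Rceb)).
      rewrite EB. assert (HL := laurent_expansion_neg Hq (b * eb) (b * q / c) (c * e) p1 HA0 Hz0 HA1 Rbq Rce).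
      fold K in HL.
      set (g := jackson q (a * e / u) (a * u * e) (a ^ 2) (c * eb * RtoC q ^ p1) / qpoch_inf q (c * eb * RtoC q ^ p1)).
      set (f := jackson q (q / (c * e)) (b * eb) (b * q / c) (c * e * RtoC q ^ p1) / qpoch_inf q (c * e * RtoC q ^ p1)) in *.
      apply (is_Cseries_scal (g * / t ^ p1)) in HL.
      symmetry. replace (f * g * / t ^ p1) with (g * / t ^ p1 * f) by ring.
      apply (Cseries_factor (fun l => g * / t ^ p1 * (K * (qshift q (b * eb) (b * q / c) l / qpoch q q l *
        (qpoch q (c * e) (p1 + l) / qpoch q q (p1 + l)))))); [|exact HL].
      intros l. unfold double_term, row_coef, col_term, phi2.
      replace (c * eb * RtoC q ^ (p1 + l) / RtoC q ^ l) with (c * eb * RtoC q ^ p1).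
      2:{ rewrite Cpow_add_r. field. auto. }
      fold g. rewrite EA, Cpow_mult_l, Cpow_inv, (Cpow_add_r t p1 l) by exact ht0.
      assert (Htl : t ^ l <> 0) by (apply Cpow_nz, ht0).
      assert (Htp : t ^ p1 <> 0) by (apply Cpow_nz, ht0).
      assert (H1 := qpoch_q_neq0 Hq l). assert (H2 := qpoch_q_neq0 Hq (p1 + l)). field. auto. }
  assert (HPp := qpoch_inf_neq0 Hq _ Rp). assert (HPm := qpoch_inf_neq0 Hq _ Rm).
  assert (HPt := qpoch_inf_neq0 Hq _ Rt). assert (HPce := qpoch_inf_neq0 Hq _ Rce).
  assert (HPceb := qpoch_inf_neq0 Hq _ Rceb). assert (HPal := qpoch_inf_neq0 Hq _ Ral).
  assert (HPbq := qpoch_inf_neq0 Hq _ Rbq).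
  set (pre := qpoch_inf q q * qpoch_inf q (b * eb) * qpoch_inf q (a * c * u) /
     (qpoch_inf q (c * e) * qpoch_inf q (c * eb) * qpoch_inf q (a ^ 2 * c * e) * qpoch_inf q (b * q / c) *
      qpoch_inf q (1 / t) * qpoch_inf q (a * b * t * u) * qpoch_inf q (a * b * t / u))).
  assert (HRHS : K * double_sum q a c u e eb (/ t) (b * t) = pre * vwp_sum q a c u e eb (/ t) (b * t)).
  { replace (a * u * (b * t)) with (a * b * t * u) in Hid by ring.
    replace (a / u * (b * t)) with (a * b * t / u) in Hid by (field; exact hu0).
    unfold pre. unfold vwp_const in Hid.
    replace (/ t) with (1 / t) in * by (field; exact ht0).
    set (Dd := double_sum _ _ _ _ _ _ _ _) in *. set (V := vwp_sum _ _ _ _ _ _ _ _) in *.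
    transitivity (K * (qpoch_inf q (a * b * t * u) * qpoch_inf q (a * b * t / u) * Dd) /
      (qpoch_inf q (a * b * t * u) * qpoch_inf q (a * b * t / u))); [field; auto|].
    rewrite Hid. unfold K, laurent_const. field. repeat split; auto. }
  rewrite HRHS in HLHS. clear Hid HRHS.
  destruct (vwp_sum_has_ps Hq a c u e eb (/ t) Heb1 Hta0 Rs Rw hW1 (Cmod (b * t)) ltac:(apply Cmod_gt_0, Hy0) HB2)
    as [MV [_ HV]].
  assert (HVs := abs_le_is_series _ _ (HV (b * t) (Rle_refl _))).
  fold (vwp_sum q a c u e eb (/ t) (b * t)) in HVs.
  assert (Q0 := q_neq0 Hq).
  assert (Ea4 : a ^ 2 * c * e / q * q / (a * u * e) = a * c / u) by (field; auto).
  assert (Ea5 : a ^ 2 * c * e / q * q / (a * e / u) = a * c * u) by (field; auto).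
  assert (Ea6 : a ^ 2 * c * e / q * q / (c * e) = a ^ 2) by (field; auto).
  assert (Ea7 : a ^ 2 * c * e / q * q / (a ^ 2 * t) = c * e / t) by (field; auto).
  assert (Ea8 : a ^ 2 * c * e / q * q / (c / (b * t)) = a ^ 2 * b * t * e) by (field; auto).
  set (L := qpoch_inf q (c * e / t) * qpoch_inf q (a ^ 2 * b * t * e) * qpoch_inf q (b * q * t / c)).
  (* [(X q^k;q)_oo = (X;q)_oo / (X;q)_k] brings back the quotients of the 8W7 *)
  assert (Hterm : forall k, vwp_coef q a c u e eb (/ t) k * vwp_factor q a c e k (b * t) =
    L * ((1 - a ^ 2 * c * e / q * RtoC q ^ (2 * k)) / (1 - a ^ 2 * c * e / q) *
     ((qpoch q (a ^ 2 * c * e / q) k * qpoch q (a * u * e) k * qpoch q (a * e / u) k * qpoch q (c * e) k *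
       qpoch q (a ^ 2 * t) k * qpoch q (c / (b * t)) k) /
      (qpoch q q k * qpoch q (a * c * u) k * qpoch q (a ^ 2) k * qpoch q (c * e / t) k * qpoch q (a ^ 2 * b * t * e) k) *
      qpoch_inf q (a * c / u * RtoC q ^ k)) * (b * eb) ^ k)).
  { intros k. unfold vwp_coef, vwp_factor, L.
    replace (a ^ 2 * e * RtoC q ^ k * (b * t)) with (a ^ 2 * b * t * e * RtoC q ^ k) by ring.
    replace (q / c * (b * t)) with (b * q * t / c) by (field; exact hc0).
    replace (c * e * / t * RtoC q ^ k) with (c * e / t * RtoC q ^ k) by (field; exact ht0).
    rewrite (qshift_qpoch (b * t) c k Hy0), (qshift_qpoch (/ t) (a ^ 2) k Hta0).
    replace (a ^ 2 / / t) with (a ^ 2 * t) by (field; exact ht0).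
    rewrite (qpoch_inf_split Hq (c * e / t) k), (qpoch_inf_split Hq (a ^ 2 * b * t * e) k).
    rewrite !Cpow_mult_l, Cpow_inv by exact ht0.
    assert (H1 := qpoch_q_neq0 Hq k). assert (H2 := qpoch_neq0 _ k Rw). assert (H3 := qpoch_neq0 _ k Rs).
    assert (H4 := qpoch_neq0 _ k Rct). assert (H5 := qpoch_neq0 _ k Rabt).
    assert (H6 : 1 - a ^ 2 * c * e / q <> 0) by exact (one_minus_alpha_neq0 a c e hW1).
    assert (H7 : t ^ k <> 0) by (apply Cpow_nz, ht0).
    set (z1 := 1 - a ^ 2 * c * e / q) in *.
    generalize (1 - a ^ 2 * c * e / q * RtoC q ^ (2 * k)). intros z2. clearbody z1.
    generalize (qpoch q (a ^ 2 * c * e / q) k). intros z3.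
    generalize (qpoch q (a * e / u) k). intros z4.
    generalize (qpoch q (c / (b * t)) k). intros z5.
    generalize (qpoch_inf q (a * c / u * RtoC q ^ k)). intros z6.
    generalize (qpoch_inf q (b * q * t / c)). intros z7.
    generalize (qpoch_inf q (c * e / t * RtoC q ^ k)). intros z8.
    generalize dependent (qpoch q (c * e / t) k). intros z9 H4.
    field. repeat split; auto. }
  clear HV. unfold denominator, qpochs_inf, Cprod. cbn [map fold_right].
  split.
  - intros Rx.
    set (g := fun k => (1 - a ^ 2 * c * e / q * RtoC q ^ (2 * k)) / (1 - a ^ 2 * c * e / q) *
      (qpochs q [a ^ 2 * c * e / q; a * u * e; a * e / u; c * e; a ^ 2 * t; c / (b * t)] k /
       qpochs q [RtoC q; a ^ 2 * c * e / q * q / (a * u * e); a ^ 2 * c * e / q * q / (a * e / u);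
         a ^ 2 * c * e / q * q / (c * e); a ^ 2 * c * e / q * q / (a ^ 2 * t); a ^ 2 * c * e / q * q / (c / (b * t))] k) *
      (b * eb) ^ k).
    assert (EV : vwp_sum q a c u e eb (/ t) (b * t) = L * qpoch_inf q (a * c / u) * Cseries g).
    { refine (Cseries_factor _ g _ _ _ HVs). intros k. rewrite Hterm. unfold g.
      rewrite Ea4, Ea5, Ea6, Ea7, Ea8. unfold qpochs, Cprod. cbn [map fold_right].
      rewrite (qpoch_inf_split Hq (a * c / u) k). assert (H := qpoch_neq0 _ k Rx).
      assert (H1 := qpoch_q_neq0 Hq k). assert (H2 := qpoch_neq0 _ k Rw). assert (H3 := qpoch_neq0 _ k Rs).
      assert (H4 := qpoch_neq0 _ k Rct). assert (H5 := qpoch_neq0 _ k Rabt).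
      set (z1 := (1 - a ^ 2 * c * e / q * RtoC q ^ (2 * k)) / (1 - a ^ 2 * c * e / q)).
      field. repeat split; auto. }
    unfold W87. fold g.
    match goal with |- is_Zseries _ ?v => replace v with (pre * vwp_sum q a c u e eb (/ t) (b * t)) end;
      [exact HLHS|].
    rewrite EV. unfold pre, L. field. repeat split; auto.
  - intros _.
    set (g := fun k => (1 - a ^ 2 * c * e / q * RtoC q ^ (2 * k)) / (1 - a ^ 2 * c * e / q) *
      (qpochs q [a ^ 2 * c * e / q; a * u * e; a * e / u; c * e; a ^ 2 * t; c / (b * t)] k /
       qpochs q [RtoC q; a ^ 2 * c * e / q * q / (a * e / u);
         a ^ 2 * c * e / q * q / (c * e); a ^ 2 * c * e / q * q / (a ^ 2 * t); a ^ 2 * c * e / q * q / (c / (b * t))] k *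
       qpoch_inf q (a ^ 2 * c * e / q * q / (a * u * e) * RtoC q ^ k)) *
      (b * eb) ^ k).
    assert (EV : vwp_sum q a c u e eb (/ t) (b * t) = L * Cseries g).
    { refine (Cseries_factor _ g _ _ _ HVs). intros k. rewrite Hterm. unfold g.
      rewrite Ea4, Ea5, Ea6, Ea7, Ea8. unfold qpochs, Cprod. cbn [map fold_right].
      unfold Cdiv. rewrite !Cmult_1_r, !Cinv_product. ring. }
    unfold W87_termwise. fold g.
    match goal with |- is_Zseries _ ?v => replace v with (pre * vwp_sum q a c u e eb (/ t) (b * t)) end;
      [exact HLHS|].
    rewrite EV. unfold pre, L. field. repeat split; auto.
Qed.
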